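(* Let $\Gamma$ be a countable discrete abelian group with infinite exponent, and let $\mathbf{T} = \hat{\Gamma}$ be its Pontryagin dual. If $\mathbf{T}$ is topologically Kronecker-generated, then there is a sequence $(r_n)_{n \in \mathbb{N}}$ in $\Gamma$ such that, for every $t \in \Gamma$, $(r_n - t)_{n \in \mathbb{N}}$ is a freely rigid-recurrent sequence.
   Context: The exponent of an abelian group is the smallest $n\in\mathbb{N}$ with $nx=0$ for every $x$ (infinite if there is none). $\mathbb{T}$ is the unit circle and $\mathbf{T}=\hat\Gamma$ is the compact group of homomorphisms $\chi:\Gamma\to\mathbb{T}$. A set $K\subseteq\mathbf{T}$ is a Kronecker set if for every continuous $f:K\to\mathbb{T}$ and every $\varepsilon>0$ there is $g\in\Gamma$ with $\sup_{\chi\in K}|f(\chi)-\chi(g)|<\varepsilon$. With $\Lambda_q$ the group of $q$th roots of unity and $D_q=\prod_{n=1}^\infty\Lambda_q$, a subset $K$ of a closed copy of $D_q$ in $\mathbf{T}$ is of type $K_q$ if for every continuous $f:K\to\Lambda_q$ there is $g\in\Gamma$ with $f(\chi)=\chi(g)$ for all $\chi\in K$. A compact metrizable abelian group $G$ that has infinite exponent or is isomorphic to $D_q$ for some $q\ge2$ is topologically Kronecker-generated if there is a perfect set $K\subseteq G$ (closed, no isolated points) such that $K$ is a Kronecker set or a set of type $K_q$ and the subgroup $\langle K\rangle$ generated by $K$ is dense in $G$. A measure-preserving system (or action) for $\Gamma$ is a quadruple $(X, \mathcal{B}, \mu, (T_g)_{g \in \Gamma})$, where $(X,\mathcal{B},\mu)$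 is a non-atomic Lebesgue probability space and $(T_g)_{g\in\Gamma}$ is an action of $\Gamma$ by measure-preserving transformations. A sequence $(a_n)$ in $\Gamma$ is a rigidity sequence for the system if $\|f\circ T_{a_n} - f\|_2 \to 0$ for every $f \in L^2(\mu)$. The system is free if $\mu(\{x : T_gx = x\}) = 0$ for every $g\in\Gamma\setminus\{0\}$. A set $R\subseteq\Gamma$ is a set of recurrence if for every measure-preserving system and every $A\in\mathcal{B}$ with $\mu(A)>0$ there is $r\in R\setminus\{0\}$ with $\mu(A\cap T_r^{-1}A)>0$. A sequence $(r_n)_{n\in\mathbb{N}}$ in $\Gamma$ is freely rigid-recurrent if it is a rigidity sequence for a free action of $\Gamma$ and $\{r_n : n\in\mathbb{N}\}$ is a set of recurrence. *)

(* Defs.v *)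
From HB Require Import structures.
From mathcomp Require Import all_boot all_order all_algebra.
From mathcomp Require Import all_classical all_reals all_analysis.
From mathcomp Require Import complex.

Set Implicit Arguments.
Unset Strict Implicit.
Unset Printing Implicit Defensive.

Import Order.TTheory GRing.Theory Num.Theory.
Import numFieldNormedType.Exports.

Local Open Scope classical_set_scope.
Local Open Scope ring_scope.

Definition infinite_exponent (G : zmodType) : Prop :=
  ~ exists n : nat, (0 < n)%N /\ forall x : G, x *+ n = 0.

Section groups_of_functions.
Variable R : realType.

(* Compact abelian groups are represented as sets of functions I -> C with the
   topology of pointwise convergence and the pointwise multiplication; the
   dual of G and D_q are closed in the ambient product, so that closed, perfect
   and dense subsets of them can be described by the ambient topology. *)
Local Notation C := (R[i]^o).

Definition circle : set C := [set z : C | `|z| = 1].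

Definition roots_of_unity (q : nat) : set C := [set z : C | z ^+ q = 1].

Definition dual (G : zmodType) : set {ptws G -> C} :=
  [set chi | (forall g, circle (chi g)) /\
             forall g h, chi (g + h) = chi g * chi h].
Arguments dual : clear implicits.

Definition torsion_product (q : nat) : set {ptws nat -> C} :=
  [set x | forall n, roots_of_unity q (x n)].

Definition infinite_exponent_mul (I : Type) (A : set {ptws I -> C}) : Prop :=
  ~ exists n : nat, (0 < n)%N /\
    forall x, A x -> (fun i => x i ^+ n) = (fun=> 1).

Definition is_subgroup (I : Type) (H : set {ptws I -> C}) : Prop :=
  [/\ H (fun=> 1),
      forall x y, H x -> H y -> H (fun i => x i * y i) &
      forall x, H x -> H (fun i => (x i)^-1)].

Definition generated (I : Type) (K : set {ptws I -> C}) : set {ptws I -> C} :=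
  smallest (@is_subgroup I) K.

Definition topologically_isomorphic (I J : Type)
    (A : set {ptws I -> C}) (B : set {ptws J -> C}) : Prop :=
  exists (phi : {ptws I -> C} -> {ptws J -> C})
         (psi : {ptws J -> C} -> {ptws I -> C}),
    [/\ (forall x, A x -> B (phi x) /\ psi (phi x) = x),
        (forall y, B y -> A (psi y) /\ phi (psi y) = y),
        (forall x y, A x -> A y ->
           phi (fun i => x i * y i) = (fun j => phi x j * phi y j)),
        {within A, continuous phi} &
        {within B, continuous psi}].

(* The norm of R[i] takes values in R[i], hence the real part. *)
Definition kronecker_set (G : zmodType) (K : set {ptws G -> C}) : Prop :=
  K `<=` dual G /\
  forall f : {ptws G -> C} -> C,
    {within K, continuous f} -> (forall chi, K chi -> circle (f chi)) ->
    forall eps : R, 0 < eps ->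
      exists g : G,
        (ereal_sup [set (complex.Re `|f chi - chi g|)%:E | chi in K]
           < eps%:E)%E.

Definition type_K (q : nat) (G : zmodType) (K : set {ptws G -> C}) : Prop :=
  (exists H : set {ptws G -> C},
     [/\ closed H, H `<=` dual G,
         topologically_isomorphic (torsion_product q) H & K `<=` H]) /\
  forall f : {ptws G -> C} -> C,
    {within K, continuous f} ->
    (forall chi, K chi -> roots_of_unity q (f chi)) ->
    exists g : G, forall chi, K chi -> f chi = chi g.

(* This is a property of the dual of G; its first conjunct is the class of
   groups for which the notion is defined. *)
Definition topologically_kronecker_generated (G : zmodType) : Prop :=
  (infinite_exponent_mul (dual G) \/
   exists q : nat, (2 <= q)%N /\
     topologically_isomorphic (torsion_product q) (dual G)) /\
  exists K : set {ptws G -> C},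
    [/\ K `<=` dual G, perfect_set K,
        kronecker_set K \/ (exists q : nat, (2 <= q)%N /\ type_K q K) &
        dual G `<=` closure (generated K)].

End groups_of_functions.

Arguments dual : clear implicits.
Arguments topologically_kronecker_generated : clear implicits.

Section systems.
Variable R : realType.

Local Notation lambda := (@completed_lebesgue_measure R).

Definition lebesgue_measurable (A : set R) : Prop :=
  @measurable _ (caratheodory_type ((wlength (@idfun R))^*)%mu) A.

(* Isomorphic mod 0 to [0, 1] with its Lebesgue-measurable sets. *)
Definition nonatomic_lebesgue_space (d : measure_display)
    (X : measurableType d) (mu : probability X R) : Prop :=
  exists (X0 : set X) (Y0 : set R) (phi : X -> R),
    [/\ measurable X0 /\ mu X0 = 1%E,
        [/\ lebesgue_measurable Y0, Y0 `<=` `[0, 1] & lambda Y0 = 1%E],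
        set_bij X0 Y0 phi &
        forall A : set X, A `<=` X0 ->
          (measurable A <-> lebesgue_measurable (phi @` A)) /\
          (measurable A -> mu A = lambda (phi @` A))].

Definition measure_preserving_system (G : zmodType) (d : measure_display)
    (X : measurableType d) (mu : probability X R) (T : G -> X -> X) : Prop :=
  [/\ nonatomic_lebesgue_space mu,
      T 0 = id,
      forall g h, T (g + h) = T g \o T h,
      forall g, measurable_fun setT (T g) &
      forall g A, measurable A -> mu (T g @^-1` A) = mu A].

Definition rigidity_sequence (G : zmodType) (d : measure_display)
    (X : measurableType d) (mu : probability X R) (T : G -> X -> X)
    (a : nat -> G) : Prop :=
  forall f : X -> R, f \in Lfun mu 2%:E ->
    'N[mu]_2%:E[EFin \o (f \o T (a n) \- f)%R]%E @[n --> \oo] --> 0%E.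

(* The fixed-point sets are asked to be null in the completion of mu: they need
   not be measurable if the sigma-algebra is not complete. *)
Definition free_system (G : zmodType) (d : measure_display)
    (X : measurableType d) (mu : probability X R) (T : G -> X -> X) : Prop :=
  forall g : G, g != 0 -> mu.-negligible [set x | T g x = x].

Definition set_of_recurrence (G : zmodType) (S : set G) : Prop :=
  forall (d : measure_display) (X : measurableType d) (mu : probability X R)
    (T : G -> X -> X), measure_preserving_system mu T ->
  forall A : set X, measurable A -> (0 < mu A)%E ->
  exists r : G, [/\ S r, r != 0 & (0 < mu (A `&` T r @^-1` A))%E].

Definition freely_rigid_recurrent (G : zmodType) (r : nat -> G) : Prop :=
  (exists (d : measure_display) (X : measurableType d) (mu : probability X R)
     (T : G -> X -> X),
     [/\ measure_preserving_system mu T, free_system mu T &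
         rigidity_sequence mu T r]) /\
  set_of_recurrence (range r).

End systems.

Arguments freely_rigid_recurrent : clear implicits.

(* Main.v *)
(* A set K of type K_q with a dense generated subgroup would make q kill every
   element of Gamma, because characters separate points; hence K is a Kronecker
   set. Nested pieces of K indexed by binary words code a character Phi_c for
   every binary sequence c, and by the Kronecker property one element of Gamma
   takes nearly prescribed values on all pieces of a given length. Let (s, h)
   enumerate Gamma^2, let i be the position of the first zero of c and put
   tau(c) = Phi_c(s_i); the pieces are chosen such that Phi_c(h_i) <> 1.

   There is (r_n) with Phi_c(r_n) -> tau(c) in measure for which every r_n - t
   gives a set of recurrence: measure concentration on the cube [m]^W, W being
   the words of a given length, yields returns of a set of positive measure
   along sums of k_w g_w with k_w = 1 mod m for most w, and the g_w are free to
   be chosen such that the value of t plus this sum is nearly tau.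

   For a fixed t let X be a sequence of independent pairs (v, u) in [0, 1)^2 and
   let g rotate u by the argument of Phi_c(g), c being the digits of v, if
   s_i = t, and by 0 otherwise. On this event
   |Phi_c(r_n - t) - 1| = |Phi_c(r_n) - Phi_c(t)| -> 0, so (r_n - t) is a
   rigidity sequence. The event that (s_i, h_i) = (t, g) has a positive
   probability and is met by almost every sequence of pairs, so g has a null set
   of fixed points. The space X is coded by the digits of one number in [0, 1).
   *)
Require Import Defs.
From HB Require Import structures.
From mathcomp Require Import all_boot all_order all_algebra.
From mathcomp Require Import all_classical all_reals all_analysis.
From mathcomp Require Import measurable_realfun complex.
From mathcomp Require Import ring lra.

Set Implicit Arguments.
Unset Strict Implicit.
Unset Printing Implicit Defensive.

Import Order.TTheory GRing.Theory Num.Theory.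
Import numFieldNormedType.Exports.

Local Open Scope classical_set_scope.
Local Open Scope ring_scope.

(** * Binary expansions of numbers in [0, 1) *)

Section binary_digits.
Variable R : realType.
Implicit Types (x y : R) (c : nat -> bool).

(** One sequence has to serve every t, while the rigidity of [r n - t] needs tau = Phi_c(t). Hence
    tau follows each element of Gamma on an event of positive probability, and the rotation is
    switched off elsewhere. With a single pair (v, u) the action would then be trivial on a set of
    positive measure; this is why infinitely many independent pairs are used. Concentration takes
    place in (Z/m)^W: a coordinate of x that follows that of y modulo m may differ from it by 1 - m
    as an integer. The values prescribed for the g_w are therefore m-th roots of unity b, for which
    b^(1-m) = b. In dimension N = 2^n the exceptional coordinates number O(sqrt N) for a fixed
    measure of the set. They are a vanishing fraction of the words, all of measure 2^-n, but they
    cannot be excluded; so the convergence to tau is in measure and not uniform. With X coded in [0,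
    1), the identity shows that X is a Lebesgue space. The price is that independence, invariance
    and rigidity have to be read off from binary digits. *)

Definition unit_itv : set R := `[0, 1[%classic.

Lemma unit_itvP x : unit_itv x <-> 0 <= x < 1.
Proof. by rewrite /unit_itv /= in_itv. Qed.

Definition bit0 x : bool := 2^-1 <= x.
(** The doubling map of [0, 1). Its itinerary gives a dyadic number the expansion that ends in
    zeros. *)
Definition dbl x : R := 2 * x - (bit0 x)%:R.
Definition bit (n : nat) x : bool := bit0 (iter n dbl x).

Lemma dbl_unit x : unit_itv x -> unit_itv (dbl x).
Proof.
move=> /unit_itvP x01; apply/unit_itvP; rewrite /dbl /bit0.
by case: (lerP 2^-1 x) => h /=; apply/andP; move: x01 => /andP[]; split; lra.
Qed.

Lemma iter_dbl_unit n x : unit_itv x -> unit_itv (iter n dbl x).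
Proof. by move=> x01; elim: n => //= n; exact: dbl_unit. Qed.

Lemma bitS n x : bit n.+1 x = bit n (dbl x).
Proof. by rewrite /bit iterSr. Qed.

Definition bin_sum c (n : nat) : R := \sum_(i < n) (c i)%:R * 2^-1 ^+ i.+1.
Definition real_of c : R := limn (bin_sum c).

Lemma bin_sumS c n :
  bin_sum c n.+1 = ((c 0%N)%:R + bin_sum (fun i => c i.+1) n) / 2.
Proof.
rewrite /bin_sum big_ord_recl expr1 mulrDl mulr_suml; congr (_ + _).
by apply: eq_bigr => i _; rewrite -mulrA -exprSr.
Qed.

Lemma bin_sum_le1 c n : bin_sum c n <= 1.
Proof.
elim: n c => [|n IHn] c; first by rewrite /bin_sum big_ord0.
rewrite bin_sumS; have := IHn (fun i => c i.+1).
by case: (c 0%N) => /= h; lra.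
Qed.

Lemma nondecreasing_bin_sum c : nondecreasing_seq (bin_sum c).
Proof.
apply/nondecreasing_seqP => n; rewrite /bin_sum big_ord_recr /= lerDl.
by rewrite mulr_ge0// exprn_ge0.
Qed.

Lemma bin_sum_cvg c : bin_sum c @ \oo --> real_of c.
Proof.
apply: nondecreasing_is_cvgn; first exact: nondecreasing_bin_sum.
by exists 1 => _ [n _ <-]; exact: bin_sum_le1.
Qed.

Lemma real_ofS c : real_of c = ((c 0%N)%:R + real_of (fun i => c i.+1)) / 2.
Proof.
apply: cvg_lim => //; rewrite -cvg_shiftS.
rewrite (_ : [sequence _]_n =
    (fun n => ((c 0%N)%:R + bin_sum (fun i => c i.+1) n) / 2)); last first.
  by apply/funext => n; rewrite /= bin_sumS.
by apply: cvgMl; apply: cvgD; [exact: cvg_cst|exact: bin_sum_cvg].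
Qed.

Lemma real_of_ge0 c : 0 <= real_of c.
Proof.
rewrite -[0](_ : bin_sum c 0 = _); last by rewrite /bin_sum big_ord0.
apply: nondecreasing_cvgn_le; first exact: nondecreasing_bin_sum.
by apply/cvg_ex; exists (real_of c); exact: bin_sum_cvg.
Qed.

Lemma real_of_le1 c : real_of c <= 1.
Proof.
apply: limr_le; last by near=> n; exact: bin_sum_le1.
by apply/cvg_ex; exists (real_of c); exact: bin_sum_cvg.
Unshelve. all: by end_near. Qed.

Lemma real_of_lt1 c n : ~~ c n -> real_of c < 1.
Proof.
elim: n c => [|n IHn] c cn; rewrite real_ofS.
  by rewrite (negbTE cn) /=; have := real_of_le1 (fun i => c i.+1); lra.
by have := IHn (fun i => c i.+1) cn; case: (c 0%N) => /= h; lra.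
Qed.

(** Exactly the digit sequences of numbers in [0, 1): [real_of] and [bit] are inverse to each other
    between the two. *)
Definition not_eventually1 c := forall n, exists2 m, (n <= m)%N & ~~ c m.

Lemma real_of_unit c : not_eventually1 c -> unit_itv (real_of c).
Proof.
move=> /(_ 0%N)[m _ cm]; apply/unit_itvP.
by rewrite real_of_ge0 (real_of_lt1 cm).
Qed.

Lemma not_eventually1S c :
  not_eventually1 c -> not_eventually1 (fun i => c i.+1).
Proof. by move=> h n; have [[|m] // nm cm] := h n.+1; exists m. Qed.

Lemma bit0_real_of c : not_eventually1 c -> bit0 (real_of c) = c 0%N.
Proof.
move=> h; rewrite /bit0 real_ofS.
have /unit_itvP := real_of_unit (not_eventually1S h).
move: (real_of _) => y /andP[y0 y1]; case: (c 0%N) => /=.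
  by apply/idP; lra.
by apply/negbTE; rewrite -ltNge; lra.
Qed.

Lemma dbl_real_of c :
  not_eventually1 c -> dbl (real_of c) = real_of (fun i => c i.+1).
Proof. by move=> h; rewrite /dbl bit0_real_of// [in LHS]real_ofS; lra. Qed.

Lemma bit_real_of c n : not_eventually1 c -> bit n (real_of c) = c n.
Proof.
elim: n c => [|n IHn] c h; first exact: bit0_real_of.
by rewrite bitS dbl_real_of// IHn//; exact: not_eventually1S.
Qed.

Lemma bin_sum_bit n x :
  x = bin_sum (fun i => bit i x) n + iter n dbl x * 2^-1 ^+ n.
Proof.
elim: n x => [|n IHn] x; first by rewrite /bin_sum big_ord0 add0r mulr1.
rewrite bin_sumS.
rewrite [X in bin_sum X](_ : _ = fun i => bit i (dbl x)); last first.
  by apply/funext => i; rewrite bitS.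
have := IHn (dbl x); rewrite -iterSr => IH.
have -> : iter n.+1 dbl x * 2^-1 ^+ n.+1 =
    (dbl x - bin_sum (fun i => bit i (dbl x)) n) / 2.
  rewrite (_ : dbl x - _ = iter n.+1 dbl x * 2^-1 ^+ n) ?exprSr ?mulrA//.
  by rewrite {1}IH [X in X - _]addrC addrK.
move: (bin_sum _ _) => b; rewrite /bit /= /dbl; lra.
Qed.

Lemma real_ofK x : unit_itv x -> real_of (fun i => bit i x) = x.
Proof.
move=> x01; apply: cvg_lim => //.
rewrite (_ : bin_sum _ = (fun n => x - iter n dbl x * 2^-1 ^+ n)); last first.
  by apply/funext => n; rewrite {2}(bin_sum_bit n x) addrK.
rewrite -[X in _ --> X]subr0; apply: cvgB; first exact: cvg_cst.
apply: (@squeeze_cvgr _ _ _ _ (fun=> 0) (fun n => 2^-1 ^+ n)).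
- near=> n; have /unit_itvP /andP[y0 y1] := iter_dbl_unit n x01.
  by rewrite mulr_ge0 ?exprn_ge0//= ler_piMl ?exprn_ge0// ltW.
- exact: cvg_cst.
- by apply: cvg_expr; rewrite ger0_norm//; lra.
Unshelve. all: by end_near. Qed.

Lemma real_of_cst1 : real_of (fun=> true) = 1.
Proof. by have := real_ofS (fun=> true) => /= h; lra. Qed.

Lemma bit_iter n m x : bit n (iter m dbl x) = bit (m + n) x.
Proof. by rewrite /bit -iterD addnC. Qed.

(** A tail of ones would make some iterate of the doubling map equal to 1, which lies outside [0,
    1). *)
Lemma bit_not_eventually1 x :
  unit_itv x -> not_eventually1 (fun i => bit i x).
Proof.
move=> x01 n; apply: contrapT => h.
have /unit_itvP := iter_dbl_unit n x01.
rewrite -(real_ofK (iter_dbl_unit n x01)).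
rewrite [X in real_of X](_ : _ = fun=> true) ?real_of_cst1 ?ltxx ?andbF//.
apply/funext => i; rewrite bit_iter; apply: contrapT => /negP hi.
by apply: h; exists (n + i)%N => //; exact: leq_addr.
Qed.

(* Binary expansions are ordered lexicographically. *)
Lemma ltr_bit x y : unit_itv x -> unit_itv y -> x < y <->
  exists n, [/\ forall i, (i < n)%N -> bit i x = bit i y,
    ~~ bit n x & bit n y].
Proof.
have E n x' y' : (forall i, (i < n)%N -> bit i x' = bit i y') ->
    y' - x' = (iter n dbl y' - iter n dbl x') * 2^-1 ^+ n.
  move=> exy; rewrite {1}(bin_sum_bit n x') {1}(bin_sum_bit n y').
  rewrite (_ : bin_sum (fun i => bit i x') n = bin_sum (fun i => bit i y') n).
    by rewrite mulrBl; lra.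
  by apply: eq_bigr => i _; rewrite exy.
have F x' y' : (exists n, [/\ forall i, (i < n)%N -> bit i x' = bit i y',
    ~~ bit n x' & bit n y']) -> x' < y'.
  move=> [n [exy bx by_]]; rewrite -subr_gt0 (E n)// pmulr_lgt0 ?exprn_gt0//.
  by move: bx by_; rewrite /bit /bit0 -ltNge; lra.
move=> x01 y01; split=> [xy|]; last exact: F.
have [n bn] : exists n, bit n x != bit n y.
  apply: contrapT => h; suff : x = y by move=> e; rewrite e ltxx in xy.
  rewrite -(real_ofK x01) -(real_ofK y01); congr real_of.
  by apply/funext => i; apply: contrapT => /eqP hi; apply: h; exists i.
have Pn : exists n, bit n x != bit n y by exists n.
case: (ex_minnP Pn) => m bm mmin.
have eqm i : (i < m)%N -> bit i x = bit i y.
  by move=> im; apply: contraTeq im => /mmin; rewrite -leqNgt.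
exists m; case bx: (bit m x); case by_: (bit m y) bm => //; rewrite bx // => _.
suff : y < x by move=> /(lt_trans xy); rewrite ltxx.
by apply: F; exists m; rewrite bx by_; split=> // i im; rewrite eqm.
Qed.

End binary_digits.

(** * The uniform distribution on [0, 1) *)

Section uniform_measure.
Variable R : realType.
Local Notation lambda := (@lebesgue_measure R).
Implicit Types (A : set R).

(* Named so as to be usable where the measurability of [f] cannot be inferred. *)
Definition image_measure d d' (T1 : measurableType d) (T2 : measurableType d')
    (m : {measure set T1 -> \bar R}) (f : T1 -> T2)
    (mf : measurable_fun setT f) : {measure set T2 -> \bar R} :=
  measure_function_pushforward__canonical__measure_function_Measure m mf.

Lemma measurable_affine (a b : R) :
  measurable_fun setT (fun x : R => a * x + b).
Proof. by apply: measurable_funD => //; exact: measurable_funM. Qed.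

(** The image measure scaled by [a] agrees with Lebesgue measure on half-open intervals, hence
    everywhere. *)
Lemma lebesgue_measure_affine (a b : R) A : 0 < a -> measurable A ->
  lambda ((fun x => a * x + b) @^-1` A) = (a^-1%:E * lambda A)%E.
Proof.
move=> a0 mA; pose a' := NngNum (ltW a0).
pose m : {measure set (measurableTypeR R) -> \bar R} :=
  mscale a' (@image_measure _ _ (measurableTypeR R) (measurableTypeR R)
    lambda _ (measurable_affine a b)).
suff -> : lambda A = m A.
  by rewrite /m /= /mscale /= /pushforward muleA -EFinM mulVf ?mul1e// gt_eqF.
refine (@lebesgue_measure_unique R m _ A mA) => _ [[u v] _ <-].
rewrite /m /= /mscale /= /pushforward.
rewrite (_ : _ @^-1` _ = `](u - b) / a, (v - b) / a]%classic); last first.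
  apply/seteqP; split=> x /=; rewrite !in_itv /= ltr_pdivrMr// ler_pdivlMr//.
    by rewrite ltrBlDr lerBrDr [x * a]mulrC.
  by rewrite ltrBlDr lerBrDr [x * a]mulrC.
rewrite -[X in (_ * X)%E]/(lambda _) !lebesgue_measure_itv /= !lte_fin
  ltr_pM2r ?invr_gt0// ltrD2r.
case: ifPn => uv; last by rewrite mule0.
by rewrite -!EFinB -EFinM; congr (_%:E); field; rewrite gt_eqF.
Qed.

Lemma measurable_unit_itv : measurable (@unit_itv R).
Proof. exact: measurable_itv. Qed.

(** A measure on all of R, so that maps stay functions from R to R and the points outside [0, 1) are
    merely a null set. *)
Definition unif (A : set R) : \bar R := lambda (A `&` @unit_itv R).

Let unif0 : unif set0 = 0%E.
Proof. by rewrite /unif set0I measure0. Qed.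

Let unif_ge0 A : (0 <= unif A)%E.
Proof. exact: measure_ge0. Qed.

Let unif_sigma_additive : semi_sigma_additive unif.
Proof.
exact: (@measure_semi_sigma_additive _ (measurableTypeR R) R
  (mrestr lambda measurable_unit_itv)).
Qed.

HB.instance Definition _ := isMeasure.Build _ _ _ unif
  unif0 unif_ge0 unif_sigma_additive.

Let unif_setT : unif setT = 1%E.
Proof.
rewrite /unif setTI /unit_itv.
by rewrite lebesgue_measure_itv /= lte_fin ltr01 -EFinB subr0.
Qed.

HB.instance Definition _ :=
  Measure_isProbability.Build _ _ _ unif unif_setT.

Lemma unifE A : unif A = lambda (A `&` @unit_itv R).
Proof. by []. Qed.

End uniform_measure.
Arguments unif : simpl never.

(** * Independence of the digits, uniqueness of the uniform distribution, rotations *)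

Section uniform_measure_theory.
Variable R : realType.
Local Notation lambda := (@lebesgue_measure R).
Local Notation unif := (@unif R).
Implicit Types (A : set R).

Lemma unif_setI_unit A : unif (A `&` @unit_itv R) = unif A.
Proof. by rewrite !unifE -setIA setIid. Qed.

Lemma unif_eq_unit A B : (forall x, unit_itv x -> A x <-> B x) ->
  unif A = unif B.
Proof.
move=> AB; rewrite !unifE; congr (lambda _); apply/seteqP.
by split=> x [Ax x01]; split=> //; move: Ax; rewrite AB.
Qed.

Lemma measurable_bit0 : measurable_fun setT (@bit0 R).
Proof. exact: measurable_fun_ler. Qed.

Lemma measurable_bool_natr : measurable_fun setT (fun b : bool => b%:R : R).
Proof. by []. Qed.

Lemma measurable_dbl : measurable_fun setT (@dbl R).
Proof.
apply: measurable_funB; first exact: measurable_funM.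
exact: (measurableT_comp measurable_bool_natr measurable_bit0).
Qed.

Lemma measurable_bit n : measurable_fun setT (@bit R n).
Proof.
rewrite /bit; apply: (measurableT_comp measurable_bit0).
elim: n => [|n IHn]; first exact: measurable_id.
exact: (measurableT_comp measurable_dbl IHn).
Qed.

Lemma measurable_bit_eq n b : measurable [set x : R | bit n x = b].
Proof.
rewrite -[X in measurable X]setTI.
exact: (measurable_bit n measurableT (Y := [set b])).
Qed.

(** On each half of [0, 1) the doubling map is affine of slope 2 and onto. *)
Lemma unif_dbl (b : bool) A : measurable A ->
  unif ([set x | bit0 x = b] `&` @dbl R @^-1` A) = (2^-1%:E * unif A)%E.
Proof.
move=> mA; rewrite !unifE -(@lebesgue_measure_affine R 2 (- b%:R))//; last first.
  by apply: measurableI => //; exact: measurable_unit_itv.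
congr (lambda _); apply/seteqP; split=> x /=.
  move=> [[<- Ax] x01]; split=> //; exact: dbl_unit.
rewrite /unit_itv /= !in_itv /= => -[Ax /andP[x0 x1]].
have bx : bit0 x = b.
  by rewrite /bit0; case: b x0 x1 {Ax} => /= x0 x1;
    [apply/idP|apply/negbTE; rewrite -ltNge]; lra.
rewrite /dbl bx; split => //; apply/andP.
by case: b x0 x1 {Ax bx} => /= x0 x1; split; lra.
Qed.

Lemma unif_dbl_preimage A : measurable A -> unif (@dbl R @^-1` A) = unif A.
Proof.
move=> mA.
have mD : measurable (@dbl R @^-1` A).
  by rewrite -[X in measurable X]setTI; exact: measurable_dbl.
have -> : @dbl R @^-1` A = ([set x | bit0 x = true] `&` @dbl R @^-1` A) `|`
   ([set x | bit0 x = false] `&` @dbl R @^-1` A).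
  rewrite -setIUl [X in X `&` _](_ : _ = setT) ?setTI//.
  by apply/seteqP; split=> // x _ /=; case: (bit0 x); [left|right].
rewrite measureU//=.
- rewrite !unif_dbl// -ge0_muleDl ?lee_fin ?invr_ge0// -EFinD.
  by rewrite (_ : 2^-1 + 2^-1 = 1) ?mul1e//; lra.
- by apply: measurableI => //; exact: (measurable_bit_eq 0).
- by apply: measurableI => //; exact: (measurable_bit_eq 0).
- by apply/seteqP; split=> // x [[/= -> _] []].
Qed.

Definition cylinder (s : seq nat) (c : nat -> bool) : set R :=
  [set x | forall m, m \in s -> bit m x = c m].

Lemma cylinder_cons m s c :
  cylinder (m :: s) c = [set x | bit m x = c m] `&` cylinder s c.
Proof.
apply/seteqP; split=> x /=.
  by move=> h; split=> [|i ii]; apply: h; rewrite inE ?eqxx// ii orbT.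
by move=> [h1 h2] i; rewrite inE => /orP[/eqP->//|]; exact: h2.
Qed.

Lemma measurable_cylinder s c : measurable (cylinder s c).
Proof.
elim: s => [|m s IHs].
  by rewrite (_ : cylinder _ _ = setT)//; apply/seteqP; split.
by rewrite cylinder_cons; apply: measurableI => //; exact: measurable_bit_eq.
Qed.

(** Giving the positions by a predicate below a bound is stable under the shift by which [dbl]
    removes the first digit, and so fits an induction on the bound. *)
Let prefix_cylinder n (p : pred nat) c : set R :=
  [set x | forall m, (m < n)%N -> p m -> bit m x = c m].

Let prefix_cylinderE n p c :
  prefix_cylinder n p c = cylinder [seq m <- iota 0 n | p m] c.
Proof.
apply/seteqP; split=> x h m.
  by rewrite mem_filter mem_iota /= => /andP[pm mn]; apply: h.
by move=> mn pm; apply: h; rewrite mem_filter pm mem_iota.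
Qed.

Let unif_prefix_cylinder n p c :
  unif (prefix_cylinder n p c) = (2^-1 ^+ count p (iota 0 n))%:E.
Proof.
elim: n p c => [|n IHn] p c.
  rewrite [X in unif X](_ : _ = setT) ?probability_setT//.
  by apply/seteqP; split.
pose p' m := p m.+1; pose c' m := c m.+1.
have mC : measurable (prefix_cylinder n p' c').
  by rewrite prefix_cylinderE; exact: measurable_cylinder.
have count_iotaS : count p (iota 1 n) = count p' (iota 0 n).
  by rewrite (iotaDl 1 0) count_map.
rewrite [iota 0 n.+1]/= [count _ _]/= count_iotaS; case p0: (p 0%N).
  rewrite add1n exprS EFinM -(IHn p' c') -(unif_dbl (c 0%N))//.
  congr (unif _); apply/seteqP; split=> x /=.
    move=> h; split; first exact: (h 0%N).
    by move=> m mn pm; rewrite -bitS; exact: h.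
  by move=> [h0 h] [|m] mn pm //; rewrite bitS; exact: h.
rewrite add0n -(IHn p' c') -(unif_dbl_preimage mC).
congr (unif _); apply/seteqP; split=> x /=.
  by move=> h m mn pm; rewrite -bitS; exact: h.
move=> h [|m] mn pm //; first by rewrite p0 in pm.
by rewrite bitS; exact: h.
Qed.

Lemma unif_cylinder s c : uniq s ->
  unif (cylinder s c) = (2^-1 ^+ size s)%:E.
Proof.
move=> us; pose n := (\max_(m <- s) m).+1.
have sn m : m \in s -> (m < n)%N.
  by move=> ms; rewrite /n ltnS; exact: (@leq_bigmax_seq _ s xpredT id).
have -> : size s = count (mem s) (iota 0 n).
  rewrite -size_filter; apply/perm_size/uniq_perm => //.
    exact/filter_uniq/iota_uniq.
  move=> m; rewrite mem_filter mem_iota /= add0n.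
  by rewrite [m \in mem s]/=; case ms: (m \in s) => //=; rewrite sn.
rewrite -(@unif_prefix_cylinder _ _ c).
congr (unif _); apply/seteqP; split=> x h m; last by move=> ms; apply: h => //; exact: sn.
by move=> _ ms; exact: h.
Qed.

Definition cell (n : nat) (c : nat -> bool) : set R :=
  cylinder (iota 0 n) c.

Lemma cellP n c x : cell n c x <-> forall m, (m < n)%N -> bit m x = c m.
Proof.
by split=> h m hm; apply: h; rewrite ?mem_iota// -[_ \in _]/(m \in iota 0 n)
  in hm *; move: hm; rewrite mem_iota.
Qed.

Lemma unif_cell n c : unif (cell n c) = (2^-1 ^+ n)%:E.
Proof. by rewrite unif_cylinder ?iota_uniq// size_iota. Qed.

(** Rays generate the Borel sets. By the lexicographic order, the part in [0, 1) of the ray below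
    [a] is a disjoint union of dyadic cells, one for each digit 1 of [a]: the point agrees with [a]
    up to there and has the digit 0 instead. *)
Lemma unif_unique (m : {measure set R -> \bar R}) :
    m (@unit_itv R) = 1%E -> m (~` @unit_itv R) = 0%E ->
    (forall n c, m (cell n c `&` @unit_itv R) = (2^-1 ^+ n)%:E) ->
  forall A, measurable A -> m A = unif A.
Proof.
move=> m1 m0 mcell A mA.
have mU := @measurable_unit_itv R.
have m_unit B : measurable B -> m B = m (B `&` @unit_itv R).
  move=> mB; rewrite -{1}(setIT B) -(setUv (@unit_itv R)) setIUr measureU//=.
  - rewrite (_ : m (B `&` ~` _) = 0%E) ?adde0//.
    apply/eqP; rewrite eq_le measure_ge0 andbT -m0; apply: le_measure;
      rewrite ?inE//; last exact: measurableC.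
    by apply: measurableI => //; exact: measurableC.
  - exact: measurableI.
  - by apply: measurableI => //; exact: measurableC.
  - by rewrite setIACA setICr setI0.
have mT : m setT = 1%E by rewrite m_unit// setTI.
pose G : set (set R) := [set B | exists a, B = `]-oo, a[%classic].
apply: (measure_unique G (fun n => `]-oo, n%:R[%classic)) => //.
- exact: RGenInftyO.measurableE.
- move=> _ _ [a ->] [b ->]; exists (Order.min a b).
  apply/seteqP; split=> x /=; rewrite !in_itv /= lt_min.
    by move=> [-> ->].
  by move=> /andP[-> ->].
- by move=> i; exists i%:R.
- apply/seteqP; split=> // x _; exists (Num.truncn x).+1 => //=.
  by rewrite in_itv /= truncnS_gt.
- move=> _ [a ->] /=; rewrite m_unit// -[in RHS]unif_setI_unit.
  have [a0|a0] := lerP a 0.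
    rewrite (_ : _ `&` _ = set0) ?measure0//.
    apply/seteqP; split=> // x [] /=; rewrite /unit_itv /= !in_itv /=.
    by move=> xa /andP[x0 _]; have := le_lt_trans x0 (lt_le_trans xa a0);
       rewrite ltxx.
  have [a1|a1] := lerP 1 a.
    rewrite (_ : _ `&` _ = @unit_itv R); last first.
      apply/seteqP; split=> [x []//|x x01]; split=> //=.
      move/unit_itvP : x01 => /andP[_ x1]; rewrite in_itv /=.
      exact: lt_le_trans x1 a1.
    by rewrite m1 -[X in unif X]setTI unif_setI_unit probability_setT.
  have a01 : unit_itv a by apply/unit_itvP; rewrite (ltW a0).
  pose F n : set R := if bit n a then
      cylinder [:: n] (fun=> false) `&` cell n (fun i => bit i a) `&` @unit_itv R
    else set0.
  have mF n : measurable (F n).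
    rewrite /F; case: ifP => // _; apply: measurableI => //.
    by apply: measurableI; exact: measurable_cylinder.
  have -> : `]-oo, a[%classic `&` @unit_itv R = \bigcup_n F n.
    apply/seteqP; split=> x /=.
      rewrite in_itv /= => -[/ltr_bit-/(_ _ a01)xa x01].
      have [n [h1 h2 h3]] := xa x01.
      exists n => //; rewrite /F h3; split=> //; split.
        by move=> i; rewrite inE => /eqP ->; exact/negbTE.
      by apply/cellP.
    move=> [n _]; rewrite /F; case: ifP => // bn [[hn /cellP hc] x01].
    split=> //=; rewrite in_itv /=; apply/ltr_bit => //; exists n; split=> //.
    by rewrite hn// inE.
  have tF : trivIset setT F.
    apply/trivIsetP => i j _ _; rewrite neq_ltn => ij.
    apply/seteqP; split=> // x []; rewrite /F; case: ifP => // bi.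
    move=> [[hi /cellP ci] _]; case: ifP => // bj [[hj /cellP cj] _].
    case/orP: ij => ij.
      by have := cj _ ij; rewrite hi ?inE// bi.
    by have := ci _ ij; rewrite hj ?inE// bj.
  rewrite !measure_semi_bigcup//; try exact: bigcup_measurable.
  apply: eq_eseriesr => n _; rewrite /F; case: ifP => bn; last by rewrite !measure0.
  have -> : cylinder [:: n] (fun=> false) `&` cell n (fun i => bit i a) =
      cell n.+1 (fun i => if i == n then false else bit i a).
    apply/seteqP; split=> x.
      move=> [hn /cellP hc]; apply/cellP => i; rewrite ltnS leq_eqVlt.
      by case: eqP => /= [-> _|_]; [rewrite hn ?inE|exact: hc].
    move=> /cellP hc; split=> [i|].
      by rewrite inE => /eqP ->; rewrite hc// eqxx.
    by apply/cellP => i hi; rewrite hc ?ltn_eqF// ltnW.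
  by rewrite mcell /= unif_setI_unit unif_cell.
- by move=> k; apply: le_lt_trans (ltry 1); rewrite -mT le_measure ?inE.
Qed.

Definition rotation (a u : R) : R := if u + a < 1 then u + a else u + a - 1.

Lemma rotation_unit a u : unit_itv a -> unit_itv u -> unit_itv (rotation a u).
Proof.
move=> /unit_itvP/andP[a0 a1] /unit_itvP/andP[u0 u1]; apply/unit_itvP/andP.
by rewrite /rotation; case: ltrP => h; split; lra.
Qed.

(** The set is cut at [a]; the preimage of either part is a translate of it. *)
Lemma unif_rotation a A : unit_itv a -> measurable A ->
  unif (rotation a @^-1` A) = unif A.
Proof.
move=> /unit_itvP/andP[a0 a1] mA; rewrite !unifE.
pose A1 := A `&` `[a, 1[%classic; pose A2 := A `&` `[0, a[%classic.
have mA1 : measurable A1 by exact: measurableI.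
have mA2 : measurable A2 by exact: measurableI.
have -> : A `&` @unit_itv R = A1 `|` A2.
  rewrite /A1 /A2 -setIUr; congr (_ `&` _).
  apply/seteqP; split=> x /=; rewrite /unit_itv /= !in_itv /=.
    by move=> /andP[x0 x1]; rewrite x0 x1 andbT; case: (lerP a x); [left|right].
  by case=> /andP[h1 h2]; rewrite ?(le_trans a0 h1) ?h2 ?h1 ?(lt_trans h2 a1).
have m1 : measurable ((fun x => 1 * x + a) @^-1` A1).
  by rewrite -[X in measurable X]setTI; exact: measurable_affine.
have m2 : measurable ((fun x => 1 * x + (a - 1)) @^-1` A2).
  by rewrite -[X in measurable X]setTI; exact: measurable_affine.
have -> : rotation a @^-1` A `&` @unit_itv R =
    (fun x => 1 * x + a) @^-1` A1 `|` (fun x => 1 * x + (a - 1)) @^-1` A2.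
  apply/seteqP; split=> x.
    rewrite /unit_itv /rotation /A1 /A2 /= !in_itv /= mul1r addrA.
    move=> [+ /andP[x0 x1]]; case: ltrP => h Ax; [left|right]; split=> //.
      by rewrite lerDr x0.
    by apply/andP; split; lra.
  rewrite /unit_itv /rotation /A1 /A2 /= !in_itv /= mul1r addrA.
  case=> -[Ax /andP[h1 h2]].
    by rewrite h2; split=> //; apply/andP; split; lra.
  case: ltrP => h; first by exfalso; lra.
  by split=> //; apply/andP; split; lra.
rewrite !measureU//.
- by rewrite /= !lebesgue_measure_affine// invr1 !mul1e.
- apply/seteqP; split=> // x [[_ /=]]; rewrite in_itv /= => /andP[h1 h2] [_ /=].
  by rewrite in_itv /= => /andP[h3 h4]; lra.
- apply/seteqP; split=> // x [[_ /=]]; rewrite in_itv /= => /andP[h1 h2] [_ /=].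
  by rewrite in_itv /= => /andP[h3 h4]; lra.
Qed.

End uniform_measure_theory.

(** * Independent coordinates coded in the digits of one number *)

Lemma probability_setI_full d (T : measurableType d) (R : realType)
    (P : probability T R) (B D : set T) :
  measurable B -> measurable D -> P D = 1%E -> P (B `&` D) = P B.
Proof.
move=> mB mD PD; apply/eqP; rewrite eq_le le_measure ?inE//=; last first.
  exact: measurableI.
have PDC : P (~` D) = 0%E by rewrite probability_setC// PD subee.
rewrite -{1}(setIT B) -(setUv D) setIUr.
apply: le_trans (measureU2 _ _ _) _.
- exact: measurableI.
- by apply: measurableI => //; exact: measurableC.
rewrite -[leRHS]adde0 leeD2l// -PDC.
by apply: le_measure; rewrite ?inE//; [apply: measurableI => //|]; exact: measurableC.
Qed.

Lemma measurable_real_of d (T : measurableType d) (R : realType)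
    (c : T -> nat -> bool) :
  (forall n, measurable_fun setT (c ^~ n)) ->
  measurable_fun setT (fun t => real_of R (c t)).
Proof.
move=> mc; apply: (@measurable_fun_cvg _ _ _ _ (fun n t => bin_sum R (c t) n)).
  move=> n; apply: measurable_sum => i; apply: measurable_funM => //.
  by apply: (measurableT_comp (@measurable_bool_natr R)); exact: mc.
by move=> t _; exact: bin_sum_cvg.
Qed.

Section resampling.
Variable R : realType.
Local Notation unif := (@unif R).
Local Notation unit_itv := (@unit_itv R).

(* The [i]-th digit of the [j]-th coordinate is at the position [pos j i]. *)
Variables (pos : nat -> nat -> nat) (pos1 pos2 : nat -> nat).
Hypotheses (posK1 : forall j i, pos1 (pos j i) = j)
  (posK2 : forall j i, pos2 (pos j i) = i)
  (posK : forall m, pos (pos1 m) (pos2 m) = m).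
Implicit Types (x u v : R) (j : nat).

Definition coord j x : R := real_of R (fun i => bit (pos j i) x).

(** The point [x] with its j-th coordinate replaced by [u]. That a uniform independent [u] leaves
    the distribution of the point uniform plays the role of Fubini's theorem for one coordinate
    against all the others. *)
Definition resample j x u : R :=
  real_of R (fun m => if pos1 m == j then bit (pos2 m) u else bit m x).

Lemma measurable_coord j : measurable_fun setT (coord j).
Proof. by apply: measurable_real_of => n; exact: measurable_bit. Qed.

Lemma measurable_resample j :
  measurable_fun setT (fun z : R * R => resample j z.1 z.2).
Proof.
apply: measurable_real_of => n; case: (pos1 n == j).
  exact: (measurableT_comp (@measurable_bit R _) measurable_snd).
exact: (measurableT_comp (@measurable_bit R _) measurable_fst).
Qed.

Lemma not_eventually1_coord j (c : nat -> bool) :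
  not_eventually1 (fun i => c (pos j i)) -> not_eventually1 c.
Proof.
(* An index beyond [pos2 m] for all m < n can only sit at a position at least n. *)
move=> h n; have [i ni ci] := h (\max_(m < n) (pos2 m).+1)%N.
exists (pos j i) => //; rewrite leqNgt; apply/negP => lt.
have := leq_trans (leq_bigmax (Ordinal lt)) ni.
by rewrite /= posK2 ltnn.
Qed.

Lemma not_eventually1_resample j x u : unit_itv u ->
  not_eventually1 (fun m => if pos1 m == j then bit (pos2 m) u else bit m x).
Proof.
move=> u01; apply: (@not_eventually1_coord j).
rewrite (_ : (fun i => _) = (fun i => bit i u)).
  exact: bit_not_eventually1.
by apply/funext => i; rewrite posK1 eqxx posK2.
Qed.

Lemma resample_unit j x u : unit_itv u -> unit_itv (resample j x u).
Proof. by move=> u01; apply: real_of_unit; exact: not_eventually1_resample. Qed.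

Lemma bit_resample j x u m : unit_itv u ->
  bit m (resample j x u) = if pos1 m == j then bit (pos2 m) u else bit m x.
Proof.
by move=> u01; rewrite bit_real_of//; exact: not_eventually1_resample.
Qed.

Lemma coord_resample j x u : unit_itv u -> coord j (resample j x u) = u.
Proof.
move=> u01; rewrite -[RHS]real_ofK//; congr real_of; apply/funext => i.
by rewrite bit_resample// posK1 eqxx posK2.
Qed.

Lemma coord_resample_neq j j' x u : unit_itv u -> j' != j ->
  coord j' (resample j x u) = coord j' x.
Proof.
move=> u01 jj'; congr real_of; apply/funext => i.
by rewrite bit_resample// posK1 (negbTE jj').
Qed.

Lemma resample_resample j x u v : unit_itv u ->
  resample j (resample j x u) v = resample j x v.
Proof.
move=> u01; congr real_of; apply/funext => m.
by case: ifP => // jm; rewrite bit_resample// jm.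
Qed.

Let resampling_set j (A : set R) : set (R * R) :=
  (fun z => resample j z.1 z.2) @^-1` A.

Let measurable_resampling_set j A :
  measurable A -> measurable (resampling_set j A).
Proof.
move=> mA; rewrite -[X in measurable X]setTI.
by apply: (measurable_resample j).
Qed.

Let unit_square : set (R * R) := unit_itv `*` unit_itv.

Let unif_unit : unif unit_itv = 1%E.
Proof. by rewrite -[X in unif X]setTI unif_setI_unit probability_setT. Qed.

Let measurable_unit_square : measurable unit_square.
Proof. by apply: measurableX; exact: measurable_unit_itv. Qed.

Let unif2_unit_square : (unif \x unif)%E unit_square = 1%E.
Proof.
rewrite /unit_square product_measure1E; try exact: measurable_unit_itv.
by rewrite -[LHS]/(unif _ * unif _)%E unif_unit mule1.
Qed.

(** The first n digits of the resampled point are digits of [x] at the positions outside coordinate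
    j and digits of [u] at the others. The two cylinders involve n positions in total, so each cell
    gets the measure 2^-n and [unif_unique] applies. *)
Lemma unif2_resample j A : measurable A ->
  (unif \x unif)%E (resampling_set j A) = unif A.
Proof.
pose mr : measurable_fun setT (fun z : R * R => resample j z.1 z.2) :=
  measurable_resample j.
pose nu : {measure set R -> \bar R} := image_measure (unif \x unif)%E mr.
have nuE B : nu B = (unif \x unif)%E (resampling_set j B) by [].
have mU := @measurable_unit_itv R.
rewrite -nuE; apply: unif_unique.
- rewrite nuE -(probability_setI_full _ _ unif2_unit_square)//; last first.
    exact: measurable_resampling_set.
  rewrite -unif2_unit_square; congr ((unif \x unif)%E _).
  apply/seteqP; split=> [z []//|z [z1 z2]]; split=> //.
  exact: resample_unit.
- rewrite nuE -(probability_setI_full _ _ unif2_unit_square)//; last first.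
    by apply: measurable_resampling_set; exact: measurableC.
  rewrite (_ : _ `&` _ = set0) ?measure0//.
  by apply/seteqP; split=> // z [nz [z1 z2]]; apply: nz; exact: resample_unit.
- move=> n c.
  pose s1 := [seq m <- iota 0 n | pos1 m != j].
  pose s2 := [seq pos2 m | m <- iota 0 n & pos1 m == j].
  have us1 : uniq s1 by exact/filter_uniq/iota_uniq.
  have us2 : uniq s2.
    rewrite map_inj_in_uniq ?filter_uniq ?iota_uniq// => m m'.
    rewrite !mem_filter => /andP[/eqP mj _] /andP[/eqP mj' _] e.
    by rewrite -(posK m) -(posK m') mj mj' e.
  have ms1 := @measurable_cylinder R s1 c.
  have ms2 := @measurable_cylinder R s2 (fun i => c (pos j i)).
  transitivity ((unif \x unif)%E
      (cylinder s1 c `*` cylinder s2 (fun i => c (pos j i)))); last first.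
    rewrite product_measure1E// -[LHS]/(unif _ * unif _)%E.
    rewrite !unif_cylinder// -EFinM -exprD; congr ((2^-1 ^+ _)%:E).
    rewrite size_map !size_filter addnC.
    by rewrite (count_predC (fun m => pos1 m == j)) size_iota.
  rewrite nuE -(probability_setI_full _ _ unif2_unit_square)//; last first.
    apply: measurable_resampling_set; apply: measurableI => //.
    exact: measurable_cylinder.
  rewrite -[RHS](probability_setI_full _ _ unif2_unit_square)//; last first.
    exact: measurableX.
  congr ((unif \x unif)%E _); apply/seteqP; split=> z.
    move=> [[/cellP zn _] [z1 z2]]; split=> //; split=> m.
      rewrite mem_filter mem_iota /= add0n => /andP[mj mn].
      by rewrite -zn// bit_resample// (negbTE mj).
    move=> /mapP[k]; rewrite mem_filter mem_iota /= add0n => /andP[/eqP kj kn] ->.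
    by rewrite -[in RHS]kj posK -zn// bit_resample// kj eqxx.
  move=> [[h1 h2] [z1 z2]]; split=> //; split; last exact: resample_unit.
  apply/cellP => m mn; rewrite bit_resample//; case: ifPn => mj.
    rewrite h2.
      by rewrite -(eqP mj) posK.
    by apply/mapP; exists m => //; rewrite mem_filter mj mem_iota.
  by apply: h1; rewrite mem_filter mj mem_iota.
Qed.

Lemma unif_resample j A : measurable A ->
  unif A = (\int[unif]_x unif [set u | [/\ unit_itv x, unit_itv u &
    A (resample j x u)]])%E.
Proof.
move=> mA; rewrite -(unif2_resample j)//.
rewrite -(probability_setI_full _ _ unif2_unit_square)//; last first.
  exact: measurable_resampling_set.
apply: eq_integral => x _ /=; congr (unif _); apply/seteqP.
by split=> u; rewrite /xsection /= in_setE => -[]; [move=> Ax []|move=> ? ? ?].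
Qed.

Lemma unif_resample_eq j A B : measurable A -> measurable B ->
  (forall x, unit_itv x -> unif [set u | unit_itv u /\ A (resample j x u)] =
    unif [set u | unit_itv u /\ B (resample j x u)]) ->
  unif A = unif B.
Proof.
move=> mA mB AB; rewrite (unif_resample j mA) (unif_resample j mB).
apply: eq_integral => x _.
have E C : [set u | [/\ unit_itv x, unit_itv u & C (resample j x u)]] =
    if `[< unit_itv x >] then [set u | unit_itv u /\ C (resample j x u)]
    else set0.
  apply/seteqP; split=> u /=.
    by move=> [x01 u01 Cu]; rewrite (asboolT x01).
  by case: asboolP => // x01 [].
by rewrite (E A) (E B); case: asboolP => // x01; exact: AB.
Qed.

(** The last hypothesis says that [A] depends only on the coordinates other than j. The section over
    [x] is then [B] within [0, 1) or empty, according to whether [x] is in [A]. *)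
Lemma unif_coord_indep j A B : measurable A -> measurable B ->
  (forall x u, unit_itv x -> unit_itv u -> A (resample j x u) <-> A x) ->
  unif (A `&` coord j @^-1` B) = (unif A * unif B)%E.
Proof.
move=> mA mB hA.
have mcB : measurable (coord j @^-1` B).
  by rewrite -[X in measurable X]setTI; exact: (measurable_coord j).
rewrite (@unif_resample j); last exact: measurableI.
have -> : unif A = (\int[unif]_x (\1_(A `&` unit_itv) x)%:E)%E.
  rewrite integral_indic ?setIT//; last first.
    by apply: measurableI => //; exact: measurable_unit_itv.
  by rewrite [RHS]unif_setI_unit.
rewrite -ge0_integralZr//; last first.
  apply: measurableT_comp => //; apply: measurable_indic.
  by apply: measurableI => //; exact: measurable_unit_itv.
apply: eq_integral => x _; rewrite indicE; case: (boolP (x \in _)) => xA.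
  move: xA; rewrite inE => -[Ax x01]; rewrite mul1e.
  rewrite -[RHS]unif_setI_unit; congr (unif _); apply/seteqP; split=> u /=.
    by move=> [_ u01 [_]]; rewrite coord_resample.
  move=> [Bu u01]; split=> //; split; first exact/hA.
  by rewrite coord_resample.
rewrite mul0e (_ : [set _ | _] = set0) ?measure0//.
apply/seteqP; split=> // u [x01 u01 [/hA Ax _]].
by apply: (negP xA); rewrite inE; split=> //; exact: Ax.
Qed.

Lemma unif_coord j B : measurable B -> unif (coord j @^-1` B) = unif B.
Proof.
move=> mB; rewrite -[RHS]mul1e -(probability_setT unif).
by rewrite -(@unif_coord_indep j setT B measurableT mB)// setTI.
Qed.

End resampling.

(** * The skew product and the invariance of its measure *)

Lemma probability_negligibleC d (T : measurableType d) (R : realType)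
    (P : probability T R) (B : set T) :
  measurable B -> P.-negligible (~` B) -> P B = 1%E.
Proof.
move=> mB nB; rewrite -[B]setCK probability_setC; last exact: measurableC.
by rewrite (measure_negligible (measurableC mB) nB) sube0.
Qed.

Lemma rotation_comp (R : realType) (a b u : R) :
  unit_itv a -> unit_itv b -> unit_itv u ->
  rotation (rotation a b) u = rotation a (rotation b u).
Proof.
move=> /unit_itvP/andP[a0 a1] /unit_itvP/andP[b0 b1] /unit_itvP/andP[u0 u1].
rewrite /rotation.
case: (ltrP (b + a) 1) => h1; case: (ltrP (u + b) 1) => h2;
  do 2 (case: ltrP => ?); lra.
Qed.

Lemma rotation0 (R : realType) (u : R) : unit_itv u -> rotation 0 u = u.
Proof. by move=> /unit_itvP/andP[_ u1]; rewrite /rotation addr0 u1. Qed.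

Lemma measurable_rotation d (T : measurableType d) (R : realType) (f g : T -> R) :
  measurable_fun setT f -> measurable_fun setT g ->
  measurable_fun setT (fun t => rotation (f t) (g t)).
Proof.
move=> mf mg; apply: measurable_fun_ifT.
- by apply: measurable_fun_ltr => //; exact: measurable_funD.
- exact: measurable_funD.
- by apply: measurable_funB => //; exact: measurable_funD.
Qed.

Section skew_product.
Variable R : realType.
Local Notation unif := (@unif R).
Local Notation unit_itv := (@unit_itv R).
Variables (pos : nat -> nat -> nat) (pos1 pos2 : nat -> nat).
Hypotheses (posK1 : forall j i, pos1 (pos j i) = j)
  (posK2 : forall j i, pos2 (pos j i) = i)
  (posK : forall m, pos (pos1 m) (pos2 m) = m).
Local Notation coord := (@coord R pos).
Local Notation resample := (@resample R pos1 pos2).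

(** A coordinate whose digits end in ones cannot be recovered from its value under [real_of]. On
    this set of full measure [coord] and [merge] are inverse to each other. *)
Definition coord_domain : set R :=
  [set x | unit_itv x /\ forall j, not_eventually1 (fun i => bit (pos j i) x)].

Lemma measurable_not_eventually1 j :
  measurable [set x : R | not_eventually1 (fun i => bit (pos j i) x)].
Proof.
rewrite (_ : [set x | _] = \bigcap_n \bigcup_(i in [set i | (n <= i)%N])
    [set x : R | bit (pos j i) x = false]).
  apply: bigcapT_measurable => n; apply: bigcup_measurable => i _.
  exact: measurable_bit_eq.
apply/seteqP; split=> x h n.
  by move=> _; have [i ni bi] := h n; exists i => //=; exact/negbTE.
by have [i ni /= bi] := h n I; exists i => //; rewrite bi.
Qed.

Lemma measurable_coord_domain : measurable coord_domain.
Proof.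
rewrite (_ : coord_domain = unit_itv `&` \bigcap_j
    [set x : R | not_eventually1 (fun i => bit (pos j i) x)]).
  apply: measurableI; first exact: measurable_unit_itv.
  by apply: bigcapT_measurable => j; exact: measurable_not_eventually1.
by apply/seteqP; split=> x [x01 h]; split=> // j; [move=> _|]; exact: h.
Qed.

(** Having only ones from n on puts ones at k given positions for every k, which has probability
    2^-k. *)
Lemma unif_not_eventually1 j :
  unif [set x : R | not_eventually1 (fun i => bit (pos j i) x)] = 1%E.
Proof.
apply: probability_negligibleC; first exact: measurable_not_eventually1.
set E := [set x | _].
rewrite (_ : ~` E = \bigcup_n \bigcap_(i in [set i | (n <= i)%N])
    [set x : R | bit (pos j i) x = true]); last first.
  apply/seteqP; split=> x /=.
    move=> nE; apply: contrapT => h; apply: nE => n; apply: contrapT => hn.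
    apply: h; exists n => // i ni /=; apply: contrapT => /negP bi.
    by apply: hn; exists i.
  move=> [n _ h] Ex; have [i ni] := Ex n; apply/negP; rewrite negbK.
  exact: h.
apply: negligible_bigcup => n; set F := (X in _.-negligible X).
have mF : measurable F.
  by apply: bigcap_measurable; [exists n => /=|move=> i _; exact: measurable_bit_eq].
exists F; split => //; apply/eqP; rewrite eq_le measure_ge0 andbT.
apply/lee_addgt0Pr => e e0; rewrite add0e.
have [k ke] : exists k, 2^-1 ^+ k < e.
  have : (fun k => (2^-1 : R) ^+ k) @ \oo --> 0.
    by apply: cvg_expr; rewrite ger0_norm//; lra.
  move=> /cvgrPdist_lt /(_ _ e0)[k _ /(_ k)] /= /(_ (leqnn _)).
  by rewrite sub0r normrN ger0_norm ?exprn_ge0// => ?; exists k.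
pose s := [seq pos j i | i <- iota n k].
have us : uniq s.
  by rewrite map_inj_uniq ?iota_uniq// => i i' /(congr1 pos2); rewrite !posK2.
apply: (@le_trans _ _ (unif (cylinder s (fun=> true)))).
  apply: le_measure; rewrite ?inE//; first exact: measurable_cylinder.
  move=> x Fx _ /mapP[i + ->]; rewrite mem_iota => /andP[ni _].
  exact: Fx.
rewrite [leLHS](_ : _ = (2^-1 ^+ k)%:E) ?lee_fin ?ltW//.
by rewrite [LHS]unif_cylinder// size_map size_iota.
Qed.

Lemma negligible_coord_domainC : unif.-negligible (~` coord_domain).
Proof.
have negl (B : set R) : measurable B -> unif B = 1%E -> unif.-negligible (~` B).
  move=> mB B1; exists (~` B); split=> //; first exact: measurableC.
  by rewrite probability_setC//= B1 subee.
rewrite (_ : ~` coord_domain = ~` unit_itv `|` \bigcup_j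
    ~` [set x : R | not_eventually1 (fun i => bit (pos j i) x)]).
  apply: negligibleU.
    apply: negl; first exact: measurable_unit_itv.
    by rewrite -[X in unif X]setTI unif_setI_unit probability_setT.
  apply: negligible_bigcup => j; apply: negl.
    exact: measurable_not_eventually1.
  exact: unif_not_eventually1.
apply/seteqP; split=> x /=.
  move=> h; have [x01|] := pselect (unit_itv x); last by left.
  right; apply: contrapT => h'; apply: h; split=> // j; apply: contrapT => hj.
  by apply: h'; exists j.
by case=> [nx [] //|[j _ hj] [_ /(_ j)]].
Qed.

Lemma unif_eq_coord_domain A B : measurable A -> measurable B ->
  (forall x, coord_domain x -> A x <-> B x) -> unif A = unif B.
Proof.
have u1 : unif coord_domain = 1%E.
  apply: probability_negligibleC; first exact: measurable_coord_domain.
  exact: negligible_coord_domainC.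
have mD := measurable_coord_domain.
move=> mA mB AB; rewrite -(probability_setI_full mA mD u1).
rewrite -(probability_setI_full mB mD u1); congr (unif _); apply/seteqP.
by split=> x [Ax Dx]; split=> //; exact/AB.
Qed.

Lemma coord_unit x j : coord_domain x -> unit_itv (coord j x).
Proof. by move=> [_ h]; exact: real_of_unit. Qed.

Lemma bit_coord x j i : coord_domain x -> bit i (coord j x) = bit (pos j i) x.
Proof. by move=> [_ h]; rewrite bit_real_of. Qed.

Definition merge (y : nat -> R) : R :=
  real_of R (fun m => bit (pos2 m) (y (pos1 m))).

Lemma bit_merge y m : (forall j, unit_itv (y j)) ->
  bit m (merge y) = bit (pos2 m) (y (pos1 m)).
Proof.
move=> y01; rewrite bit_real_of//.
apply: (@not_eventually1_coord pos pos2 posK2 0) => n.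
have [i ni bi] := bit_not_eventually1 (y01 0%N) n.
by exists i => //; rewrite posK1 posK2.
Qed.

Lemma merge_domain y : (forall j, unit_itv (y j)) -> coord_domain (merge y).
Proof.
move=> y01.
have h j : not_eventually1 (fun i => bit (pos j i) (merge y)).
  move=> n; have [i ni bi] := bit_not_eventually1 (y01 j) n.
  by exists i => //; rewrite bit_merge// posK1 posK2.
split=> //; apply: real_of_unit.
have h' := @not_eventually1_coord pos pos2 posK2 0 (fun m => bit m (merge y)) (h 0%N).
move=> n; have [m nm bm] := h' n; exists m => //; rewrite -bit_merge//.
Qed.

Lemma coord_merge y j : (forall j, unit_itv (y j)) -> coord j (merge y) = y j.
Proof.
move=> y01; rewrite -[RHS]real_ofK//; congr real_of; apply/funext => i.
by rewrite bit_merge// posK1 posK2.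
Qed.

Lemma mergeK x : coord_domain x -> merge (coord ^~ x) = x.
Proof.
move=> Dx; rewrite -[RHS]real_ofK; last by case: Dx.
by congr real_of; apply/funext => m; rewrite bit_coord// posK.
Qed.

Variables (G : zmodType) (alpha : G -> R -> R).
Hypotheses (alpha_unit : forall g v, unit_itv (alpha g v))
  (malpha : forall g, measurable_fun setT (alpha g))
  (alpha0 : forall v, alpha 0 v = 0)
  (alphaD : forall g h v, alpha (g + h) v = rotation (alpha g v) (alpha h v)).

(* The coordinates of index 2j are fixed, and each of them determines the angle
   by which the coordinate of index 2j+1 is rotated. *)
Definition twist (g : G) (x : R) (j : nat) : R :=
  if odd j then rotation (alpha g (coord j.-1 x)) (coord j x) else coord j x.

(** The identity off [coord_domain] makes the group law hold at every point, as a measure-preserving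
    system requires, and not only almost everywhere. *)
Definition skew (g : G) (x : R) : R :=
  if `[< coord_domain x >] then merge (twist g x) else x.

Lemma twist_unit g x j : coord_domain x -> unit_itv (twist g x j).
Proof.
move=> Dx; rewrite /twist; case: ifP => _; last exact: coord_unit.
by apply: rotation_unit => //; exact: coord_unit.
Qed.

Lemma skewE g x : coord_domain x -> skew g x = merge (twist g x).
Proof. by move=> Dx; rewrite /skew asboolT. Qed.

Lemma skew_domain g x : coord_domain (skew g x) <-> coord_domain x.
Proof.
rewrite /skew; case: asboolP => // Dx; split=> // _.
by apply: merge_domain => j; exact: twist_unit.
Qed.

Lemma coord_skew g x j : coord_domain x -> coord j (skew g x) = twist g x j.
Proof.
move=> Dx; rewrite skewE// coord_merge// => i; exact: twist_unit.
Qed.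

Lemma skew0 : skew 0 = id.
Proof.
apply/funext => x; rewrite /skew; case: asboolP => // Dx.
rewrite -[RHS]mergeK//; congr merge; apply/funext => j; rewrite /twist.
by case: ifP => // _; rewrite alpha0 rotation0//; exact: coord_unit.
Qed.

Lemma skewD g h : skew (g + h) = skew g \o skew h.
Proof.
apply/funext => x /=; have [Dx|nDx] := pselect (coord_domain x); last first.
  by rewrite /skew (asboolF nDx) (asboolF nDx).
rewrite [RHS]skewE; last by apply/skew_domain.
rewrite skewE//; congr merge; apply/funext => j.
rewrite {1 2}/twist; case: ifP => oj; last first.
  by rewrite coord_skew// /twist oj.
have oj' : odd j.-1 = false by case: j oj => //= j /negbTE.
rewrite !coord_skew// /twist oj oj' alphaD rotation_comp//.
exact: coord_unit.
Qed.

Lemma measurable_twist g j : measurable_fun setT (fun x => twist g x j).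
Proof.
rewrite /twist; case: (odd j); last exact: measurable_coord.
apply: measurable_rotation; last exact: measurable_coord.
exact: (measurableT_comp (malpha g) (@measurable_coord R pos _)).
Qed.

Lemma measurable_skew g : measurable_fun setT (skew g).
Proof.
apply: measurable_fun_ifT.
- apply: (measurable_fun_bool true); rewrite setTI.
  rewrite (_ : _ @^-1` _ = coord_domain); first exact: measurable_coord_domain.
  by apply/seteqP; split=> x /=; [move/asboolP|move=> Dx; exact/asboolP].
- apply: measurable_real_of => n.
  exact: (measurableT_comp (@measurable_bit R _) (measurable_twist g _)).
- exact: measurable_id.
Qed.

(** With all other coordinates held fixed this is a rotation of one coordinate, so it preserves the
    measure. The composition [skews] of the first J such maps agrees with [skew] on the coordinates
    of index below 2J. *)
Let skew1 (g : G) (i : nat) (x : R) : R :=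
  resample i.*2.+1 x
    (rotation (alpha g (coord i.*2 x)) (coord i.*2.+1 x)).

Let measurable_skew1 g i : measurable_fun setT (skew1 g i).
Proof.
apply: (measurableT_comp (@measurable_resample R pos1 pos2 _)
  (g := fun x => (x, _))).
apply: measurable_fun_pair => //; apply: measurable_rotation.
  exact: (measurableT_comp (malpha g) (@measurable_coord R pos _)).
exact: measurable_coord.
Qed.

Let measurable_skew1_preimage g i A :
  measurable A -> measurable (skew1 g i @^-1` A).
Proof.
move=> mA; rewrite -[X in measurable X]setTI; exact: measurable_skew1.
Qed.

Let unif_skew1 g i A : measurable A -> unif (skew1 g i @^-1` A) = unif A.
Proof.
move=> mA; apply: (@unif_resample_eq R pos pos1 pos2 posK1 posK2 posK i.*2.+1) => //.
  exact: measurable_skew1_preimage.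
move=> x x01; set a := alpha g (coord i.*2 x).
have mB : measurable [set u | A (resample i.*2.+1 x u)].
  rewrite -[X in measurable X]setTI.
  apply: (measurableT_comp (@measurable_resample R pos1 pos2 i.*2.+1)
    (g := fun u => (x, u))) => //.
  exact: measurable_fun_pair.
transitivity (unif (rotation a @^-1` [set u | A (resample i.*2.+1 x u)])).
  apply: unif_eq_unit => u u01 /=; rewrite /skew1.
  rewrite coord_resample// coord_resample_neq//; last first.
    by rewrite neq_ltn ltnSn.
  by rewrite (resample_resample posK1 posK2)//; split=> [[]|].
rewrite (unif_rotation (alpha_unit _ _) mB); apply: unif_eq_unit => u u01 /=.
by split=> [|[]].
Qed.

Let skews (g : G) (J : nat) (x : R) : R := iteri J (skew1 g) x.

Let unif_skews g J A : measurable A ->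
  measurable (skews g J @^-1` A) /\ unif (skews g J @^-1` A) = unif A.
Proof.
elim: J A => // J IHJ A mA.
rewrite (_ : skews g J.+1 @^-1` A = skews g J @^-1` (skew1 g J @^-1` A))//.
have [mB ->] := IHJ _ (measurable_skew1_preimage g J mA); split=> //.
exact: unif_skew1.
Qed.

Let coord_skews g J x : coord_domain x -> coord_domain (skews g J x) /\
  forall j, coord j (skews g J x) =
    if odd j && (j./2 < J)%N then twist g x j else coord j x.
Proof.
move=> Dx; elim: J => [|J [Dy IHJ]].
  by split=> // j; rewrite ltn0 andbF.
rewrite /skews iteriS -/(skews g J x) /skew1; set y := skews g J x.
set a := rotation _ _; have a01 : unit_itv a.
  by apply: rotation_unit => //; exact: coord_unit.
have aE : a = twist g x J.*2.+1.
  rewrite /a /y !IHJ /twist /= odd_double /=.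
  by rewrite uphalf_double ltnn.
split.
  split; first exact: (resample_unit posK1 posK2).
  move=> j n; have [->|jJ] := eqVneq j J.*2.+1.
    have [i ni bi] := bit_not_eventually1 a01 n.
    by exists i => //; rewrite (bit_resample posK1 posK2)// posK1 eqxx posK2.
  have [i ni bi] := Dy.2 j n; exists i => //.
  by rewrite (bit_resample posK1 posK2)// posK1 (negbTE jJ).
move=> j; have [->|jJ] := eqVneq j J.*2.+1.
  by rewrite coord_resample// aE /= odd_double /= uphalf_double ltnS leqnn.
rewrite coord_resample_neq// IHJ; case oj: (odd j) => //=.
rewrite [in RHS]ltnS [in RHS]leq_eqVlt; case: eqP => //= jJ2.
by move: jJ; rewrite -[j]odd_double_half oj jJ2 add1n eqxx.
Qed.

Lemma unif_skew g A : measurable A -> unif (skew g @^-1` A) = unif A.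
Proof.
pose nu : {measure set R -> \bar R} := image_measure unif (measurable_skew g).
have mS B : measurable B -> measurable (skew g @^-1` B).
  by move=> mB; rewrite -[X in measurable X]setTI; exact: measurable_skew.
have mU := @measurable_unit_itv R.
have nu1 : nu unit_itv = 1%E.
  rewrite -(probability_setT unif) -[LHS]/(unif _).
  apply: unif_eq_coord_domain => //; first exact: mS.
  by move=> x Dx; split=> // _ /=; case: ((skew_domain g x).2 Dx).
move=> mA; rewrite -[LHS]/(nu A); apply: unif_unique => //.
  rewrite -[LHS]/(unif _) -(measure0 unif).
  apply: unif_eq_coord_domain => //; first by apply: mS; exact: measurableC.
  move=> x Dx; split=> //= h; apply: h.
  by case: ((skew_domain g x).2 Dx).
move=> n c; rewrite -(@unif_cell R n c) -[LHS]/(unif _).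
(* All coordinates that own one of the first n digits have an index below J, so J rotations settle
   these digits. *)
pose J := (\max_(m < n) (pos1 m).+1)%N.
have [mJ <-] := unif_skews g J (@measurable_cylinder R (iota 0 n) c).
apply: unif_eq_coord_domain => //.
  by apply: mS; apply: measurableI => //; exact: measurable_cylinder.
have bitE x m : coord_domain x -> (m < n)%N ->
    bit m (skew g x) = bit m (skews g J x).
  move=> Dx mn; have [DJ cJ] := coord_skews g J Dx.
  rewrite -(posK m) -(bit_coord _ _ DJ) cJ -(bit_coord _ _ ((skew_domain g x).2 Dx)).
  rewrite coord_skew// /twist; case: ifP => //= om.
  rewrite (_ : (_ < J)%N = true)//.
  have := leq_bigmax (F := fun m : 'I_n => (pos1 m).+1) (Ordinal mn).
  apply: leq_trans; rewrite ltnS -{2}[pos1 m]odd_double_half -addnn addnA.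
  exact: leq_addl.
move=> x Dx; split=> /=.
  by move=> [/cellP h _]; apply/cellP => m mn; rewrite -bitE// h.
move=> /cellP h; split; first by apply/cellP => m mn; rewrite bitE// h.
by case: ((skew_domain g x).2 Dx).
Qed.

End skew_product.

(** * Rigidity reduced to measurable sets *)

Definition vanishing (R : realType) (u : nat -> \bar R) : Prop :=
  forall e : R, 0 < e -> exists N, forall n, (N <= n)%N -> (u n <= e%:E)%E.

Lemma vanishing_cvg0 (R : realType) (u : nat -> \bar R) :
  (forall n, (0 <= u n)%E) -> vanishing u -> u @ \oo --> 0%E.
Proof.
move=> u0 hu; apply/fine_cvgP; split.
  have [N hN] := hu 1 ltr01; exists N => // n /= /hN un.
  by rewrite ge0_fin_numE// (le_lt_trans un)// ltry.
apply/cvgrPdist_le => e e0; have [N hN] := hu e e0; exists N => // n /= /hN un.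
rewrite sub0r normrN ger0_norm ?fine_ge0// -lee_fin fineK//.
by rewrite ge0_fin_numE// (le_lt_trans un)// ltry.
Qed.

Lemma cvg0_vanishing (R : realType) (u : nat -> \bar R) :
  u @ \oo --> 0%E -> vanishing u.
Proof.
move=> /fine_cvgP[fu /cvgrPdist_le hu] e e0.
have [N1 _ h1] := fu; have [N2 _ h2] := hu e e0.
exists (maxn N1 N2) => n; rewrite geq_max => /andP[n1 n2].
rewrite -(fineK (h1 n n1)) lee_fin; apply: le_trans (h2 n n2).
by rewrite sub0r normrN ler_norm.
Qed.

Lemma vanishing_le (R : realType) (u v : nat -> \bar R) :
  (forall n, (u n <= v n)%E) -> vanishing v -> vanishing u.
Proof.
move=> uv hv e /hv[N hN]; exists N => n /hN; exact: le_trans.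
Qed.

Lemma vanishingD (R : realType) (u v : nat -> \bar R) :
  vanishing u -> vanishing v -> vanishing (fun n => u n + v n)%E.
Proof.
move=> hu hv e e0; have e2 : 0 < e / 2 by lra.
have [N1 h1] := hu _ e2; have [N2 h2] := hv _ e2.
exists (maxn N1 N2) => n; rewrite geq_max => /andP[n1 n2].
rewrite (_ : e = e / 2 + e / 2) ?EFinD; last lra.
by apply: leeD; [exact: h1|exact: h2].
Qed.

Lemma vanishing0 (R : realType) : vanishing (fun=> 0%E : \bar R).
Proof. by move=> e e0; exists 0%N => n _; rewrite lee_fin ltW. Qed.

Lemma vanishing_sum (R : realType) (I : eqType) (s : seq I) (u : I -> nat -> \bar R) :
  (forall i, i \in s -> vanishing (u i)) ->
  vanishing (fun n => \sum_(i <- s) u i n)%E.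
Proof.
elim: s => [|i s IHs] h.
  by under eq_fun do rewrite big_nil; exact: vanishing0.
under eq_fun do rewrite big_cons; apply: vanishingD.
  by apply: h; rewrite mem_head.
by apply: IHs => k ks; apply: h; rewrite inE ks orbT.
Qed.

Lemma vanishingZ (R : realType) (c : R) (u : nat -> \bar R) : 0 <= c ->
  vanishing u -> vanishing (fun n => c%:E * u n)%E.
Proof.
move=> c0 hu e e0; have ec : 0 < e / (c + 1) by rewrite divr_gt0// ltr_wpDl.
have [N h] := hu _ ec; exists N => n /h un.
apply: (@le_trans _ _ (c%:E * (e / (c + 1))%:E)%E); first exact: lee_wpmul2l.
rewrite -EFinM lee_fin mulrA ler_pdivrMr ?ltr_wpDl// mulrC ler_pM2l//.
by rewrite lerDl.
Qed.

Section rigidity_of_sets.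
Context d (X : measurableType d) (R : realType).
Variable mu : probability X R.

Let sqint (f : X -> R) : \bar R := (\int[mu]_x ((f x) ^+ 2)%:E)%E.

Let msqr (f : X -> R) : measurable_fun setT f ->
  measurable_fun setT (fun x => ((f x) ^+ 2)%:E).
Proof. by move=> mf; apply/measurable_EFinP; exact: measurable_funX. Qed.

Let sqint_le3 (f g h k : X -> R) : measurable_fun setT f ->
  measurable_fun setT g -> measurable_fun setT h -> measurable_fun setT k ->
  (forall x, f x = g x + h x + k x) ->
  (sqint f <= 3%:E * (sqint g + sqint h + sqint k))%E.
Proof.
move=> mf mg mh mk fE; rewrite /sqint.
rewrite -!ge0_integralD//; try (by move=> x _; rewrite ?adde_ge0// lee_fin sqr_ge0);
  try exact: msqr; last by apply: emeasurable_funD; exact: msqr.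
rewrite -ge0_integralZl//; last 2 first.
  by do 2?apply: emeasurable_funD; exact: msqr.
  by move=> x _; rewrite !adde_ge0// lee_fin sqr_ge0.
apply: ge0_le_integral => //.
- by move=> x _; rewrite lee_fin sqr_ge0.
- exact: msqr.
- apply: measurable_funeM; by do 2?apply: emeasurable_funD; exact: msqr.
move=> x _; rewrite -!EFinD -EFinM lee_fin fE.
move: (g x) (h x) (k x) => a b c.
have := sqr_ge0 (a - b); have := sqr_ge0 (a - c); have := sqr_ge0 (b - c).
by nra.
Qed.

Import HBNNSimple.

(** The positive and the negative part are approximated from below, so that the error never exceeds
    |f| and f^2 dominates its square. *)
Lemma Lfun2_simple_approx (f : X -> R) (e : R) : f \in Lfun mu 2%:E -> 0 < e ->
  exists s : X -> R, [/\ measurable_fun setT s, finite_set (range s) &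
    (\int[mu]_x ((f x - s x) ^+ 2)%:E <= e%:E)%E].
Proof.
move=> f2 e0; have mf : measurable_fun setT f.
  by move: f2; rewrite inE => /andP[]; rewrite inE.
have mfE : measurable_fun setT (EFin \o f) by exact/measurable_EFinP.
pose p := nnsfun_approx measurableT (measurable_funepos mfE).
pose m := nnsfun_approx measurableT (measurable_funeneg mfE).
have posE x : ((EFin \o f)^\+ x)%E = (Num.max (f x) 0)%:E.
  by rewrite funeposE /= EFin_max.
have negE x : ((EFin \o f)^\- x)%E = (Num.max (- f x) 0)%:E.
  by rewrite funenegE /= EFin_max.
have p0 k x : 0 <= p k x by [].
have m0 k x : 0 <= m k x by [].
have p_le k x : p k x <= Num.max (f x) 0.
  by rewrite -lee_fin -posE /p nnsfun_approxE;
    apply: le_approx => // y _; exact: funepos_ge0.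
have m_le k x : m k x <= Num.max (- f x) 0.
  by rewrite -lee_fin -negE /m nnsfun_approxE;
    apply: le_approx => // y _; exact: funeneg_ge0.
pose s k x := p k x - m k x.
have ms k : measurable_fun setT (s k) by exact: measurable_funB.
have le_fs k x : (f x - s k x) ^+ 2 <= f x ^+ 2.
  rewrite -ler_sqrt ?sqr_ge0// !sqrtr_sqr /s.
  move: (p0 k x) (m0 k x) (p_le k x) (m_le k x).
  rewrite !maxEle ler_norml; case: (lerP (f x) 0) => h1;
    case: (lerP (- f x) 0) => h2 a b c d';
    [rewrite ger0_norm|rewrite ler0_norm|rewrite gtr0_norm|exfalso]; lra.
have cvgs x : (fun k => ((f x - s k x) ^+ 2)%:E) @ \oo --> 0%E.
  have cp : (fun k => p k x) @ \oo --> Num.max (f x) 0.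
    have := @cvg_nnsfun_approx _ _ _ _ measurableT _ (measurable_funepos mfE)
      (fun y _ => funepos_ge0 (EFin \o f) y) x Logic.I.
    by rewrite posE => /fine_cvgP[_].
  have cm : (fun k => m k x) @ \oo --> Num.max (- f x) 0.
    have := @cvg_nnsfun_approx _ _ _ _ measurableT _ (measurable_funeneg mfE)
      (fun y _ => funeneg_ge0 (EFin \o f) y) x Logic.I.
    by rewrite negE => /fine_cvgP[_].
  apply/fine_cvgP; split; first by near=> k.
  rewrite (_ : fine \o _ = (fun k => (f x - s k x) ^+ 2))//.
  rewrite [X in _ --> X](_ : 0 = 0 ^+ 2); last by rewrite expr0n.
  apply: (@cvg_comp _ _ _ (fun k => f x - s k x) (fun y : R => y ^+ 2) _ (nbhs (0 : R))).
    rewrite (_ : 0 = f x - (Num.max (f x) 0 - Num.max (- f x) 0)).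
      by apply: cvgB; [exact: cvg_cst|exact: cvgB].
    rewrite !maxEle; case: (lerP (f x) 0) => h1; case: (lerP (- f x) 0) => h2; lra.
  exact: exprn_continuous.
have dom : {ae mu, forall x, forall k, setT x ->
    (`|((f x - s k x) ^+ 2)%:E| <= (f x ^+ 2)%:E)%E}.
  by apply: aeW => x k _; rewrite gee0_abs ?lee_fin ?sqr_ge0.
have [_ _ dc] := @dominated_convergence _ _ _ mu setT measurableT
  (fun k x => ((f x - s k x) ^+ 2)%:E) (fun=> 0%E) (fun x => (f x ^+ 2)%:E)
  (fun k => msqr (measurable_funB mf (ms k))) (measurable_cst _)
  (aeW _ (fun x _ => cvgs x)) (Lfun2_integrable_sqr f2) dom.
rewrite integral0 in dc.
have [N hN] := cvg0_vanishing dc e0.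
exists (s N); split=> //; last exact: hN.
apply: (@sub_finite_set _ _ [set a - b | a in range (p N) & b in range (m N)]).
  by move=> _ [x _ <-]; exists (p N x); [exists x|exists (m N x); [exists x|]].
by apply: finite_image2; exact: fimfunP.
Unshelve. all: by end_near. Qed.

(** For a simple function s, if s(Tx) differs from s(x) then x leaves the level set of its own
    value; so the one-sided differences of the finitely many level sets control s o T - s. A general
    f is compared with s before and after T, where invariance makes the two errors equal. *)
Lemma rigidity_sequence_of_sets (G : zmodType) (T : G -> X -> X) (a : nat -> G) :
  (forall g, measurable_fun setT (T g)) ->
  (forall g A, measurable A -> mu (T g @^-1` A) = mu A) ->
  (forall A, measurable A ->
     vanishing (fun n => mu (A `\` T (a n) @^-1` A))) ->
  rigidity_sequence mu T a.
Proof.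
move=> mT muT hT f f2.
have mf : measurable_fun setT f.
  by move: f2; rewrite inE => /andP[]; rewrite inE.
have mTA g A : measurable A -> measurable (T g @^-1` A).
  by move=> mA; rewrite -[X in measurable X]setTI; exact: mT.
have sqintT (h : X -> R) g : measurable_fun setT h -> sqint (h \o T g) = sqint h.
  move=> mh; rewrite /sqint.
  rewrite -(@ge0_integral_pushforward _ _ _ _ _ _ (mT g) mu setT
    (fun x => (h x ^+ 2)%:E)) ?preimage_setT//; last 2 first.
  - exact: msqr.
  - by move=> x _; rewrite lee_fin sqr_ge0.
  by apply: eq_measure_integral => A mA _; exact: muT.
have vanish_simple (s : X -> R) : measurable_fun setT s -> finite_set (range s) ->
    vanishing (fun n => sqint (fun x => s (T (a n) x) - s x)).
  move=> ms /finite_seqP[F rF].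
  have sF x : s x \in F by have : range s (s x) by [exists x]; rewrite rF.
  pose C := \sum_(c <- F) `|c|.
  have sC x : `|s x| <= C.
    by rewrite /C (big_rem (s x))//= lerDl sumr_ge0.
  pose A c := s @^-1` [set c].
  have mA c : measurable (A c) by rewrite -[X in measurable X]setTI; exact: ms.
  pose D n c := A c `\` T (a n) @^-1` A c.
  have mD n c : measurable (D n c) by apply: measurableD => //; exact: mTA.
  apply: (@vanishing_le _ _ (fun n => ((2 * C) ^+ 2)%:E * \sum_(c <- F) mu (D n c))%E).
    move=> n.
    have -> : (\sum_(c <- F) mu (D n c) = \int[mu]_x \sum_(c <- F) (\1_(D n c) x)%:E)%E.
      rewrite ge0_integral_sum//; last first.
        by move=> c; apply/measurable_EFinP; exact: measurable_indic.
      by apply: eq_bigr => c _; rewrite integral_indic// setIT.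
    have mS : measurable_fun setT (fun x => \sum_(c <- F) (\1_(D n c) x : R)%:E)%E.
      by apply: emeasurable_sum => c; apply/measurable_EFinP; exact: measurable_indic.
    rewrite -ge0_integralZl ?lee_fin ?sqr_ge0//; last first.
      by move=> x _; apply: sume_ge0 => c _; rewrite lee_fin.
    apply: ge0_le_integral => //.
    - by move=> x _; rewrite lee_fin sqr_ge0.
    - by apply: msqr; apply: measurable_funB => //; exact: measurableT_comp.
    - exact: measurable_funeM.
    move=> x _; have [->|sTx] := eqVneq (s (T (a n) x)) (s x).
      rewrite subrr expr0n mule_ge0 ?lee_fin ?sqr_ge0//.
      by apply: sume_ge0 => c _; rewrite lee_fin.
    apply: (@le_trans _ _ (((2 * C) ^+ 2)%:E * 1)%E).
      rewrite mule1 lee_fin -ler_sqrt ?sqr_ge0// !sqrtr_sqr.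
      rewrite (le_trans (ler_normB _ _))//.
      have C0 : 0 <= C by exact: le_trans (normr_ge0 _) (sC x).
      by rewrite [leRHS]ger0_norm ?mulr_ge0// mulr_natl mulr2n lerD.
    apply: lee_wpmul2l; first by rewrite lee_fin sqr_ge0.
    rewrite (big_rem (s x))//= indicE mem_set.
      by rewrite leeDl// sume_ge0// => c _; rewrite lee_fin.
    by split=> //= /eqP; rewrite (negbTE sTx).
  apply: vanishingZ; first exact: sqr_ge0.
  by apply: vanishing_sum => c _; exact: hT.
have vanish_f : vanishing (fun n => sqint (fun x => f (T (a n) x) - f x)).
  (* Three terms, times the factor 3 of [sqint_le3]. *)
  move=> e e0; have e9 : 0 < e / 9 by lra.
  have [s [ms fs sfs]] := Lfun2_simple_approx f2 e9.
  have [N hN] := vanish_simple s ms fs _ e9.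
  exists N => n /hN hn.
  have mTn := mT (a n).
  have mfs : measurable_fun setT (fun x => f x - s x) by exact: measurable_funB.
  apply: le_trans (@sqint_le3 (fun x => f (T (a n) x) - f x)
    ((fun x => f x - s x) \o T (a n)) (fun x => s (T (a n) x) - s x)
    (fun x => s x - f x) _ _ _ _ _) _.
  - by apply: measurable_funB => //; exact: measurableT_comp.
  - exact: measurableT_comp.
  - by apply: measurable_funB => //; exact: measurableT_comp.
  - exact: measurable_funB.
  - by move=> x /=; lra.
  rewrite sqintT// (_ : sqint (fun x => s x - f x) = sqint (fun x => f x - s x)).
    rewrite (_ : e%:E = 3%:E * ((e / 9)%:E + (e / 9)%:E + (e / 9)%:E))%E; last first.
      by rewrite -!EFinD -EFinM; congr (_%:E); field.
    by apply: lee_wpmul2l => //; rewrite !leeD.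
  by apply: eq_integral => x _; rewrite -opprB sqrrN.
apply: vanishing_cvg0 => [n|e e0]; first exact: Lnorm_ge0.
have [N hN] := vanish_f _ (exprn_gt0 2 e0); exists N => n /hN hn.
rewrite unlock (_ : (\int[mu]_x _)%E = sqint (fun x => f (T (a n) x) - f x)).
  apply: (@le_trans _ _ ((e ^+ 2)%:E `^ 2^-1)%E).
    apply: gt0_ler_poweR => //; first by rewrite in_itv /= leey
      integral_ge0// => x _; rewrite lee_fin sqr_ge0.
    by rewrite in_itv /= leey lee_fin sqr_ge0.
  by rewrite poweR_EFin lee_fin -powR_mulrn ?(ltW e0)// -powRrM divff// powRr1// ltW.
apply: eq_integral => x _ /=.
by rewrite -[X in _ `^ X]/(2%:R) powR_mulrn// real_normK ?num_real.
Qed.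

End rigidity_of_sets.

(** * Passage from Borel to Lebesgue-measurable sets *)

Section completed_system.
Variable R : realType.
Local Notation unif := (@unif R).
Local Notation unit_itv := (@unit_itv R).
Local Notation lambda := (@lebesgue_measure R).
Local Notation lambdac := (@completed_lebesgue_measure R).
Local Notation leb := (caratheodory_type ((wlength (@idfun R))^*)%mu).

Lemma measurable_lebesgue_measurable (A : set R) :
  measurable A -> lebesgue_measurable A.
Proof. exact: sub_caratheodory. Qed.

Lemma lebesgue_measurable_sandwich (A : set R) : lebesgue_measurable A ->
  exists B Z : set R, [/\ measurable B, measurable Z, lambda Z = 0%E,
    B `<=` A & A `<=` B `|` Z].
Proof.
rewrite /lebesgue_measurable -completed_caratheodory_measurable.
rewrite g_sigma_completed_algebra_genE => -[B mB] [N [Z [mZ Z0 NZ]]] <-.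
exists B, Z; split; [exact: mB|exact: mZ|exact: Z0| |].
  by move=> x Bx; left.
by move=> x [Bx|/NZ Zx]; [left|right].
Qed.

Lemma lebesgue_measurable_null (N Z : set R) : measurable Z ->
  lambda Z = 0%E -> N `<=` Z -> lebesgue_measurable N.
Proof.
move=> mZ Z0 NZ; apply: completed_lebesgue_measure_is_complete.
by exists Z; split=> //; exact: measurable_lebesgue_measurable.
Qed.

Let measurable_unit : measurable (unit_itv : set leb).
Proof. apply: measurable_lebesgue_measurable; exact: measurable_unit_itv. Qed.

(** The same set function as [unif] on a larger sigma-algebra: [nonatomic_lebesgue_space] matches
    the measurable sets of the space with all Lebesgue-measurable sets, so the Borel sets are too
    few. *)
Definition unifc : set leb -> \bar R := mrestr lambdac measurable_unit.

HB.instance Definition _ := Measure.on unifc.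

Lemma unifcE (A : set R) : unifc A = unif A.
Proof. by []. Qed.

Let unifc_setT : unifc setT = 1%E.
Proof. exact: (probability_setT unif). Qed.

HB.instance Definition _ :=
  Measure_isProbability.Build _ _ _ unifc unifc_setT.

Lemma unifc_nonatomic : nonatomic_lebesgue_space unifc.
Proof.
exists unit_itv, unit_itv, id; split.
- split; first exact: measurable_unit.
  rewrite -[LHS]/(unif unit_itv) -[X in unif X]setTI unif_setI_unit.
  exact: probability_setT.
- split; first exact: measurable_unit.
    by apply: subset_itv; rewrite bnd_simp.
  rewrite -[LHS]/(lambda unit_itv) -[X in lambda X]setTI -unifE.
  exact: probability_setT.
- by split=> // x; exists x.
move=> A A01; rewrite image_id; split=> // mA.
by rewrite -[LHS]/(lambdac (A `&` unit_itv)) setIidl.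
Qed.

Variables (G : zmodType) (T : G -> R -> R).
Hypotheses (T0 : T 0 = id) (TD : forall g h, T (g + h) = T g \o T h)
  (mT : forall g, measurable_fun setT (T g))
  (unifT : forall g A, measurable A -> unif (T g @^-1` A) = unif A)
  (Tout : forall g x, ~ unit_itv x -> T g x = x).

Let mTA g A : measurable A -> measurable (T g @^-1` A).
Proof. by move=> mA; rewrite -[X in measurable X]setTI; exact: mT. Qed.

(** Invariance of [unif] controls the preimage inside [0, 1); outside, [T g] is the identity and the
    preimage lies in [Z]. *)
Let null_preimage g (Z : set R) : measurable Z -> lambda Z = 0%E ->
  lambda (T g @^-1` Z) = 0%E.
Proof.
move=> mZ Z0; have mZg := mTA g mZ.
have hZ : T g @^-1` Z `<=` (T g @^-1` Z `&` unit_itv) `|` Z.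
  move=> x Zx; have [x01|nx] := pselect (unit_itv x); first by left.
  by right; rewrite -(Tout g nx).
apply/eqP; rewrite eq_le measure_ge0 andbT.
apply: (@le_trans _ _ (lambda (T g @^-1` Z `&` unit_itv `|` Z))).
  apply: le_measure; rewrite ?inE//; apply: measurableU => //.
  by apply: measurableI => //; exact: measurable_unit_itv.
apply: le_trans (measureU2 _ _ _) _ => //.
  by apply: measurableI => //; exact: measurable_unit_itv.
rewrite [X in (X + _)%E](_ : _ = unif (T g @^-1` Z))// unifT// unifE.
rewrite [X in (_ + X)%E](_ : _ = lambda Z)// Z0 adde0 -Z0.
apply: le_measure; rewrite ?inE//.
by apply: measurableI => //; exact: measurable_unit_itv.
Qed.

Let mTc g : measurable_fun setT (T g : leb -> leb).
Proof.
move=> _ A mA; rewrite setTI.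
have [B [Z [mB mZ Z0 BA ABZ]]] := lebesgue_measurable_sandwich mA.
rewrite (_ : T g @^-1` A = T g @^-1` B `|` (T g @^-1` A `&` T g @^-1` Z)).
  apply: measurableU.
    exact: (measurable_lebesgue_measurable (mTA g mB)).
  apply: (lebesgue_measurable_null (mTA g mZ) (null_preimage g mZ Z0)).
  exact: subIsetr.
apply/seteqP; split=> x /=.
  by move=> Ax; case: (ABZ _ Ax); [left|right].
by case=> [/BA//|[]].
Qed.

Let unif_null (Z : set R) : measurable Z -> lambda Z = 0%E -> unif Z = 0%E.
Proof.
move=> mZ Z0; apply/eqP; rewrite eq_le measure_ge0 andbT -Z0 unifE.
apply: le_measure; rewrite ?inE//.
by apply: measurableI => //; exact: measurable_unit_itv.
Qed.

Let unif_sandwich (B Z : set R) (A : set leb) : measurable B -> measurable Z ->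
  lambda Z = 0%E -> B `<=` A -> A `<=` B `|` Z -> measurable A ->
  unifc A = unif B.
Proof.
move=> mB mZ Z0 BA ABZ mA; apply/eqP; rewrite eq_le; apply/andP; split.
  apply: (@le_trans _ _ (unif (B `|` Z))).
    rewrite -unifcE; apply: le_measure; rewrite ?inE//.
    by apply: measurable_lebesgue_measurable; exact: measurableU.
  apply: le_trans (measureU2 _ _ _) _ => //=.
  by rewrite (unif_null mZ Z0) adde0.
rewrite -unifcE; apply: le_measure; rewrite ?inE//.
exact: measurable_lebesgue_measurable.
Qed.

Let unifcT g (A : set leb) : measurable A -> unifc (T g @^-1` A) = unifc A.
Proof.
move=> mA; have [B [Z [mB mZ Z0 BA ABZ]]] := lebesgue_measurable_sandwich mA.
rewrite (@unif_sandwich (T g @^-1` B) (T g @^-1` Z)).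
- by rewrite unifT// (unif_sandwich mB mZ).
- exact: mTA.
- exact: mTA.
- exact: null_preimage.
- exact: preimage_subset.
- by move=> x /ABZ.
- by rewrite -[X in measurable X]setTI; exact: mTc.
Qed.

Lemma completed_measure_preserving : measure_preserving_system unifc T.
Proof. by split=> //; exact: unifc_nonatomic. Qed.

Lemma completed_free :
  (forall g, g != 0 -> unif.-negligible [set x | T g x = x]) ->
  free_system unifc T.
Proof.
move=> h g /h[Z [mZ Z0 TZ]]; exists Z; split=> //.
exact: measurable_lebesgue_measurable.
Qed.

Lemma completed_rigid (a : nat -> G) :
  (forall A, measurable A -> vanishing (fun n => unif (A `\` T (a n) @^-1` A))) ->
  rigidity_sequence unifc T a.
Proof.
move=> h; apply: rigidity_sequence_of_sets => // A mA.
have [B [Z [mB mZ Z0 BA ABZ]]] := lebesgue_measurable_sandwich mA.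
apply: vanishing_le (h B mB) => n.
have mTB := mTA (a n) mB.
apply: (@le_trans _ _ (unif ((B `\` T (a n) @^-1` B) `|` Z))).
  rewrite -unifcE; apply: le_measure; rewrite ?inE//.
  - apply: measurableD => //.
    by rewrite -[X in measurable X]setTI; exact: mTc.
  - apply: measurable_lebesgue_measurable; apply: measurableU => //.
    exact: measurableD.
  - move=> x [Ax nTAx]; have [Bx|] := ABZ _ Ax; last by right.
    by left; split=> // TBx; apply: nTAx; exact: BA.
apply: le_trans (measureU2 _ _ _) _ => //=; first exact: measurableD.
by rewrite (unif_null mZ Z0) adde0.
Qed.

End completed_system.

Lemma measure_bigsetU_le d (T : measurableType d) (R : realType)
    (mu : {measure set T -> \bar R}) (I : eqType) (s : seq I) (F : I -> set T) :
  (forall i, measurable (F i)) ->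
  (mu (\big[setU/set0]_(i <- s) F i) <= \sum_(i <- s) mu (F i))%E.
Proof.
move=> mF; elim: s => [|i s IHs]; first by rewrite !big_nil measure0.
rewrite !big_cons; apply: le_trans (measureU2 _ _ _) _ => //.
  exact: bigsetU_measurable.
exact: leeD2l.
Qed.

(** * Freeness and rigidity of the skew product *)

Section skew_product_dynamics.
Variable R : realType.
Local Notation unif := (@unif R).
Local Notation unit_itv := (@unit_itv R).

(** For [a] in [0, 1) this is the distance to the nearest integer. *)
Definition circle_dist (a : R) : R := Num.min a (1 - a).

Lemma real_of_prefix c n (y : R) : unit_itv y ->
  real_of R (fun m => if (m < n)%N then c m else bit (m - n) y) =
  bin_sum R c n + y * 2^-1 ^+ n.
Proof.
move=> y01; elim: n c => [|n IHn] c.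
  rewrite /bin_sum big_ord0 add0r mulr1 -[RHS]real_ofK//; congr real_of.
  by apply/funext => m; rewrite ltn0 subn0.
rewrite real_ofS bin_sumS ltn0Sn.
rewrite (_ : (fun i => _) = (fun m => if (m < n)%N then c m.+1 else bit (m - n) y)).
  by rewrite IHn exprSr mulrA -mulrDl addrA.
by apply/funext => m; rewrite ltnS subSS.
Qed.

Lemma bit_prefix c n (y : R) m : unit_itv y -> (m < n)%N ->
  bit m (bin_sum R c n + y * 2^-1 ^+ n) = c m.
Proof.
move=> y01 mn; rewrite -real_of_prefix// bit_real_of ?mn// => k.
have [i ki bi] := bit_not_eventually1 y01 k.
by exists (n + i)%N; [rewrite (leq_trans ki) ?leq_addl|rewrite ltnNge leq_addr /= addKn].
Qed.

Lemma bin_sum_ge0 c n : 0 <= bin_sum R c n.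
Proof. by apply: sumr_ge0 => i _; rewrite mulr_ge0// exprn_ge0. Qed.

Lemma bin_sum_le c n : bin_sum R c n + 2^-1 ^+ n <= 1.
Proof.
elim: n c => [|n IHn] c; first by rewrite /bin_sum big_ord0 add0r.
rewrite bin_sumS exprSr -mulrDl ler_pdivrMr// mul1r -addrA.
by have := IHn (fun i => c i.+1); case: (c 0%N) => /= h; lra.
Qed.

(** The iterate of [dbl] is the relative position of [u] in its dyadic interval of length 2^-n. A
    point at distance at least k 2^-n from both ends stays in that interval under a shorter
    rotation, in either direction, and keeps its first n digits. *)
Lemma bit_rotation (b u k : R) n i : unit_itv b -> unit_itv u -> (i < n)%N ->
  k <= iter n (@dbl R) u < 1 - k -> circle_dist b < k * 2^-1 ^+ n ->
  bit i (rotation b u) = bit i u.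
Proof.
move=> /unit_itvP/andP[b0 b1] u01 ni /andP[ky yk] bk.
have /unit_itvP/andP[y0 y1] := iter_dbl_unit n u01.
move: (bin_sum_bit n u); set y := iter n _ u in ky yk y0 y1 *.
set S := bin_sum _ _ _ => uE.
have S0 : 0 <= S by exact: bin_sum_ge0.
have S1 : S + 2^-1 ^+ n <= 1 by exact: bin_sum_le.
set q : R := 2^-1 ^+ n in uE S1 bk *; have q0 : 0 < q by exact: exprn_gt0.
suff [y' [y'01 rE]] : exists y', unit_itv y' /\ rotation b u = S + y' * q.
  by rewrite rE /S bit_prefix.
have k1 : k * q <= y * q by rewrite ler_pM2r.
have k2 : y * q < (1 - k) * q by rewrite ltr_pM2r.
move: bk; rewrite /circle_dist minElt; case: ifP => _ bk.
- exists (y + b / q); split.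
    apply/unit_itvP/andP; split; first by rewrite addr_ge0// divr_ge0// ltW.
    rewrite -(ltr_pM2r q0) mulrDl mulfVK ?gt_eqF//; nra.
  have -> : (y + b / q) * q = y * q + b by rewrite mulrDl mulfVK ?gt_eqF.
  by rewrite /rotation uE ifT ?addrA//; nra.
- exists (y - (1 - b) / q); split.
    apply/unit_itvP/andP; split.
      by rewrite -(ler_pM2r q0) mulrBl mulfVK ?gt_eqF//; nra.
    by rewrite -(ltr_pM2r q0) mulrBl mulfVK ?gt_eqF//; nra.
  have -> : (y - (1 - b) / q) * q = y * q - (1 - b).
    by rewrite mulrBl mulfVK ?gt_eqF.
  by rewrite /rotation uE ifF; [lra|apply/negbTE; rewrite -leNgt; nra].
Qed.

Lemma unif_itv_le (a b : R) (c d : bool) : a <= b ->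
  (unif [set` Interval (BSide c a) (BSide d b)] <= (b - a)%:E)%E.
Proof.
move=> ab; rewrite unifE.
apply: (@le_trans _ _ (lebesgue_measure [set` Interval (BSide c a) (BSide d b)])).
  apply: le_measure; rewrite ?inE//.
  by apply: measurableI => //; exact: measurable_unit_itv.
rewrite lebesgue_measure_itv /= ; case: ifP => _; first by rewrite -EFinB.
by rewrite lee_fin subr_ge0.
Qed.

Lemma unif_iter_dbl n (A : set R) : measurable A ->
  measurable (iter n (@dbl R) @^-1` A) /\ unif (iter n (@dbl R) @^-1` A) = unif A.
Proof.
elim: n A => // n IHn A mA.
have mD : measurable (@dbl R @^-1` A).
  by rewrite -[X in measurable X]setTI; exact: measurable_dbl.
rewrite (_ : _ @^-1` _ = iter n (@dbl R) @^-1` (@dbl R @^-1` A))//.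
by have [mI ->] := IHn _ mD; split=> //; exact: unif_dbl_preimage.
Qed.

Let near_ends n (k : R) : set R :=
  iter n (@dbl R) @^-1` (`]-oo, k[%classic `|` `[1 - k, +oo[%classic).

Let unif_near_ends n (k : R) : 0 <= k ->
  measurable (near_ends n k) /\ (unif (near_ends n k) <= (2 * k)%:E)%E.
Proof.
move=> k0; have mE : measurable (`]-oo, k[%classic `|` `[1 - k, +oo[%classic : set R).
  exact: measurableU.
have [mN unifN] := unif_iter_dbl n mE; split=> //.
rewrite /near_ends unifN -unif_setI_unit setIUl.
apply: (@le_trans _ _ (unif (`[0, k[%classic `|` `[1 - k, 1[%classic))).
  apply: le_measure; rewrite ?inE//.
  - apply: measurableU; apply: measurableI => //; exact: measurable_unit_itv.
  - exact: measurableU.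
  - move=> x [] [/= + /unit_itvP/andP[x0 x1]]; rewrite !in_itv /=.
      by move=> xk; left; rewrite x0.
    by rewrite andbT => kx; right; rewrite kx.
apply: le_trans (measureU2 _ _ _) _ => //=.
rewrite mulr_natl mulr2n EFinD; apply: leeD.
  by apply: le_trans (unif_itv_le _ _ _) _ => //; rewrite subr0.
apply: le_trans (unif_itv_le _ _ _) _ => //; first by rewrite gerBl.
by rewrite subKr.
Qed.

Variables (pos : nat -> nat -> nat) (pos1 pos2 : nat -> nat).
Hypotheses (posK1 : forall j i, pos1 (pos j i) = j)
  (posK2 : forall j i, pos2 (pos j i) = i)
  (posK : forall m, pos (pos1 m) (pos2 m) = m).
Local Notation coord := (@coord R pos).
Local Notation coord_domain := (@coord_domain R pos).
Variables (G : zmodType) (alpha : G -> R -> R).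
Hypotheses (alpha_unit : forall g v, unit_itv (alpha g v))
  (malpha : forall g, measurable_fun setT (alpha g))
  (alpha0 : forall v, alpha 0 v = 0)
  (alphaD : forall g h v, alpha (g + h) v = rotation (alpha g v) (alpha h v)).
Local Notation skew := (@skew R pos pos1 pos2 G alpha).

Let mcoord j (A : set R) : measurable A -> measurable (coord j @^-1` A).
Proof.
by move=> mA; rewrite -[X in measurable X]setTI; exact: measurable_coord.
Qed.

Lemma rotation_fix (a u : R) : unit_itv a -> rotation a u = u -> a = 0.
Proof.
by move=> /unit_itvP/andP[a0 a1]; rewrite /rotation; case: ltrP => _ h; lra.
Qed.

(** At a fixed point in [coord_domain] every angle is 0, so all even coordinates avoid [B]. They are
    independent: the first J of them avoid [B] with probability q^J, where q < 1 is the measure of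
    the complement. *)
Lemma skew_fix_negligible g (B : set R) : measurable B -> (0 < unif B)%E ->
  (forall v, B v -> alpha g v != 0) ->
  unif.-negligible [set x | skew g x = x].
Proof.
move=> mB B0 hB.
pose A J : set R := [set x | forall i, (i < J)%N -> ~ B (coord i.*2 x)].
have AS J : A J.+1 = A J `&` coord J.*2 @^-1` (~` B).
  apply/seteqP; split=> x /=.
    by move=> h; split=> [i iJ|]; apply: h => //; exact: ltnW.
  move=> [h1 h2] i; rewrite ltnS leq_eqVlt => /orP[/eqP->//|]; exact: h1.
have mA J : measurable (A J).
  elim: J => [|J IHJ]; first by rewrite (_ : A 0%N = setT)//; apply/seteqP; split.
  by rewrite AS; apply: measurableI => //; apply: mcoord; exact: measurableC.
pose q := fine (unif (~` B)).
have qE : unif (~` B) = q%:E.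
  by rewrite /q fineK// fin_num_measure//; exact: measurableC.
have q0 : 0 <= q by rewrite -lee_fin -qE.
have q1 : q < 1.
  rewrite -lte_fin -qE probability_setC//= lteBlDr ?fin_num_measure//.
  by rewrite lteDl.
have unifA J : unif (A J) = (q ^+ J)%:E.
  elim: J => [|J IHJ].
    rewrite (_ : A 0%N = setT) ?expr0; last by apply/seteqP; split.
    exact: probability_setT.
  rewrite AS (@unif_coord_indep R pos pos1 pos2)//; last 2 first.
  - exact: measurableC.
  - move=> x u x01 u01; split=> h i iJ; have := h i iJ;
      by rewrite (coord_resample_neq posK1 posK2)// neq_ltn ltn_double iJ.
  by rewrite IHJ qE -EFinM exprSr.
apply: (@negligibleS _ _ _ _ (~` coord_domain `|` \bigcap_J A J)).
  move=> x /= fx; have [Dx|] := pselect (coord_domain x); last by left.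
  right=> J _ i iJ Bv; have := hB _ Bv; apply/negP; rewrite negbK; apply/eqP.
  apply: (@rotation_fix _ (coord i.*2.+1 x)) => //.
  have := coord_skew posK1 posK2 alpha_unit g i.*2.+1 Dx.
  by rewrite fx /twist /= odd_double /=.
apply: negligibleU; first exact: (@negligible_coord_domainC R pos pos2 posK2).
have mI : measurable (\bigcap_J A J) by exact: bigcapT_measurable.
exists (\bigcap_J A J); split=> //; apply/eqP; rewrite eq_le measure_ge0 andbT.
apply/lee_addgt0Pr => e e0; rewrite add0e.
have : (fun J => q ^+ J) @ \oo --> 0 by apply: cvg_expr; rewrite ger0_norm.
move=> /cvgrPdist_le /(_ _ e0)[J _ /(_ J)] /= /(_ (leqnn _)).
rewrite sub0r normrN ger0_norm ?exprn_ge0// => qe.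
apply: (@le_trans _ _ (unif (A J))); last by rewrite unifA lee_fin.
by apply: le_measure; rewrite ?inE//; exact: bigcap_inf.
Qed.

Variable a : nat -> G.
Hypothesis small_alpha : forall e : R, 0 < e ->
  vanishing (fun n => unif [set v | e <= circle_dist (alpha (a n) v)]).

Let mdist (e : R) g : measurable [set v | e <= circle_dist (alpha g v)].
Proof.
rewrite -[X in measurable X]setTI.
apply: (measurable_fun_ler (measurable_cst _) _ measurableT (Y := [set true])) => //.
apply: measurable_minr; first exact: malpha.
by apply: measurable_funB => //; exact: malpha.
Qed.

Let moved_bit m n : set R :=
  coord_domain `&` [set x | bit m (skew (a n) x) != bit m x].

Let mskew g := @measurable_skew R pos pos1 pos2 G alpha malpha g.

Let measurable_moved_bit m n : measurable (moved_bit m n).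
Proof.
apply: measurableI; first exact: measurable_coord_domain.
pose F b := (skew (a n) @^-1` [set x | bit m x = b]) `&` [set x | bit m x = ~~ b].
rewrite (_ : [set x | _] = F true `|` F false).
  have mF b : measurable (F b).
    apply: measurableI; last exact: measurable_bit_eq.
    rewrite -[X in measurable X]setTI; apply: mskew => //.
    exact: measurable_bit_eq.
  exact: measurableU.
apply/seteqP; split=> x; rewrite /F /=; last first.
  by case=> -[-> ->].
by case: (bit m x); case: (bit m _) => //; [right|left].
Qed.

(** Digit i of a coordinate can change only if the angle is at least k 2^-(i+1) or the coordinate
    lies near an end of its dyadic interval of length 2^-(i+1). *)
Let vanishing_moved_bit m : vanishing (fun n => unif (moved_bit m n)).
Proof.
move=> e e0; set i := pos2 m; set j := pos1 m.
(* The points near an end have measure at most 2k = e / 2; the other half of e is left for the large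
   angles. *)
pose k : R := e / 4; have k0 : 0 < k by rewrite divr_gt0.
have kq : 0 < k * 2^-1 ^+ i.+1 by rewrite mulr_gt0// exprn_gt0.
have e2 : 0 < e / 2 by rewrite divr_gt0.
have [N hN] := small_alpha kq e2; exists N => n /hN hn.
have [mE unifE'] := unif_near_ends i.+1 (ltW k0).
pose B := [set v | k * 2^-1 ^+ i.+1 <= circle_dist (alpha (a n) v)].
have mB : measurable B by exact: mdist.
apply: (@le_trans _ _ (unif (coord j.-1 @^-1` B `|` coord j @^-1` near_ends i.+1 k))).
  apply: le_measure; rewrite ?inE//.
    by apply: measurableU; exact: mcoord.
  move=> x [Dx /= hx]; apply: contrapT => /not_orP[nB nE].
  move: hx; rewrite -(posK m) -/i -/j => /negP; apply; apply/eqP.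
  rewrite -!(@bit_coord R pos)//; last first.
    exact: ((skew_domain posK1 posK2 alpha_unit (a n) x).2 Dx).
  rewrite (coord_skew posK1 posK2 alpha_unit)// /twist; case: ifP => // oj.
  apply: (@bit_rotation _ _ k i.+1) => //; first exact: coord_unit.
    move: nE; rewrite /near_ends /= !in_itv /= andbT => /not_orP[/negP + /negP].
    by rewrite -leNgt -ltNge => -> ->.
  by rewrite ltNge; apply/negP.
apply: le_trans (measureU2 _ _ _) _ => //=; try exact: mcoord.
rewrite !(unif_coord posK1 posK2 posK)//.
rewrite (_ : e = e / 2 + 2 * k); last by rewrite /k; lra.
by rewrite EFinD; apply: leeD.
Qed.

Let moved (d : R) n : set R :=
  coord_domain `&` [set x | d <= `|skew (a n) x - x|].

Let measurable_moved d n : measurable (moved d n).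
Proof.
apply: measurableI; first exact: measurable_coord_domain.
rewrite -[X in measurable X]setTI.
apply: (measurable_fun_ler (measurable_cst _) _ measurableT (Y := [set true])) => //.
by apply: measurableT_comp => //; apply: measurable_funB => //; exact: mskew.
Qed.

(** Numbers with the same first k digits differ by at most 2^-k, so a displacement by [d] changes
    one of finitely many digits. *)
Let vanishing_moved d : 0 < d -> vanishing (fun n => unif (moved d n)).
Proof.
move=> d0; have [k kd] : exists k, 2^-1 ^+ k < d.
  have : (fun k => (2^-1 : R) ^+ k) @ \oo --> 0.
    by apply: cvg_expr; rewrite ger0_norm//; lra.
  move=> /cvgrPdist_lt /(_ _ d0)[k _ /(_ k)] /= /(_ (leqnn _)).
  by rewrite sub0r normrN ger0_norm ?exprn_ge0// => ?; exists k.
apply: (@vanishing_le _ _ (fun n => \sum_(m <- iota 0 k) unif (moved_bit m n))%E);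
  last by apply: vanishing_sum => m _; exact: vanishing_moved_bit.
move=> n; apply: (@le_trans _ _ (unif (\big[setU/set0]_(m <- iota 0 k) moved_bit m n))).
  apply: le_measure; rewrite ?inE//; first exact: bigsetU_measurable.
  move=> x [Dx /= dx]; rewrite -bigcup_seq; apply: contrapT => h.
  have Tx : coord_domain (skew (a n) x).
    exact: ((skew_domain posK1 posK2 alpha_unit (a n) x).2 Dx).
  have bE m : (m < k)%N -> bit m (skew (a n) x) = bit m x.
    move=> mk; apply/eqP; apply: contrapT => /negP hm; apply: h.
    by exists m => //=; rewrite mem_iota.
  have E1 := bin_sum_bit k (skew (a n) x); have E2 := bin_sum_bit k x.
  rewrite (_ : bin_sum R (fun i => bit i (skew (a n) x)) k =
               bin_sum R (fun i => bit i x) k) in E1; last first.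
    by apply: eq_bigr => i _; rewrite bE.
  have Ed : skew (a n) x - x =
      (iter k (@dbl R) (skew (a n) x) - iter k (@dbl R) x) * 2^-1 ^+ k.
    by rewrite mulrBl; lra.
  move: dx; rewrite Ed normrM.
  have /unit_itvP/andP[h1 h2] := iter_dbl_unit k Tx.1.
  have /unit_itvP/andP[h3 h4] := iter_dbl_unit k Dx.1.
  rewrite [`|2^-1 ^+ k|]ger0_norm ?exprn_ge0// leNgt => /negP; apply.
  apply: le_lt_trans kd; rewrite ler_piMl ?exprn_ge0// ler_norml.
  by apply/andP; split; lra.
exact: measure_bigsetU_le.
Qed.

Let mTA n (A : set R) : measurable A -> measurable (skew (a n) @^-1` A).
Proof.
by move=> mA; rewrite -[X in measurable X]setTI; exact: mskew.
Qed.

(** A point that crosses t either moves by at least e / 2 or starts within e / 2 of t. *)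
Let vanishing_ray (t : R) : vanishing (fun n =>
  unif (`]-oo, t[%classic `\` skew (a n) @^-1` `]-oo, t[%classic)).
Proof.
move=> e e0; have e2 : 0 < e / 2 by rewrite divr_gt0.
have [N hN] := vanishing_moved e2 e2; exists N => n /hN hn.
pose B := moved (e / 2) n `|` `[t - e / 2, t[%classic.
have mB : measurable B by exact: measurableU.
set S := (X in unif X); have mS : measurable S by apply: measurableD => //; exact: mTA.
rewrite (@unif_eq_coord_domain R pos pos2 posK2 S (S `&` coord_domain)) //; last 2 first.
- by apply: measurableI => //; exact: measurable_coord_domain.
- by move=> x Dx; split=> [|[]].
apply: (@le_trans _ _ (unif B)).
  apply: le_measure; rewrite ?inE//.
    by apply: measurableI => //; exact: measurable_coord_domain.
  move=> x [[/= + +] Dx]; rewrite !in_itv /= => xt /negP; rewrite -leNgt => tx.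
  have [h|h] := lerP (t - e / 2) x; first by right; rewrite /= in_itv /= h.
  left; split=> //=; apply: le_trans (ler_norm _).
  by rewrite lerBrDr; apply: le_trans tx; lra.
apply: le_trans (measureU2 _ _ _) _ => //=.
rewrite [leRHS](_ : _ = ((e / 2) + (e / 2))%:E); last by congr (_%:E); lra.
rewrite EFinD; apply: leeD => //.
apply: le_trans (unif_itv_le _ _ _) _ => //; first by rewrite gerBl ltW.
by rewrite subKr.
Qed.

(** A Dynkin class argument starting from rays. The one-sided differences behave well under
    complements because invariance gives [A] minus its preimage and the preimage minus [A] the same
    measure; a countable disjoint union is cut to finitely many sets with a tail of measure at most
    e / 2. *)
Lemma skew_rigid A : measurable A ->
  vanishing (fun n => unif (A `\` skew (a n) @^-1` A)).
Proof.
move=> mA; have : <<s @RGenInftyO.G R >> A.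
  by have := mA; rewrite -[X in X -> _]/((@ocitv R).-sigma.-measurable A) RGenInftyO.measurableE.
move: A {mA}.
apply: (@dynkin_induction _ R (@RGenInftyO.G R)
  (fun A => vanishing (fun n => unif (A `\` skew (a n) @^-1` A)))).
- exact: RGenInftyO.measurableE.
- move=> _ _ [s ->] [t ->]; exists (Order.min s t).
  apply/seteqP; split=> x /=; rewrite !in_itv /= lt_min.
    by move=> [-> ->].
  by move=> /andP[-> ->].
- rewrite (_ : (fun n => _) = fun=> 0%E); first exact: vanishing0.
  by apply/funext => n; rewrite preimage_setT setDT measure0.
- by move=> _ [t ->]; exact: vanishing_ray.
- move=> S mS hS; apply: vanishing_le hS => n.
  rewrite preimage_setC setDE setCK setIC -setDE.
  have mTS := mTA n mS.
  have fin B : measurable B -> (unif B < +oo)%E.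
    by move=> mB; rewrite ltey_eq fin_num_measure.
  rewrite (measureD mTS mS (fin _ mTS)) (measureD mS mTS (fin _ mS)) setIC.
  rewrite [X in (X - _)%E](_ : _ = unif S)//.
  exact: (unif_skew posK1 posK2 posK).
- move=> F mF tF hF e e0; have e2 : 0 < e / 2 by rewrite divr_gt0.
  have mUF : measurable (\bigcup_k F k) by exact: bigcup_measurable.
  have [K hK] : exists K,
      (unif (\bigcup_k F k `\` \big[setU/set0]_(k < K) F k) <= (e / 2)%:E)%E.
    have := @measure_semi_sigma_additive _ _ _ unif F mF tF mUF.
    have fU : unif (\bigcup_k F k) \is a fin_num by exact: fin_num_measure.
    rewrite -[X in _ --> X]fineK// => /fine_cvgP[_ /cvgrPdist_le /(_ _ e2)].
    move=> [K _ /(_ K)] /= /(_ (leqnn _)) hK; exists K.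
    have mW : measurable (\big[setU/set0]_(k < K) F k) by exact: bigsetU_measurable.
    rewrite measureD ?ltey_eq ?fin_num_measure//= setIidr; last first.
      by rewrite -bigcup_mkord => x [k _ Fx]; exists k.
    rewrite (_ : unif (\big[setU/set0]_(k < K) F k) =
        (\sum_(0 <= i < K) unif (F i))%E); last first.
      by rewrite big_mkord measure_semi_additive.
    rewrite -[X in (X - _)%E]fineK// -[X in (_ - X)%E]fineK.
      by rewrite -EFinB lee_fin; apply: le_trans (ler_norm _) hK.
    by rewrite sum_fin_num; apply/allP => x /mapP[i _ ->]; exact: fin_num_measure.
  have : vanishing (fun n => \sum_(k <- iota 0 K) unif (F k `\` skew (a n) @^-1` F k))%E.
    by apply: vanishing_sum => k _; exact: hF.
  move=> /(_ _ e2)[N hN]; exists N => n /hN hn.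
  have mFT k : measurable (F k `\` skew (a n) @^-1` F k).
    by apply: measurableD => //; exact: mTA.
  pose B := \big[setU/set0]_(k <- iota 0 K) (F k `\` skew (a n) @^-1` F k).
  have mB : measurable B by exact: bigsetU_measurable.
  have mW : measurable (\bigcup_k F k `\` \big[setU/set0]_(k < K) F k).
    by apply: measurableD => //; exact: bigsetU_measurable.
  apply: (@le_trans _ _ (unif (B `|`
      (\bigcup_k F k `\` \big[setU/set0]_(k < K) F k)))).
    apply: le_measure; rewrite ?inE//.
    - by apply: measurableD => //; exact: mTA.
    - exact: measurableU.
    move=> x [[k _ Fx] nTx]; have [[i /= iK Fi]|nx] := pselect ((\bigcup_(i in `I_K) F i) x).
      left; rewrite /B -bigcup_seq; exists i; first by rewrite /= mem_iota.
      by split=> // Tx; apply: nTx; exists i.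
    by right; split; [exists k|rewrite -bigcup_mkord].
  apply: le_trans (measureU2 _ _ _) _ => //=.
  rewrite [leRHS](_ : _ = ((e / 2) + (e / 2))%:E); last by congr (_%:E); lra.
  rewrite EFinD; apply: leeD => //; apply: le_trans hn.
  exact: measure_bigsetU_le.
Qed.

End skew_product_dynamics.

Theorem skew_system (R : realType) (G : zmodType) (alpha : G -> R -> R)
    (a : nat -> G) :
  (forall g v, unit_itv (alpha g v)) ->
  (forall g, measurable_fun setT (alpha g)) ->
  (forall v, alpha 0 v = 0) ->
  (forall g h v, alpha (g + h) v = rotation (alpha g v) (alpha h v)) ->
  (forall g, g != 0 -> exists B : set R,
     [/\ measurable B, (0 < unif B)%E & forall v, B v -> alpha g v != 0]) ->
  (forall e : R, 0 < e ->
     vanishing (fun n => unif [set v | e <= circle_dist (alpha (a n) v)])) ->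
  exists (d : measure_display) (X : measurableType d) (mu : probability X R)
    (T : G -> X -> X),
    [/\ measure_preserving_system mu T, free_system mu T &
        rigidity_sequence mu T a].
Proof.
move=> alpha_unit malpha alpha0 alphaD hfree hrigid.
have /card_set_bijP[f fbij] := card_nat2.
have [finj fsurj] : injective f /\ forall m, exists p, f p = m.
  case: fbij => _ fi fs; split.
    by move=> p q; apply: fi; rewrite inE.
  by move=> m; have [p _ pm] := fs m Logic.I; exists p.
pose finv m := projT1 (cid (fsurj m)).
have finvK m : f (finv m) = m by rewrite /finv; case: cid.
have fK p : finv (f p) = p by apply: finj; rewrite finvK.
pose pos j i := f (j, i); pose pos1 m := (finv m).1; pose pos2 m := (finv m).2.
have posK1 j i : pos1 (pos j i) = j by rewrite /pos1 fK.
have posK2 j i : pos2 (pos j i) = i by rewrite /pos2 fK.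
have posK m : pos (pos1 m) (pos2 m) = m by rewrite /pos -surjective_pairing finvK.
pose T := skew pos pos1 pos2 alpha.
have T0 : T 0 = id by exact: skew0.
have TD g h : T (g + h) = T g \o T h by exact: skewD.
have mT g : measurable_fun setT (T g) by exact: measurable_skew.
have unifT g A : measurable A -> unif (T g @^-1` A) = unif A.
  exact: unif_skew.
have Tout g x : ~ unit_itv x -> T g x = x.
  by move=> nx; rewrite /T /skew asboolF// => -[].
exists _, _, (@unifc R), T; split.
- exact: completed_measure_preserving.
- apply: completed_free => // g /hfree[B [mB B0 hB]].
  exact: (skew_fix_negligible posK1 posK2 posK alpha_unit mB B0 hB).
- apply: completed_rigid => // A mA.
  exact: (skew_rigid posK1 posK2 posK alpha_unit malpha hrigid mA).
Qed.

(** * The complex circle and its arguments *)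

Section complex_circle.
Variable R : realType.
Local Notation C := (R[i]).
Implicit Types (z w : C) (t : R).

Definition cabs z : R := complex.Re `|z|.

Lemma cabsE z : `|z| = (cabs z)%:C%C.
Proof. by rewrite /cabs normc_def. Qed.

Lemma cabs_ge0 z : 0 <= cabs z.
Proof. by rewrite -ler0c -cabsE. Qed.

Lemma cabsM z w : cabs (z * w) = cabs z * cabs w.
Proof. by apply: complexI; rewrite -cabsE normrM !cabsE rmorphM. Qed.

Lemma cabsD z w : cabs (z + w) <= cabs z + cabs w.
Proof. by rewrite -lecR rmorphD /= -!cabsE ler_normD. Qed.

Lemma cabsN z : cabs (- z) = cabs z.
Proof. by rewrite /cabs normrN. Qed.

Lemma cabsC z w : cabs (z - w) = cabs (w - z).
Proof. by rewrite -cabsN opprB. Qed.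

Lemma cabs_eq0 z : (cabs z == 0) = (z == 0).
Proof. by rewrite -(inj_eq (@complexI R)) -cabsE normr_eq0. Qed.

Lemma cabs0 : cabs 0 = 0. Proof. by apply/eqP; rewrite cabs_eq0. Qed.

Lemma cabs_gt0 z : (0 < cabs z) = (z != 0).
Proof. by rewrite lt_neqAle cabs_ge0 andbT eq_sym cabs_eq0. Qed.

Lemma cabsX z n : cabs (z ^+ n) = cabs z ^+ n.
Proof.
elim: n => [|n IHn]; last by rewrite !exprS cabsM IHn.
by rewrite !expr0 /cabs normr1.
Qed.

Lemma cabs_triangle (u z w : C) : cabs (z - w) <= cabs (z - u) + cabs (u - w).
Proof. by apply: le_trans (cabsD _ _); rewrite addrA subrK. Qed.

Lemma circleP z : circle z <-> cabs z = 1.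
Proof.
rewrite /circle /= cabsE; split=> [/(@complexI R _ 1)//|->//].
Qed.

Lemma Re_le_cabs z : `|complex.Re z| <= cabs z.
Proof. by rewrite -lecR -cabsE; exact: normc_ge_Re. Qed.

Lemma Im_le_cabs z : `|complex.Im z| <= cabs z.
Proof.
by rewrite /cabs normc_def /= -sqrtr_sqr ler_wsqrtr// lerDr sqr_ge0.
Qed.

Lemma cabs_le z : cabs z <= `|complex.Re z| + `|complex.Im z|.
Proof.
rewrite /cabs normc_def /=.
rewrite -[leRHS]ger0_norm ?addr_ge0// -sqrtr_sqr ler_wsqrtr//.
rewrite sqrrD !real_normK ?num_real// addrAC lerDl.
by rewrite mulrn_wge0// mulr_ge0.
Qed.

Lemma ReB_le_cabs z w : `|complex.Re z - complex.Re w| <= cabs (z - w).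
Proof.
move: z w => [a b] [a' b']; exact: Re_le_cabs ((a +i* b) - (a' +i* b'))%C.
Qed.

Lemma ImB_le_cabs z w : `|complex.Im z - complex.Im w| <= cabs (z - w).
Proof.
move: z w => [a b] [a' b']; exact: Im_le_cabs ((a +i* b) - (a' +i* b'))%C.
Qed.

Lemma cabs_circle z : cabs z = 1 -> complex.Re z ^+ 2 + complex.Im z ^+ 2 = 1.
Proof.
move=> z1; have := add_Re2_Im2 z; rewrite cabsE z1 expr1n.
exact: (@complexI R).
Qed.

Definition cexp t : C := (cos (2 * pi * t) +i* sin (2 * pi * t))%C.

Lemma cexpD s t : cexp (s + t) = cexp s * cexp t.
Proof.
rewrite /cexp mulrDr cosD sinD; apply/eqP; rewrite eq_complex /=.
by rewrite eqxx addrC [sin _ * cos _]mulrC [cos _ * sin (2 * pi * t)]mulrC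
  [X in X + _]mulrC eqxx.
Qed.

Lemma cexp0 : cexp 0 = 1.
Proof. by rewrite /cexp mulr0 cos0 sin0. Qed.

Lemma cexp1 : cexp 1 = 1.
Proof. by rewrite /cexp mulr1 mulr_natl cos2pi sin2pi. Qed.

Lemma cabs_cexp t : cabs (cexp t) = 1.
Proof. by rewrite /cabs normc_def /= cos2Dsin2 sqrtr1. Qed.

Lemma cexpN t : cexp (- t) = (cexp t)^-1.
Proof.
apply: (mulIf (x := cexp t)); first by rewrite -cabs_eq0 cabs_cexp oner_eq0.
rewrite mulVf; last by rewrite -cabs_eq0 cabs_cexp oner_eq0.
by rewrite -cexpD addNr cexp0.
Qed.

Lemma cexpMn t n : cexp (t *+ n) = cexp t ^+ n.
Proof.
elim: n => [|n IHn]; first by rewrite mulr0n cexp0.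
by rewrite mulrS exprS cexpD IHn.
Qed.

Lemma cabs_cexpB s t : cabs (cexp s - cexp t) = cabs (cexp (s - t) - 1).
Proof.
by rewrite -[RHS]mulr1 -(cabs_cexp t) -cabsM mulrBl mul1r -cexpD subrK.
Qed.

Lemma cexp_near1 (e : R) : 0 < e -> exists2 d : R, 0 < d &
  forall t, `|t| < d -> cabs (cexp t - 1) < e.
Proof.
move=> e0; have e2 : 0 < e / 2 by rewrite divr_gt0.
have p2 : 0 < 2 * (pi : R) by rewrite mulr_gt0// pi_gt0.
have /cvgrPdist_lt/(_ _ e2)/nbhs_ballP[d1 /= d10 h1] := @continuous_cos R 0.
have /cvgrPdist_lt/(_ _ e2)/nbhs_ballP[d2 /= d20 h2] := @continuous_sin R 0.
pose d := Num.min d1 d2; have d0 : 0 < d by rewrite lt_min d10.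
exists (d / (2 * pi)); first by rewrite divr_gt0.
move=> t; rewrite ltr_pdivlMr// => td.
have td' : `|0 - 2 * pi * t| < d.
  by rewrite sub0r normrN normrM gtr0_norm// mulrC.
apply: le_lt_trans (cabs_le _) _ => /=.
have t1 : ball (0 : R) d1 (2 * pi * t).
  by rewrite /ball /=; apply: lt_le_trans td' _; rewrite ge_min lexx.
have t2 : ball (0 : R) d2 (2 * pi * t).
  by rewrite /ball /=; apply: lt_le_trans td' _; rewrite ge_min lexx orbT.
have := h1 _ t1; have := h2 _ t2 => /=.
rewrite cos0 sin0 subr0 sub0r normrN distrC => a b; lra.
Qed.

Lemma circle_dist_unit (a : R) : unit_itv a -> 0 <= circle_dist a <= 2^-1.
Proof.
move=> /unit_itvP/andP[a0 a1]; rewrite /circle_dist minElt.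
by case: ifP => [h|/negbT]; rewrite -?leNgt => *; apply/andP; split; lra.
Qed.

Lemma Re_cexp_circle_dist (a : R) : complex.Re (cexp a) = cos (2 * pi * circle_dist a).
Proof.
rewrite /circle_dist minElt /=; case: ifP => // _.
by rewrite mulrBr mulr1 -[RHS]cosN opprB -[RHS]cosD2pi -[pi *+ 2]mulr_natl subrK.
Qed.

(** The cosine decreases on [0, pi], so the real part of [cexp a] is at most cos(2 pi e), and k = 1
    - cos(2 pi e) will do. *)
Lemma circle_dist_cexp (e : R) : 0 < e -> exists2 k : R, 0 < k &
  forall a, unit_itv a -> e <= circle_dist a -> k <= cabs (cexp a - 1).
Proof.
move=> e0; have p0 := @pi_gt0 R.
have [e2|e2] := lerP e 2^-1; last first.
  (* For e > 1/2 no [a] qualifies, since [circle_dist] is at most 1/2; the value 1 is arbitrary. *)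
  by exists 1 => // a /circle_dist_unit/andP[_ h1] h2; lra.
have I0 : (0 : R) \in `[0, pi] by rewrite in_itv /= lexx pi_ge0.
have Ie (t : R) : 0 <= t <= 2^-1 -> 2 * pi * t \in `[0, pi].
  move=> /andP[t0 t2]; rewrite in_itv /= !mulr_ge0 ?pi_ge0//=.
  by rewrite mulrAC ler_piMl ?pi_ge0//; lra.
exists (1 - cos (2 * pi * e)).
  by rewrite subr_gt0 -[ltRHS]cos0 ltr_cos// ?Ie ?(ltW e0)// !mulr_gt0.
move=> a a01 ea; have /andP[d0 d2] := circle_dist_unit a01.
apply: le_trans (Re_le_cabs _); rewrite -normrN; apply: le_trans (ler_norm _).
have -> : - complex.Re (cexp a - 1) = 1 - complex.Re (cexp a) by rewrite /= opprB.
rewrite Re_cexp_circle_dist lerB// leNgt ltr_cos ?Ie ?d0// ?(ltW e0)//.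
by rewrite -leNgt ler_pM2l// mulr_gt0.
Qed.

Lemma cexp_inj (s t : R) : unit_itv s -> unit_itv t -> cexp s = cexp t -> s = t.
Proof.
wlog ts : s t / t <= s.
  move=> h s01 t01 e; have [ts|st] := lerP t s; first exact: h.
  by apply/esym; apply: h => //; exact: ltW.
move=> /unit_itvP/andP[s0 s1] /unit_itvP/andP[t0 t1] e.
have d01 : unit_itv (s - t) by apply/unit_itvP/andP; split; lra.
have e1 : cexp (s - t) = 1.
  by rewrite cexpD cexpN e mulfV// -cabs_eq0 cabs_cexp oner_eq0.
apply/eqP; rewrite -subr_eq0; apply: contraT => d0.
have c0 : 0 < circle_dist (s - t).
  move/unit_itvP: (d01) => /andP[h h1].
  by rewrite /circle_dist lt_min [X in _ && X]subr_gt0 h1 andbT lt_neqAle eq_sym d0.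
have [k k0 /(_ _ d01 (lexx _))] := circle_dist_cexp c0.
by rewrite e1 subrr cabs0 leNgt k0.
Qed.

(** The argument in [0, 1), in units of a full turn; [acos] alone covers the upper half of the
    circle. *)
Definition arg z : R :=
  let a := acos (complex.Re z) / (2 * pi) in
  if 0 <= complex.Im z then a else 1 - a.

Lemma Re_circle z : cabs z = 1 -> -1 <= complex.Re z <= 1.
Proof. by move=> z1; rewrite -ler_norml -z1 Re_le_cabs. Qed.

Lemma cexp_arg z : cabs z = 1 -> cexp (arg z) = z.
Proof.
move=> z1; have x1 := Re_circle z1; have p0 := @pi_gt0 R.
have s1 : sin (acos (complex.Re z)) = `|complex.Im z|.
  by rewrite sin_acos// -(cabs_circle z1) addrC addKr sqrtr_sqr.
have pE : 2 * pi * (acos (complex.Re z) / (2 * pi)) = acos (complex.Re z).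
  by rewrite mulrC mulfVK// mulf_neq0// gt_eqF.
rewrite [RHS]complexE /cexp /arg; case: ifPn => h.
  rewrite pE acosK ?in_itv//= s1 ger0_norm//.
  by apply/eqP; rewrite eq_complex /= !(mulr0,mul0r,mulr1,mul1r,addr0,add0r,subr0) !eqxx.
rewrite mulrBr mulr1 pE mulr_natl addrC cosD2pi sinD2pi cosN sinN.
rewrite acosK ?in_itv//= s1 ltr0_norm ?ltNge// opprK.
by apply/eqP; rewrite eq_complex /= !(mulr0,mul0r,mulr1,mul1r,addr0,add0r,subr0) !eqxx.
Qed.

Lemma arg_unit z : cabs z = 1 -> unit_itv (arg z).
Proof.
move=> z1; have x1 := Re_circle z1; have p0 := @pi_gt0 R.
have a0 := acos_ge0 x1; have a1 := acos_lepi x1.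
have p2 : 0 < 2 * (pi : R) by rewrite mulr_gt0.
have h2 : acos (complex.Re z) / (2 * pi) <= 2^-1.
  by rewrite ler_pdivrMr// mulrA mulVf// mul1r.
have h0 : 0 <= acos (complex.Re z) / (2 * pi) by rewrite divr_ge0// ltW.
apply/unit_itvP/andP; rewrite /arg; case: ifPn => h; split; try lra.
rewrite gtrBl divr_gt0// acos_gt0//; case/andP: x1 => -> /=.
rewrite le_eqVlt => /orP[/eqP x1|//].
have := cabs_circle z1; rewrite x1 expr1n => /eqP.
by rewrite -subr_eq0 addrC addKr sqrf_eq0 => /eqP i0; rewrite i0 lexx in h.
Qed.

Lemma argM z w : cabs z = 1 -> cabs w = 1 ->
  arg (z * w) = rotation (arg z) (arg w).
Proof.
move=> z1 w1; have zw1 : cabs (z * w) = 1 by rewrite cabsM z1 w1 mulr1.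
apply: cexp_inj; first exact: arg_unit.
  by apply: rotation_unit; exact: arg_unit.
rewrite cexp_arg// /rotation; case: ifP => _.
  by rewrite cexpD !cexp_arg// mulrC.
by rewrite !cexpD cexpN cexp1 invr1 mulr1 !cexp_arg// mulrC.
Qed.

Lemma cabs1 : cabs 1 = 1.
Proof. by rewrite -cexp0 cabs_cexp. Qed.

Lemma arg1 : arg 1 = 0.
Proof.
apply: cexp_inj; first exact: (arg_unit cabs1).
  by apply/unit_itvP; rewrite lexx ltr01.
by rewrite (cexp_arg cabs1) cexp0.
Qed.

Lemma arg_eq0 z : cabs z = 1 -> arg z = 0 -> z = 1.
Proof. by move=> z1 a0; rewrite -(cexp_arg z1) a0 cexp0. Qed.

(** By monotonicity, acos y < c means cos c < y when 0 < c <= pi; this gives the preimages of rays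
    under [acos]. *)
Lemma measurable_arg d (T : measurableType d) (f : T -> C) :
  (forall x : T, cabs (f x) = 1) ->
  measurable_fun setT (fun x : T => complex.Re (f x)) ->
  measurable_fun setT (fun x : T => complex.Im (f x)) ->
  measurable_fun setT (fun x : T => arg (f x)).
Proof.
move=> f1 mRe mIm.
have macos : measurable_fun setT (fun x : T => acos (complex.Re (f x))).
  apply: (measurability _ (RGenInftyO.measurableE R)) => //.
  move=> _ [_ [c ->] <-]; rewrite setTI.
  have [c0|c0] := lerP c 0.
    rewrite (_ : _ @^-1` _ = set0)//; apply/seteqP; split=> // x /=.
    rewrite in_itv /= => h; have := acos_ge0 (Re_circle (f1 x)).
    by rewrite leNgt (lt_le_trans h c0).
  have [cp|cp] := lerP c pi; last first.
    rewrite (_ : _ @^-1` _ = setT)//; apply/seteqP; split=> // x _ /=.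
    by rewrite in_itv /=; apply: le_lt_trans cp; exact: acos_lepi (Re_circle (f1 x)).
  rewrite (_ : _ @^-1` _ = [set x : T | cos c < complex.Re (f x)]).
    rewrite -[X in measurable X]setTI.
    exact: (measurable_fun_ltr (measurable_cst _) mRe measurableT (Y := [set true])).
  have E (x : T) : (acos (complex.Re (f x)) < c) = (cos c < complex.Re (f x)).
    have x1 := Re_circle (f1 x).
    rewrite -{2}(acosK (x := complex.Re (f x))) ?in_itv//= ltr_cos//.
      by rewrite in_itv /= acos_ge0 ?acos_lepi.
    by rewrite in_itv /= cp andbT ltW.
  by apply/seteqP; split=> x /=; rewrite in_itv /= E.
apply: measurable_fun_ifT.
- exact: measurable_fun_ler.
- exact: measurable_funM.
- by apply: measurable_funB => //; exact: measurable_funM.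
Qed.

(** The argument is rounded down to a multiple of 1/m. A single order m for all points of the circle
    later allows exponents to be counted modulo m. *)
Lemma root_dense (e : R) : 0 < e -> exists2 m : nat, (0 < m)%N &
  forall z, cabs z = 1 -> exists2 c, c ^+ m = 1 & cabs (c - z) < e.
Proof.
move=> /cexp_near1[d d0 hd].
pose m := (Num.truncn d^-1).+1; have md : m%:R^-1 < d.
  by rewrite invf_plt ?posrE// truncnS_gt.
exists m => // z z1; have /unit_itvP/andP[a0 a1] := arg_unit z1.
set a := arg z in a0 a1; pose k := Num.truncn (a * m%:R).
exists (cexp (k%:R / m%:R)).
  have kE : k%:R / m%:R *+ m = k%:R :> R.
    by rewrite -[LHS]mulr_natr mulfVK// pnatr_eq0.
  by rewrite -cexpMn kE cexpMn cexp1 expr1n.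
rewrite -(cexp_arg z1) cabs_cexpB; apply: hd; rewrite -/a distrC.
have m0 : 0 < (m%:R : R) by rewrite ltr0n.
have /andP[h1 h2] := truncn_itv (mulr_ge0 a0 (ltW m0)).
apply: le_lt_trans md; rewrite -[X in X - _](mulfK (lt0r_neq0 m0)) -mulrBl normrM.
rewrite [X in _ * X]ger0_norm ?invr_ge0 ?ler0n// ler_piMl ?invr_ge0 ?ler0n//.
by rewrite ger0_norm ?subr_ge0// lerBlDl natr1 ltW.
Qed.

End complex_circle.

(** * Concentration of measure in the Hamming cube *)

Section hamming_concentration.
Variables (R : realType) (Omega : finType).
Local Notation cube n := {ffun 'I_n -> Omega}.

Definition hamming n (x y : cube n) : nat := #|[pred i | x i != y i]|.

Lemma hammingE n (x y : cube n) : hamming x y = (\sum_i (x i != y i))%N.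
Proof.
by rewrite /hamming -sum1_card big_mkcond; apply: eq_bigr => i _; rewrite inE; case: eqP.
Qed.

Definition ffun_cons n (a : Omega) (x : cube n) : cube n.+1 :=
  [ffun i => oapp x a (unlift ord0 i)].

Lemma ffun_cons0 n a (x : cube n) : ffun_cons a x ord0 = a.
Proof. by rewrite ffunE unlift_none. Qed.

Lemma ffun_consS n a (x : cube n) i : ffun_cons a x (lift ord0 i) = x i.
Proof. by rewrite ffunE liftK. Qed.

Lemma hamming_cons n a b (x y : cube n) :
  hamming (ffun_cons a x) (ffun_cons b y) = ((a != b) + hamming x y)%N.
Proof.
rewrite !hammingE big_ord_recl !ffun_cons0; congr addn.
by apply: eq_bigr => i _; rewrite !ffun_consS.
Qed.

Lemma sum_ffun_cons n (F : cube n.+1 -> R) :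
  \sum_x F x = \sum_(a : Omega) \sum_(x : cube n) F (ffun_cons a x).
Proof.
rewrite pair_big /=.
rewrite (reindex (fun p : Omega * cube n => ffun_cons p.1 p.2)) //=.
exists (fun x : cube n.+1 => (x ord0, [ffun i => x (lift ord0 i)])) => [[a x] _|x _] /=.
  by rewrite ffun_cons0; congr pair; apply/ffunP => i; rewrite ffunE ffun_consS.
apply/ffunP => i; rewrite ffunE; case: unliftP => [j ->|->] //=.
by rewrite ffunE.
Qed.

Lemma hammingxx n (x : cube n) : hamming x x = 0%N.
Proof. by apply: eq_card0 => i; rewrite !inE eqxx. Qed.

Lemma hammingC n (x y : cube n) : hamming x y = hamming y x.
Proof. by apply: eq_card => i; rewrite !inE eq_sym. Qed.

Lemma hamming_triangle n (y x z : cube n) :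
  (hamming x z <= hamming x y + hamming y z)%N.
Proof.
rewrite !hammingE -big_split /=; apply: leq_sum => i _.
case: (eqVneq (x i) (y i)) => [->|_] //=.
exact: leq_trans (leq_b1 _) (leq_addr _ _).
Qed.

Lemma sum_square_diff (X : finType) (f g : X -> R) :
  \sum_x \sum_y (f x - g y) ^+ 2 =
  #|X|%:R * \sum_x f x ^+ 2 + #|X|%:R * \sum_y g y ^+ 2
  - 2 * (\sum_x f x) * (\sum_y g y).
Proof.
transitivity (\sum_x (#|X|%:R * f x ^+ 2 + \sum_y g y ^+ 2
    - 2 * f x * \sum_y g y)).
  apply: eq_bigr => x _.
  rewrite (eq_bigr (fun y => f x ^+ 2 + g y ^+ 2 - 2 * f x * g y)).
    by rewrite sumrB big_split /= sumr_const -mulr_sumr -[X in X + _ - _]mulr_natl.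
  by move=> y _; ring.
rewrite sumrB big_split /= sumr_const -mulr_sumr -mulr_suml -mulr_sumr.
by rewrite -[X in _ + X - _]mulr_natl.
Qed.

(* Induction on the dimension through the law of total variance: the first
   coordinate contributes at most 1 to the variance of a 1-Lipschitz function. *)
Lemma hamming_variance n (f : cube n -> R) :
  (forall x y, `|f x - f y| <= (hamming x y)%:R) ->
  \sum_x \sum_y (f x - f y) ^+ 2 <= n%:R * (#|Omega|%:R ^+ n) ^+ 2.
Proof.
elim: n f => [|n IHn] f f_lip.
  rewrite mul0r big1// => x _; rewrite big1// => y _.
  suff -> : x = y by rewrite subrr expr0n.
  by apply/ffunP => -[].
rewrite sum_ffun_cons [_ ^+ n.+1]exprS; set M : R := #|Omega|%:R ^+ n.
have ME : M = #|cube n|%:R by rewrite card_ffun card_ord natrX.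
pose F a := \sum_(x : cube n) f (ffun_cons a x).
pose V a := \sum_(x : cube n) \sum_(y : cube n)
  (f (ffun_cons a x) - f (ffun_cons a y)) ^+ 2.
have VE a : V a = 2 * (M * \sum_(x : cube n) f (ffun_cons a x) ^+ 2) - 2 * F a ^+ 2.
  rewrite /V sum_square_diff -ME -/(F a); ring.
have V_le a : V a <= n%:R * M ^+ 2.
  apply: IHn => x y; apply: le_trans (f_lip _ _) _.
  by rewrite hamming_cons eqxx.
have F_le a b : (F a - F b) ^+ 2 <= M ^+ 2.
  rewrite -[leLHS]real_normK ?num_real// lerXn2r// ?nnegrE ?exprn_ge0//.
  rewrite -sumrB; apply: le_trans (ler_norm_sum _ _ _) _.
  rewrite ME -sum1_card natr_sum; apply: ler_sum => x _.
  apply: le_trans (f_lip _ _) _; rewrite hamming_cons hammingxx addn0.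
  by rewrite lern1; case: (a == b).
have E a b : \sum_(x : cube n) \sum_(y : cube n)
    (f (ffun_cons a x) - f (ffun_cons b y)) ^+ 2 =
    2^-1 * V a + 2^-1 * V b + (F a - F b) ^+ 2.
  rewrite sum_square_diff -ME -/(F a) -/(F b) !VE; by field.
have -> : \sum_a \sum_(x : cube n) \sum_y (f (ffun_cons a x) - f y) ^+ 2 =
    \sum_a \sum_b (2^-1 * V a + 2^-1 * V b + (F a - F b) ^+ 2).
  apply: eq_bigr => a _.
  under eq_bigr => x _ do rewrite sum_ffun_cons.
  by rewrite exchange_big; apply: eq_bigr => b _; rewrite E.
apply: (@le_trans _ _ (\sum_(a : Omega) \sum_(b : Omega) (n.+1%:R * M ^+ 2))).
  apply: ler_sum => a _; apply: ler_sum => b _.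
  have := V_le a; have := V_le b; have := F_le a b.
  by rewrite -[n.+1%:R]natr1 mulrDl mul1r; lra.
rewrite !sumr_const -!mulrnA -[leLHS]mulr_natr natrM exprMn -mulrA.
by rewrite [X in n.+1%:R * X]mulrC -expr2.
Qed.

(** A Chebyshev argument for the distance to [A]: it is 1-Lipschitz, vanishes on [A], and on [B] is
    at least the distance of the two sets. The pairs in A x B alone thus contribute |A| |B| times
    the square of that distance to the sum bounded by [hamming_variance]. *)
Lemma hamming_concentration n (A B : {set cube n}) (delta : R) :
  (0 < #|Omega|)%N -> 0 < delta ->
  delta * #|Omega|%:R ^+ n <= #|A|%:R -> delta * #|Omega|%:R ^+ n <= #|B|%:R ->
  exists x y, [/\ x \in A, y \in B & (delta * (hamming x y)%:R) ^+ 2 <= n%:R].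
Proof.
move=> Omega0 delta0 hA hB; set M : R := #|Omega|%:R ^+ n in hA hB.
have M0 : 0 < M by rewrite exprn_gt0// ltr0n.
have dM0 : 0 < delta * M by rewrite mulr_gt0.
have /card_gt0P[a0 Aa0] : (0 < #|A|)%N by rewrite -(ltr0n R) (lt_le_trans dM0).
have /card_gt0P[b0 Bb0] : (0 < #|B|)%N by rewrite -(ltr0n R) (lt_le_trans dM0).
pose near x := [arg min_(a < a0 in A) hamming x a].
have nearA x : near x \in A by rewrite /near; case: arg_minnP.
have near_min x a : a \in A -> (hamming x (near x) <= hamming x a)%N.
  by rewrite /near; case: arg_minnP => // i _; apply.
pose f x : R := (hamming x (near x))%:R.
have f_le x y : f x <= (hamming x y)%:R + f y.
  rewrite -natrD ler_nat.
  exact: leq_trans (near_min _ _ (nearA y)) (hamming_triangle _ _ _).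
have f_lip x y : `|f x - f y| <= (hamming x y)%:R.
  have := f_le x y; have := f_le y x; rewrite hammingC ler_norml => h1 h2.
  by apply/andP; split; lra.
pose b := [arg min_(b < b0 in B) hamming b (near b)].
have [Bb b_min] : b \in B /\ forall y, y \in B -> f b <= f y.
  rewrite /b; case: arg_minnP => // i Bi h; split=> // y By.
  by rewrite ler_nat h.
exists (near b), b; split=> //; rewrite hammingC -/(f b).
have h := hamming_variance f_lip; rewrite -/M in h.
have fA x : x \in A -> f x = 0.
  by move=> Ax; apply/eqP; rewrite pnatr_eq0 -leqn0 -(hammingxx x) near_min.
suff : (delta * f b) ^+ 2 * M ^+ 2 <= n%:R * M ^+ 2.
  by rewrite ler_pM2r// exprn_gt0.
apply: le_trans h.
apply: (@le_trans _ _ (\sum_(x in A) \sum_(y in B) f b ^+ 2)).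
  rewrite !sumr_const -mulrnA -mulr_natr natrM -exprMn.
  rewrite (_ : (delta * f b * M) ^+ 2 =
      f b ^+ 2 * ((delta * M) * (delta * M))); last by ring.
  by rewrite ler_wpM2l ?sqr_ge0// ler_pM ?(ltW dM0).
rewrite [leRHS](bigID (mem A)) /= -[leLHS]addr0 lerD ?sumr_ge0//; last first.
  by move=> x _; rewrite sumr_ge0// => y _; rewrite sqr_ge0.
apply: ler_sum => x Ax; rewrite [leRHS](bigID (mem B)) /= -[leLHS]addr0.
rewrite lerD ?sumr_ge0//; last by move=> y _; rewrite sqr_ge0.
apply: ler_sum => y By; rewrite (fA x Ax) sub0r sqrrN.
by rewrite lerXn2r ?nnegrE ?ler0n// b_min.
Qed.

End hamming_concentration.

(** * Recurrence along sums indexed by a cube *)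

Section cube_recurrence.
Variable R : realType.

(** The number of x with p in [E x] has mean at least delta |X|, so it cannot be below half of this
    at every p off a null set. *)
Lemma popular_point d (T : measurableType d) (mu : probability T R)
    (X : finType) (E : X -> set T) (Z : set T) (delta : R) :
  (0 < #|X|)%N -> 0 < delta -> measurable Z -> mu Z = 0 ->
  (forall x, measurable (E x)) -> (forall x, (delta%:E <= mu (E x))%E) ->
  exists2 p, ~ Z p & delta / 2 * #|X|%:R <= #|[set x | `[< E x p >]]%SET|%:R.
Proof.
move=> X0 delta0 mZ Z0 mE hE; apply: contrapT => H.
have few p : ~ Z p -> #|[set x | `[< E x p >]]%SET|%:R < delta / 2 * #|X|%:R.
  by move=> Zp; rewrite ltNge; apply/negP => h; apply: H; exists p.
have N0 : 0 < (#|X|%:R : R) by rewrite ltr0n.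
pose f p : \bar R := (\sum_(x : X) (\1_(E x) p)%:E)%E.
pose g p : \bar R := ((delta / 2 * #|X|%:R)%:E + #|X|%:R%:E * (\1_Z p)%:E)%E.
have fE p : f p = (#|[set x | `[< E x p >]]%SET|%:R)%:E.
  rewrite /f sumEFin -sum1_card natr_sum [in RHS]big_mkcond; congr EFin.
  apply: eq_bigr => x _; rewrite inE indicE.
  by case: asboolP => h; rewrite ?(mem_set h) ?(memNset h).
have fg p : (f p <= g p)%E.
  rewrite fE /g indicE -EFinM -EFinD lee_fin.
  have [Zp|Zp] := pselect (Z p).
    rewrite mem_set// mulr1 -[leLHS]add0r; apply: lerD.
      by rewrite mulr_ge0 ?divr_ge0 ?(ltW delta0).
    by rewrite ler_nat max_card.
  by rewrite memNset// mulr0 addr0 ltW// few.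
have f_int : (\int[mu]_p f p = \sum_(x : X) mu (E x))%E.
  rewrite ge0_integral_sum//.
    by apply: eq_bigr => x _; rewrite integral_indic// setIT.
  by move=> x; apply/measurable_EFinP; exact: measurable_indic.
have g_int : (\int[mu]_p g p = (delta / 2 * #|X|%:R)%:E)%E.
  rewrite ge0_integralD//.
  - rewrite integral_cst//= probability_setT mule1 ge0_integralZl//.
      by rewrite integral_indic//= setIT Z0 mule0 adde0.
    by apply/measurable_EFinP; exact: measurable_indic.
  - by move=> p _; rewrite lee_fin mulr_ge0 ?divr_ge0 ?(ltW delta0).
  - by apply/measurable_EFinP/measurable_funM => //; exact: measurable_indic.
have : (\int[mu]_p f p <= \int[mu]_p g p)%E.
  apply: ge0_le_integral => //.
  - by move=> p _; rewrite fE lee_fin.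
  - by apply: emeasurable_sum => x; apply/measurable_EFinP; exact: measurable_indic.
  - apply/measurable_EFinP/measurable_funD => //.
    by apply: measurable_funM => //; exact: measurable_indic.
rewrite f_int g_int; apply/negP; rewrite -ltNge.
apply: (@lt_le_trans _ _ (\sum_(x : X) delta%:E)%E); last exact: lee_sum.
rewrite sumEFin lte_fin sumr_const -[ltRHS]mulr_natr ltr_pM2r//; lra.
Qed.

Definition cube_sum (G : zmodType) n m (g : 'I_n -> G) (x : {ffun 'I_n -> 'I_m}) : G :=
  \sum_i g i *+ x i.

(** Translation by (1, ..., 1) in (Z/m)^n. [ordS] is cyclic, whereas [cube_sum] uses the
    representatives 0, ..., m - 1 as integers. *)
Definition cube_shift n m (x : {ffun 'I_n -> 'I_m}) : {ffun 'I_n -> 'I_m} :=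
  [ffun i => ordS (x i)].

Lemma cube_shift_inj n m : injective (@cube_shift n m).
Proof.
move=> x y /ffunP h; apply/ffunP => i; have := h i; rewrite !ffunE.
exact: ordS_inj.
Qed.

(* For a point p of X that is in many of the sets T (cube_sum g x) @^-1` A, the
   set of these x comes close in the Hamming distance to its own translate by
   (1, ..., 1). *)
Lemma cube_recurrence (G : zmodType) (n m D : nat) (g : 'I_n -> G) (delta : R) :
  (0 < m)%N -> 0 < delta -> n%:R < (delta / 2 * D.+1%:R) ^+ 2 ->
  forall (d : measure_display) (X : measurableType d) (mu : probability X R)
    (T : G -> X -> X), measure_preserving_system mu T ->
  forall A : set X, measurable A -> (delta%:E <= mu A)%E ->
  exists x y : {ffun 'I_n -> 'I_m}, (hamming x (cube_shift y) <= D)%N /\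
    (0 < mu (A `&` T (cube_sum g x - cube_sum g y)%R @^-1` A))%E.
Proof.
move=> m0 delta0 nD d X mu T [_ T0 TD mT Tmu] A mA hA; apply: contrapT => H.
pose good (p : {ffun 'I_n -> 'I_m} * {ffun 'I_n -> 'I_m}) :=
  (hamming p.1 (cube_shift p.2) <= D)%N.
have mTA r B : measurable B -> measurable (T r @^-1` B).
  by move=> mB; rewrite -[X in measurable X]setTI; exact: mT.
pose Zp (p : {ffun 'I_n -> 'I_m} * {ffun 'I_n -> 'I_m}) := T (cube_sum g p.2) @^-1`
   (A `&` T (cube_sum g p.1 - cube_sum g p.2) @^-1` A).
have mZp p : measurable (Zp p) by apply/mTA/measurableI => //; exact: mTA.
(* The points that visit [A] at both times [cube_sum g x] and [cube_sum g y] for some close pair (x,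
   y). If no such pair gave a return of positive measure, this would be a null set. *)
pose Z := \big[setU/set0]_(p | good p) Zp p.
have mZ : measurable Z by exact: bigsetU_measurable.
have Z0 : mu Z = 0.
  apply/eqP; rewrite -measure_le0 /Z -big_filter.
  apply: le_trans (measure_bigsetU_le _ _ mZp) _.
  rewrite big_filter big1// => p gp; apply: etrans (Tmu _ _ _) _.
    by apply/measurableI => //; exact: mTA.
  apply/eqP; rewrite -measure_le0 leNgt; apply/negP => h; apply: H.
  by exists p.1, p.2.
have N0 : (0 < #|{ffun 'I_n -> 'I_m}|)%N by rewrite card_ffun !card_ord expn_gt0 m0.
have mE (x : {ffun 'I_n -> 'I_m}) : measurable (T (cube_sum g x) @^-1` A) by exact: mTA.
have hE (x : {ffun 'I_n -> 'I_m}) : 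
    (delta%:E <= mu (T (cube_sum g x) @^-1` A))%E by rewrite Tmu.
have [p Np hp] := popular_point N0 delta0 mZ Z0 mE hE.
rewrite card_ffun !card_ord natrX in hp.
set B := [set x | _]%SET in hp.
have hB : delta / 2 * m%:R ^+ n <= #|[set cube_shift x | x in B]%SET|%:R.
  by rewrite card_imset//; exact: cube_shift_inj.
have := @hamming_concentration R 'I_m n B [set cube_shift x | x in B]%SET (delta / 2).
rewrite card_ord divr_gt0// => /(_ m0 isT hp hB)[x [_ [Bx /imsetP[y By ->] h]]].
apply: Np; rewrite /Z.
have gxy : good (x, y).
  rewrite /good /= leqNgt; apply/negP => lt_D.
  have := le_lt_trans h nD; rewrite ltNge => /negP; apply.
  rewrite lerXn2r ?nnegrE ?mulr_ge0 ?divr_ge0 ?(ltW delta0)//.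
  by rewrite ler_pM2l ?divr_gt0// ler_nat.
rewrite (bigD1 (x, y))//=; left.
move: Bx By; rewrite !inE /preimage /= => /asboolP/asboolP Bx /asboolP/asboolP By.
have := TD (cube_sum g x - cube_sum g y) (cube_sum g y); rewrite subrK => E.
by rewrite /Zp /preimage /=; split => //=; rewrite E in Bx.
Qed.

End cube_recurrence.

(** * Characters coded by binary sequences *)

Section coding.
Variable R : realType.
Local Notation C := (R[i]).
Implicit Types (c : nat -> bool) (v : R).

Definition bits v : nat -> bool := fun i => bit i v.
Definition word n c : n.-tuple bool := [tuple c i | i < n].
Definition has_zero n c : bool := [exists i : 'I_n, ~~ c i].
Definition first_zero i c : Prop := ~~ c i /\ forall j, (j < i)%N -> c j.

Lemma wordP n c c' : word n c = word n c' <-> forall i, (i < n)%N -> c i = c' i.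
Proof.
split=> [h i ni|h].
  by have := congr1 (fun w => tnth w (Ordinal ni)) h; rewrite !tnth_mktuple.
by apply: eq_from_tnth => i; rewrite !tnth_mktuple h.
Qed.

Lemma nth_word n c i b : (i < n)%N -> nth b (word n c) i = c i.
Proof. by move=> ni; rewrite (nth_mktuple _ _ (Ordinal ni)). Qed.

Lemma word_nth n (w : n.-tuple bool) b : word n (nth b w) = w.
Proof. by apply: eq_from_tnth => i; rewrite tnth_mktuple (tnth_nth b). Qed.

Lemma cell_word n (w : n.-tuple bool) v : cell n (nth false w) v <-> word n (bits v) = w.
Proof.
rewrite cellP -[X in _ = X](word_nth w false) wordP; exact: iff_refl.
Qed.

Lemma has_zeroP n c : reflect (exists2 i, (i < n)%N & ~~ c i) (has_zero n c).
Proof.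
apply: (iffP existsP) => [[i ci]|[i ni ci]]; first by exists i.
by exists (Ordinal ni).
Qed.

Lemma first_zero_has n i c : (i < n)%N -> first_zero i c -> has_zero n c.
Proof. by move=> ni [ci _]; apply/has_zeroP; exists i. Qed.

(** All that is retained of the Kronecker set. The estimates concern only prefixes that contain a
    zero: the piece chosen at the first zero depends on [h] and need not lie in the pieces above it.
    The remaining prefix of length n, the word of ones, has a cell of measure only 2^-n. *)
Definition coding (G : zmodType) (Phi : (nat -> bool) -> G -> C) (h : nat -> G) :=
  [/\ (forall c g, cabs (Phi c g) = 1),
      (forall c g g', Phi c (g + g') = Phi c g * Phi c g'),
      (forall g (eta : R), 0 < eta -> exists n0, forall n c c', (n0 <= n)%N ->
         has_zero n c -> word n c = word n c' ->
         cabs (Phi c g - Phi c' g) <= eta),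
      (forall n (z : n.-tuple bool -> C) (eta : R), (forall w, cabs (z w) = 1) ->
         0 < eta -> exists g, forall c, has_zero n c ->
         cabs (Phi c g - z (word n c)) <= eta) &
      (forall c i, first_zero i c -> h i != 0 -> Phi c (h i) <> 1)].

Lemma cabs_prodB (I : Type) (r : seq I) (a b : I -> C) :
  (forall i, cabs (a i) = 1) -> (forall i, cabs (b i) = 1) ->
  cabs (\prod_(i <- r) a i - \prod_(i <- r) b i) <= \sum_(i <- r) cabs (a i - b i).
Proof.
move=> a1 b1; have p1 (f : I -> C) s : (forall i, cabs (f i) = 1) ->
    cabs (\prod_(i <- s) f i) = 1.
  move=> f1; elim: s => [|i s IHs]; first by rewrite big_nil cabs1.
  by rewrite big_cons cabsM f1 IHs mulr1.
elim: r => [|i r IHr]; first by rewrite !big_nil subrr cabs0.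
rewrite !big_cons; apply: le_trans (cabs_triangle (b i * \prod_(j <- r) a j) _ _) _.
by rewrite -mulrBl -mulrBr !cabsM p1// b1 mulr1 mul1r lerD2l.
Qed.

Lemma cabs_exprB (a b : C) n : cabs a = 1 -> cabs b = 1 ->
  cabs (a ^+ n - b ^+ n) <= n%:R * cabs (a - b).
Proof.
move=> a1 b1; rewrite -(card_ord n) -!prodr_const.
apply: le_trans (cabs_prodB (index_enum _) (a := fun=> a) (b := fun=> b) _ _) _ => //.
by rewrite sumr_const mulr_natl.
Qed.

Section character.
Variables (G : zmodType) (chi : G -> C).
Hypotheses (chi1 : forall g, cabs (chi g) = 1)
  (chiD : forall g g', chi (g + g') = chi g * chi g').

Lemma character_neq0 g : chi g != 0.
Proof. by rewrite -cabs_eq0 chi1 oner_eq0. Qed.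

Lemma character0 : chi 0 = 1.
Proof.
by apply: (mulIf (character_neq0 0)); rewrite -chiD addr0 mul1r.
Qed.

Lemma characterN g : chi (- g) = (chi g)^-1.
Proof.
apply: (mulIf (character_neq0 g)).
by rewrite -chiD addNr character0 mulVf ?character_neq0.
Qed.

Lemma characterMn g n : chi (g *+ n) = chi g ^+ n.
Proof.
elim: n => [|n IHn]; first by rewrite mulr0n character0.
by rewrite mulrS exprS chiD IHn.
Qed.

Lemma character_sum (I : Type) (r : seq I) (g : I -> G) :
  chi (\sum_(i <- r) g i) = \prod_(i <- r) chi (g i).
Proof.
elim: r => [|i r IHr]; first by rewrite !big_nil character0.
by rewrite !big_cons chiD IHr.
Qed.

Lemma character_cube_sum n m (g : 'I_n -> G) (x : {ffun 'I_n -> 'I_m})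
    (j : 'I_n) (b : C) (eta : R) : cabs b = 1 -> 0 <= eta ->
  (forall i, cabs (chi (g i) - (if i == j then b else 1)) <= eta) ->
  cabs (chi (cube_sum g x) - b ^+ x j) <= n%:R * (m%:R * eta).
Proof.
move=> b1 eta0 hg; pose b' i := if i == j then b else 1.
have b'1 i : cabs (b' i) = 1 by rewrite /b'; case: ifP => // _; exact: cabs1.
have -> : b ^+ x j = \prod_i b' i ^+ x i.
  rewrite (bigD1 j)//= /b' eqxx big1 ?mulr1// => i /negbTE ->.
  by rewrite expr1n.
rewrite character_sum; apply: le_trans (cabs_prodB _ _ _) _.
- by move=> i; rewrite characterMn cabsX chi1 expr1n.
- by move=> i; rewrite cabsX b'1 expr1n.
apply: (@le_trans _ _ (\sum_(i < n) (m%:R * eta))); last first.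
  by rewrite sumr_const card_ord -[leLHS]mulr_natl.
apply: ler_sum => i _; rewrite characterMn.
apply: le_trans (cabs_exprB _ (chi1 _) (b'1 _)) _.
by rewrite ler_pM ?cabs_ge0// ler_nat ltnW.
Qed.

(** At the index j the exponents differ by 1 or, after a wrap, by 1 - m, and b^m = 1 makes both
    contribute b. At every other index [chi (g i)] is near 1, so mismatches of x and y there cost
    only an error. *)
Lemma character_cube_diff n m (g : 'I_n -> G) (x y : {ffun 'I_n -> 'I_m})
    (j : 'I_n) (b : C) (eta : R) : b ^+ m = 1 -> cabs b = 1 -> 0 <= eta ->
  (forall i, cabs (chi (g i) - (if i == j then b else 1)) <= eta) ->
  x j = ordS (y j) ->
  cabs (chi (cube_sum g x - cube_sum g y) - b) <= 2 * (n%:R * (m%:R * eta)).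
Proof.
move=> bm b1 eta0 hg xy; set X := cube_sum g x; set Y := cube_sum g y.
have hX := character_cube_sum x b1 eta0 hg.
have hY := character_cube_sum y b1 eta0 hg.
have -> : cabs (chi (X - Y) - b) = cabs (chi X - b * chi Y).
  by rewrite -[LHS]mulr1 -[in LHS](chi1 Y) -cabsM mulrBl -chiD subrK.
have e : b ^+ x j = b * b ^+ y j by rewrite xy /= expr_mod// exprS.
apply: le_trans (cabs_triangle (b ^+ x j) _ _) _.
by rewrite [leRHS]mulr_natl mulr2n lerD// e -mulrBr cabsM b1 mul1r cabsC.
Qed.

End character.

End coding.

(** * Finite sets of nearly prescribed values with returns for all large sets *)

Section recurrent_block.
Variable R : realType.
Local Notation C := (R[i]).

Lemma half_pow_small (e : R) : 0 < e -> exists i, 2^-1 ^+ i <= e.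
Proof.
move=> e0; exists (Num.truncn e^-1).+1; rewrite exprVn.
rewrite -[leRHS]invrK lef_pV2 ?posrE ?invr_gt0 ?exprn_gt0//.
apply: ltW; apply: lt_le_trans (truncnS_gt _) _.
by rewrite -natrX ler_nat ltnW// ltn_expl.
Qed.

(** [D] is the integer part of 2 sqrt(N) / delta: just large enough for concentration in dimension
    N, yet D + 1 is below kappa N once sqrt(N) exceeds 4 / (delta kappa) and N exceeds 2 / kappa. *)
Lemma dimension_choice (delta kappa : R) : 0 < delta -> 0 < kappa ->
  exists n1, forall N, (n1 <= N)%N -> exists D,
    N%:R < (delta / 2 * D.+1%:R) ^+ 2 /\ D.+1%:R < kappa * N%:R.
Proof.
move=> d0 k0; pose q := 4 / (delta * kappa).
have q0 : 0 < q by rewrite divr_gt0// mulr_gt0.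
exists (Num.truncn (q ^+ 2 + 2 / kappa)).+1 => N hN.
have {hN} : q ^+ 2 + 2 / kappa < N%:R.
  by apply: lt_le_trans (truncnS_gt _) _; rewrite ler_nat.
have q2 := exprn_gt0 2 q0; have k2 : 0 < 2 / kappa by rewrite divr_gt0.
move=> hN; have hq : q ^+ 2 < N%:R by lra.
have {hN} hk : 2 / kappa < N%:R by lra.
have N0 : 0 < (N%:R : R) by exact: lt_trans hq.
set w := Num.sqrt (N%:R : R); have w0 : 0 < w by rewrite sqrtr_gt0.
have w2 : w ^+ 2 = N%:R by rewrite sqr_sqrtr ?ltW.
have qw : q < w.
  by rewrite -[q]gtr0_norm// -sqrtr_sqr ltr_sqrt// w2.
exists (Num.truncn (2 / delta * w)); split.
  rewrite -w2 ltrXn2r// ?nnegrE ?mulr_ge0 ?divr_ge0 ?(ltW d0) ?(ltW w0)//.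
  have := truncnS_gt (2 / delta * w).
  have wE : w = delta / 2 * (2 / delta * w) by field; rewrite gt_eqF.
  by rewrite [X in _ -> X < _]wE ltr_pM2l// divr_gt0.
rewrite -natr1.
have : (Num.truncn (2 / delta * w))%:R <= 2 / delta * w.
  by rewrite truncn_le// mulr_ge0 ?divr_ge0 ?(ltW d0) ?(ltW w0).
have : 2 / delta * w < kappa / 2 * N%:R.
  rewrite -w2 expr2 mulrA ltr_pM2r//.
  rewrite (_ : 2 / delta = kappa / 2 * q).
    by rewrite ltr_pM2l// divr_gt0.
  by rewrite /q; field; rewrite !gt_eqF.
have : 1 < kappa / 2 * N%:R by rewrite mulrAC ltr_pdivlMr// mul1r mulrC -ltr_pdivrMr.
by lra.
Qed.

Lemma has_zero_first n (c : nat -> bool) :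
  has_zero n c -> exists2 i, (i < n)%N & first_zero i c.
Proof.
move=> /has_zeroP[j jn cj]; have ex : exists i, ~~ c i by exists j.
case: (ex_minnP ex) => i ci i_min; exists i.
  exact: leq_ltn_trans (i_min _ cj) jn.
split=> // k ki; apply: contraLR ki => ck.
by rewrite -leqNgt i_min.
Qed.

Lemma first_zero_unique i j (c : nat -> bool) :
  first_zero i c -> first_zero j c -> i = j.
Proof.
move=> [ci hi] [cj hj]; case: (ltngtP i j) => // [/hj|/hi].
  by rewrite (negbTE ci).
by rewrite (negbTE cj).
Qed.

Lemma coding_close_seq (G : zmodType) (Phi : (nat -> bool) -> G -> C) h
    (r : seq G) (eta : R) :
  coding Phi h -> 0 < eta -> exists n0, forall n c c' g, (n0 <= n)%N -> g \in r ->
    has_zero n c -> word n c = word n c' -> cabs (Phi c g - Phi c' g) <= eta.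
Proof.
move=> [_ _ close _ _] eta0; elim: r => [|g r [n1 h1]]; first by exists 0%N.
have [n2 h2] := close g _ eta0; exists (maxn n1 n2) => n c c' g'.
by rewrite geq_max inE => /andP[l1 l2] /predU1P[->|]; [exact: h2|exact: h1].
Qed.

Lemma cabs_root (b : C) m : (0 < m)%N -> b ^+ m = 1 -> cabs b = 1.
Proof.
move=> m0 /(congr1 (@cabs R)); rewrite cabsX cabs1 => /eqP.
by rewrite pexpr_eq1 ?cabs_ge0// => /eqP.
Qed.

Variables (G : zmodType) (Phi : (nat -> bool) -> G -> C) (h s : nat -> G).
Hypothesis Phi_coding : coding Phi h.

(* Each r in S is t plus a sum of steps k_w g_w over the words w of length n,
   where g_w takes nearly the value b w on the piece of w and 1 on the others,
   and k_w = 1 mod m for all but D words. Hence r takes nearly the value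
   Phi c t * b w on most pieces. On the words that start with i0 ones, b is
   nearly -1, so that r <> t. *)
Lemma recurrent_block (eps delta : R) (t : G) : 0 < eps -> 0 < delta ->
  exists S : seq G, S != [::] /\
  (forall r, r \in S -> exists Bad : set R,
     [/\ measurable Bad, (unif Bad <= eps%:E)%E &
      forall v i, ~ Bad v -> first_zero i (bits v) ->
        cabs (Phi (bits v) r - Phi (bits v) (s i)) <= eps]) /\
  (forall (d : measure_display) (X : measurableType d) (mu : probability X R)
    (T : G -> X -> X), measure_preserving_system mu T ->
   forall A : set X, measurable A -> (delta%:E <= mu A)%E ->
   exists r, [/\ r \in S, r != t & (0 < mu (A `&` T (r - t)%R @^-1` A))%E]).
Proof.
move=> eps0 delta0.
have [Phi1 PhiD _ approx _] := Phi_coding.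
(* Four errors of size [e] add up to [eps]; the bound 1/4 keeps 1 and -1 from having a common point
   within [e]. *)
pose e := Num.min (eps / 4) 4^-1.
have e0 : 0 < e by rewrite lt_min divr_gt0//= invr_gt0 ltr0n.
have e_eps : e <= eps / 4 by rewrite ge_min lexx.
have e_1 : e <= 4^-1 by rewrite ge_min lexx orbT.
have [m m0 rootd] := root_dense e0.
(* The cell of i0 ones has measure at most eps / 2 and is given up in [Bad]; the values there are
   free to force r <> t. *)
have [i0 hi0] : exists i, 2^-1 ^+ i <= eps / 2 by apply: half_pow_small; rewrite divr_gt0.
(* The first bound keeps the mismatched cells within the other half of [eps]. The second keeps these
   cells and the word of n ones together from covering the cell of i0 ones. *)
pose kappa := Num.min (eps / 2) (2^-1 ^+ i0).
have kappa0 : 0 < kappa by rewrite lt_min divr_gt0// exprn_gt0.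
have [n1 hn1] := dimension_choice delta0 kappa0.
have [n0 hn0] := coding_close_seq (t :: [seq s i | i <- iota 0 i0]) Phi_coding e0.
pose n := maxn (maxn n0 n1) i0.
have ni0 : (i0 <= n)%N by rewrite leq_max leqnn orbT.
have nn0 : (n0 <= n)%N by rewrite !leq_max leqnn.
pose N := #|{: n.-tuple bool}|.
have NE : N = (2 ^ n)%N by rewrite /N card_tuple card_bool.
have nN : (n1 <= N)%N.
  rewrite NE; apply: leq_trans (ltnW (ltn_expl n _)) => //.
  by rewrite !leq_max leqnn orbT.
have N0 : (0 < N)%N by rewrite NE expn_gt0.
have N0' : 0 < (N%:R : R) by rewrite ltr0n.
have m0' : 0 < (m%:R : R) by rewrite ltr0n.
have [D [hD1 hD2]] := hn1 N nN.
(* A word is represented by its extension by zeros, where the quotient to be approximated is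
   evaluated. *)
have /choice[b hb] (w : n.-tuple bool) : exists b, [/\ b ^+ m = 1,
    (forall i, (i < i0)%N -> first_zero i (nth false w) ->
      cabs (b - Phi (nth false w) (s i) / Phi (nth false w) t) <= e) &
    (~~ has_zero i0 (nth false w) -> cabs (b - (-1)) <= e)].
  have [hz|nz] := boolP (has_zero i0 (nth false w)).
    have [i ii0 fi] := has_zero_first hz.
    have [|b bm hb] := rootd (Phi (nth false w) (s i) / Phi (nth false w) t).
      by rewrite -(characterN (Phi1 _) (PhiD _)) cabsM !Phi1 mulr1.
    exists b; split=> // j _ fj; rewrite (first_zero_unique fj fi); exact: ltW.
  have [|b bm hb] := rootd (-1); first by rewrite cabsN cabs1.
  exists b; split=> //; last by move=> _; exact: ltW.
  by move=> i ii0 /(first_zero_has ii0); rewrite (negbTE nz).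
have b1 w : cabs (b w) = 1 by have [/(cabs_root m0)] := hb w.
(* The denominator is the factor by which [character_cube_diff] enlarges the error. *)
pose eta := e / (2 * (N%:R * m%:R)).
have eta0 : 0 < eta by rewrite divr_gt0// !mulr_gt0.
have etaE : 2 * (N%:R * (m%:R * eta)) = e.
  by rewrite /eta; field; rewrite !gt_eqF.
have /choice[g hg] (j : 'I_N) : exists g, forall c, has_zero n c ->
    cabs (Phi c g - (if enum_val j == word n c then b (word n c) else 1)) <= eta.
  have [|g hg] := approx n (fun w => if enum_val j == w then b w else 1) eta _ eta0.
    by move=> w; case: ifP => // _; exact: cabs1.
  by exists g.
pose pair := ({ffun 'I_N -> 'I_m} * {ffun 'I_N -> 'I_m})%type.
pose mismatch (p : pair) : set R :=
  \big[setU/set0]_(j <- [seq j <- enum 'I_N | p.1 j != cube_shift p.2 j])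
    cell n (nth false (enum_val j)).
pose rho (p : pair) : G := cube_sum g p.1 - cube_sum g p.2.
have m_mismatch p : measurable (mismatch p).
  by apply: bigsetU_measurable => j _; exact: measurable_cylinder.
have key (p : pair) c : has_zero n c ->
    p.1 (enum_rank (word n c)) = cube_shift p.2 (enum_rank (word n c)) ->
    cabs (Phi c (rho p) - b (word n c)) <= e.
  move=> zc E; rewrite -etaE.
  have [bm _ _] := hb (word n c).
  apply: (character_cube_diff (Phi1 c) (PhiD c) bm (b1 _) (ltW eta0)) => [i|].
    have := hg i c zc; rewrite -[enum_val i == _](inj_eq enum_rank_inj) enum_valK.
    exact.
  by rewrite E ffunE.
have not_mismatch (p : pair) v : ~ mismatch p v ->
    p.1 (enum_rank (word n (bits v))) = cube_shift p.2 (enum_rank (word n (bits v))).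
  move=> Mv; apply/eqP; apply: contra_notT Mv => neq.
  rewrite /mismatch (bigD1_seq (enum_rank (word n (bits v)))) /=.
  - by left; rewrite enum_rankK; apply/cell_word.
  - by rewrite mem_filter neq mem_enum.
  - by rewrite filter_uniq// enum_uniq.
have mismatch_le (p : pair) : (hamming p.1 (cube_shift p.2) <= D)%N ->
    (unif (mismatch p) <= (D%:R * 2^-1 ^+ n)%:E)%E.
  move=> hD; apply: le_trans (measure_bigsetU_le _ _ _) _.
    by move=> j; exact: measurable_cylinder.
  rewrite (eq_bigr (fun=> (2^-1 ^+ n)%:E)); last by move=> j _; exact: unif_cell.
  rewrite sumEFin lee_fin big_const_seq iter_addr_0 -[leLHS]mulr_natl ler_wpM2r//.
  rewrite ler_nat count_predT size_filter; apply: leq_trans hD.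
  rewrite -sum1_count big_enum_cond /= /hamming -sum1_card.
  by rewrite (eq_bigl (fun j => p.1 j != cube_shift p.2 j)).
have NV : 2^-1 ^+ n * N%:R = 1 :> R.
  by rewrite NE natrX -exprMn mulVf// expr1n.
have DV : D.+1%:R * 2^-1 ^+ n < kappa.
  by rewrite -(ltr_pM2r N0') -mulrA NV mulr1.
pose good (p : pair) := (hamming p.1 (cube_shift p.2) <= D)%N.
exists [seq t + rho p | p <- enum {: pair} & good p]; split; last split.
- have : t + rho ([ffun=> ordS (Ordinal m0)], [ffun=> Ordinal m0])
      \in [seq t + rho p | p <- enum {: pair} & good p].
    apply: map_f; rewrite mem_filter mem_enum andbT /good /=.
    rewrite (_ : cube_shift _ = [ffun=> ordS (Ordinal m0)]) ?hammingxx//.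
    by apply/ffunP => i; rewrite !ffunE.
  by case: [seq _ | _ <- _ & _].
- move=> _ /mapP[p + ->]; rewrite mem_filter => /andP[gp _].
  exists (cell i0 (fun=> true) `|` mismatch p); split.
  - by apply: measurableU => //; exact: measurable_cylinder.
  - apply: le_trans (measureU2 _ _ _) _ => //; first exact: measurable_cylinder.
    rewrite /= unif_cell; apply: le_trans (leeD2l _ (mismatch_le _ gp)) _.
    rewrite -EFinD lee_fin; move: DV; rewrite lt_min => /andP[DV _].
    have : D%:R * 2^-1 ^+ n <= D.+1%:R * 2^-1 ^+ n :> R.
      by rewrite ler_wpM2r// ler_nat.
    lra.
  - move=> v i /not_orP[nc nM] fz; set c := bits v.
    have ii0 : (i < i0)%N.
      rewrite ltnNge; apply/negP => i0i; apply: nc; apply/cellP => j ji0.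
      by have [_ /(_ j (leq_trans ji0 i0i))] := fz.
    have i_n := leq_trans ii0 ni0.
    have zc := first_zero_has i_n fz.
    have := key p c zc (not_mismatch p v nM).
    set w := word n c; set c' := nth false w.
    have ww : word n c = word n c' by rewrite word_nth.
    have fz' : first_zero i c'.
      by split=> [|j ji]; rewrite /c' nth_word ?(ltn_trans ji)//; [case: fz|apply fz.2].
    have [_ /(_ i ii0 fz') + _] := hb w; rewrite -/c' => hbw hk.
    have h1 := hn0 n c c' t nn0 (mem_head _ _) zc ww.
    have : s i \in t :: [seq s i | i <- iota 0 i0].
      by rewrite inE map_f ?orbT// mem_iota.
    move=> /(hn0 n c c' _ nn0)/(_ zc ww) h2.
    rewrite PhiD.
    have t0 : Phi c' t != 0 by rewrite -cabs_eq0 Phi1 oner_eq0.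
    pose q := Phi c' (s i) / Phi c' t.
    have q1 : cabs q = 1.
      by rewrite /q -(characterN (Phi1 _) (PhiD _)) cabsM !Phi1 mulr1.
    have h3 : cabs (Phi c t * Phi c (rho p) - Phi c t * b w) <= e.
      by rewrite -mulrBr cabsM Phi1 mul1r.
    have h4 : cabs (Phi c t * b w - Phi c t * q) <= e.
      by rewrite -mulrBr cabsM Phi1 mul1r.
    have h5 : cabs (Phi c t * q - Phi c' (s i)) <= e.
      rewrite -[Phi c' (s i)](divfK t0) [X in _ - X]mulrC -mulrBl cabsM q1 mulr1.
      exact: h1.
    have h6 : cabs (Phi c' (s i) - Phi c (s i)) <= e by rewrite cabsC.
    apply: le_trans (cabs_triangle (Phi c t * b w) _ _) _.
    have := cabs_triangle (Phi c t * q) (Phi c t * b w) (Phi c (s i)).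
    have := cabs_triangle (Phi c' (s i)) (Phi c t * q) (Phi c (s i)).
    lra.
- move=> d X mu T sys A mA hA.
have [x [y [gxy rec]]] := cube_recurrence g m0 delta0 hD1 sys mA hA.
exists (t + rho (x, y)); split; last by rewrite addrC addKr.
  by apply/mapP; exists (x, y) => //; rewrite mem_filter /good gxy mem_enum.
apply/eqP; rewrite -[RHS]addr0 => /addrI rho0.
(* If r = t, then [rho] is 0 and takes the value 1 at every character; at such a [v] that value
   would be near [b], which is near -1. *)
have [v [vi0 vn vM]] : exists v, [/\ cell i0 (fun=> true) v,
    ~ cell n (fun=> true) v & ~ mismatch (x, y) v].
  apply: contrapT => H.
  have : (unif (cell i0 (fun=> true)) <=
      unif (cell n (fun=> true) `|` mismatch (x, y)))%E.
    apply: le_measure; rewrite ?inE.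
    - exact: measurable_cylinder.
    - by apply: measurableU => //; exact: measurable_cylinder.
    - move=> v vi0; apply: contrapT => /not_orP[h1 h2]; apply: H; by exists v.
  apply/negP; rewrite -ltNge.
  apply: le_lt_trans (measureU2 _ _ _) _ => //; first exact: measurable_cylinder.
  rewrite unif_cell.
  have hc : (@unif R (cell n (fun=> true)) <= (2^-1 ^+ n)%:E)%E.
    by rewrite -(unif_cell R n (fun=> true)).
  apply: le_lt_trans (leeD hc (mismatch_le (x, y) gxy)) _.
  rewrite -EFinD lte_fin -[X in X + _]mul1r -mulrDl nat1r.
  by move: DV; rewrite lt_min => /andP[].
have zc : has_zero n (bits v).
  apply/has_zeroP; apply: contrapT => H; apply: vn; apply/cellP => j jn.
  by apply: contrapT => /negP cj; apply: H; exists j.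
have := key (x, y) _ zc (not_mismatch _ _ vM).
rewrite rho0 (character0 (Phi1 _) (PhiD _)).
have [_ _ +] := hb (word n (bits v)) => /(_ _)/wrap[].
  apply/has_zeroP => -[j ji0]; rewrite nth_word ?(leq_trans ji0)//.
  by move/cellP: vi0 => /(_ j ji0); rewrite /bits => ->.
move=> h1 h2; have := cabs_triangle (b (word n (bits v))) 1 (-1).
have := Re_le_cabs (1 - (-1) : C); rewrite /= opprK ger0_norm//.
lra.
Qed.

End recurrent_block.

(** An [n] that codes a block and a valid position in it lists that element, and any other [n] takes
    the head of [S n]. The elements of the blocks below K have finitely many codes, so the block
    index tends to infinity. *)
Lemma interleave (T : eqType) (x0 : T) (S : nat -> seq T) : (forall k, S k != [::]) ->
  exists (r : nat -> T) (kappa : nat -> nat),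
  [/\ forall n, r n \in S (kappa n), forall k x, x \in S k -> exists n, r n = x &
      forall K, exists N, forall n, (N <= n)%N -> (K <= kappa n)%N].
Proof.
move=> S_neq0.
pose code n : nat * nat := odflt (n, 0%N) (pickle_inv n).
pose kappa n := if ((code n).2 < size (S (code n).1))%N then (code n).1 else n.
pose r n := if ((code n).2 < size (S (code n).1))%N then nth x0 (S (code n).1) (code n).2
            else nth x0 (S n) 0%N.
exists r, kappa; split.
- move=> n; rewrite /r /kappa; case: ifP => h; first exact: mem_nth.
  by apply: mem_nth; have := S_neq0 n; case: (S n).
- move=> k x xS; exists (pickle (k, index x (S k))).
  by rewrite /r /code pickleK_inv /= index_mem xS nth_index.
- move=> K; exists (K + \sum_(k < K) \sum_(j < size (S k))
    (pickle (nat_of_ord k, nat_of_ord j)).+1)%N.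
  move=> n Nn; have Kn := leq_trans (leq_addr _ _) Nn.
  rewrite /kappa; case: ifP => // h; rewrite leqNgt; apply/negP => kK.
  have nE : n = pickle (code n).
    move: kK; rewrite /code; case E : (pickle_inv n) => [p|] /=.
      by move=> _; have := @pickle_invK (nat * nat)%type n; rewrite E.
    by rewrite ltnNge Kn.
  have : (pickle (code n) < n)%N; last by rewrite -nE ltnn.
  apply: leq_trans Nn; apply: leq_trans (leq_addl _ _).
  rewrite (bigD1 (Ordinal kK)) //= (bigD1 (Ordinal h)) //= -surjective_pairing.
  by rewrite -addnA leq_addr.
Qed.

(** The sequence is [s] at the exponent of 2 in k + 1, which equals i at k + 1 = 2^i 3^K for every
    K. *)
Lemma recurring_enumeration (T : Type) (s : nat -> T) :
  exists u : nat -> T, forall i K, exists2 k, (K <= k)%N & u k = s i.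
Proof.
exists (fun k => s (logn 2 k.+1)) => i K; exists (2 ^ i * 3 ^ K).-1%N.
  rewrite -ltnS prednK ?muln_gt0 ?expn_gt0//.
  apply: leq_trans (ltn_expl K _) _ => //=.
  by rewrite leq_pmull// expn_gt0.
rewrite prednK ?muln_gt0 ?expn_gt0// lognM ?expn_gt0// !lognX.
by rewrite /= muln1 muln0 addn0.
Qed.

(** * The sequence and its rigid actions, from a coding *)

Section rigid_recurrent_sequence.
Variable R : realType.
Local Notation C := (R[i]).

Lemma measurable_first_zero i : measurable [set v : R | first_zero i (bits v)].
Proof.
rewrite (_ : [set v | _] = cell i.+1 (fun j => (j < i)%N)).
  exact: measurable_cylinder.
apply/seteqP; split=> v /=.
  move=> [vi vj]; apply/cellP => m; rewrite ltnS leq_eqVlt => /predU1P[->|mi].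
    by rewrite ltnn; apply/negbTE.
  by rewrite mi; exact: vj.
move=> /cellP vm; split; first by have := vm i (ltnSn _); rewrite ltnn /bits => ->.
by move=> j ji; have := vm j (leq_trans ji (leqnSn _)); rewrite ji /bits => ->.
Qed.

Lemma measurable_of_word n (f : n.-tuple bool -> R) :
  measurable_fun setT (fun v : R => f (word n (bits v))).
Proof.
rewrite (_ : (fun v => _) = fun v => \sum_w f w * \1_(cell n (nth false w)) v).
  apply: measurable_sum => w; apply: measurable_funM => //.
  by apply: measurable_indic; exact: measurable_cylinder.
apply/funext => v; rewrite (bigD1 (word n (bits v)))// big1 => [|w /andP[_ wv]].
  by rewrite [RHS]addr0 indicE mem_set ?mulr1//; exact/cell_word.
rewrite indicE memNset ?mulr0// => cw; move/negP: wv; apply.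
by apply/eqP/esym; exact/cell_word.
Qed.

(** On [D] the function is the limit of its values at finite words extended by zeros. Each point of
    [D] has a zero digit, and from its position on the closeness estimate applies. *)
Lemma measurable_of_bits (D : set R) (f : (nat -> bool) -> R) : measurable D ->
  (forall v, D v -> exists i, ~~ bits v i) ->
  (forall eta : R, 0 < eta -> exists n0, forall n c c', (n0 <= n)%N ->
     has_zero n c -> word n c = word n c' -> `|f c - f c'| <= eta) ->
  measurable_fun setT (fun v => \1_D v * f (bits v)).
Proof.
move=> mD D_zero close.
apply: (@measurable_fun_cvg _ _ _ _
  (fun n v => \1_D v * f (nth false (word n (bits v))))) => [n|v _].
  apply: measurable_funM; first exact: measurable_indic.
  exact: (measurable_of_word (fun w : n.-tuple bool => f (nth false w))).
have [Dv|Dv] := pselect (D v); last first.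
  by rewrite indicE memNset// mul0r; under eq_fun do rewrite mul0r; exact: cvg_cst.
rewrite indicE mem_set// mul1r; under eq_fun do rewrite mul1r.
apply/cvgrPdist_le => e /close[n0 h]; have [i vi] := D_zero _ Dv.
near=> n; apply: (h n).
- by near: n; exact: nbhs_infty_ge.
- by apply/has_zeroP; exists i => //; near: n; exact: nbhs_infty_gt.
- by rewrite word_nth.
Unshelve. all: by end_near.
Qed.

Variables (G : zmodType) (Phi : (nat -> bool) -> G -> C) (s h : nat -> G).
Hypotheses (Phi_coding : coding Phi h)
  (sh_surj : forall g g', exists i, s i = g /\ h i = g').

Section target.
Variable t : G.

Let Dt : set R := [set v | exists2 i, first_zero i (bits v) & s i = t].

Let mDt : measurable Dt.
Proof.
rewrite (_ : Dt = \bigcup_(i in [set i | s i = t]) [set v | first_zero i (bits v)]).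
  by apply: bigcup_measurable => i _; exact: measurable_first_zero.
by apply/seteqP; split=> [v [i fi si]|v [i si fi]]; exists i.
Qed.

Let f g v : C := if `[< Dt v >] then Phi (bits v) g else 1.
Let alpha g v : R := arg (f g v).

Let f1 g v : cabs (f g v) = 1.
Proof.
have [Phi1 _ _ _ _] := Phi_coding.
by rewrite /f; case: ifP => // _; exact: cabs1.
Qed.

Let fD g g' v : f (g + g') v = f g v * f g' v.
Proof.
have [_ PhiD _ _ _] := Phi_coding.
by rewrite /f; case: ifP => // _; rewrite mulr1.
Qed.

Let malpha g : measurable_fun setT (alpha g).
Proof.
have [_ _ close _ _] := Phi_coding.
have Dt_zero v : Dt v -> exists i, ~~ bits v i by move=> [i [vi _] _]; exists i.
apply: measurable_arg => //.
- rewrite (_ : (fun v => _) = fun v => \1_Dt v * complex.Re (Phi (bits v) g) +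
      (1 - \1_Dt v)).
    apply: measurable_funD; last first.
      by apply: measurable_funB => //; exact: measurable_indic.
    apply: (measurable_of_bits (f := fun c => complex.Re (Phi c g))) => //.
    move=> eta /close-/(_ g)[n0 hn]; exists n0 => n c c' nn0 zc cc'.
    exact: le_trans (ReB_le_cabs _ _) (hn n c c' nn0 zc cc').
  apply/funext => v; rewrite /f indicE; case: asboolP => Dv.
    by rewrite mem_set// mul1r subrr addr0.
  by rewrite memNset// mul0r add0r subr0.
- rewrite (_ : (fun v => _) = fun v => \1_Dt v * complex.Im (Phi (bits v) g)).
    apply: (measurable_of_bits (f := fun c => complex.Im (Phi c g))) => //.
    move=> eta /close-/(_ g)[n0 hn]; exists n0 => n c c' nn0 zc cc'.
    exact: le_trans (ImB_le_cabs _ _) (hn n c c' nn0 zc cc').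
  apply/funext => v; rewrite /f indicE; case: asboolP => Dv.
    by rewrite mem_set// mul1r.
  by rewrite memNset// mul0r.
Qed.

Let alpha_free g : g != 0 -> exists B : set R,
  [/\ measurable B, (0 < unif B)%E & forall v, B v -> alpha g v != 0].
Proof.
have [Phi1 _ _ _ Phi_free] := Phi_coding.
have [i [si hi]] := sh_surj t g.
move=> g0; exists [set v | first_zero i (bits v)]; split.
- exact: measurable_first_zero.
- apply: (@lt_le_trans _ _ (unif (cell i.+1 (fun j => (j < i)%N)))).
    by rewrite unif_cell lte_fin exprn_gt0.
  apply: le_measure; rewrite ?inE.
  - exact: measurable_cylinder.
  - exact: measurable_first_zero.
  - move=> v /cellP vm; split.
      by have := vm i (ltnSn _); rewrite ltnn /bits => ->.
    by move=> j ji; have := vm j (leq_trans ji (leqnSn _)); rewrite ji /bits => ->.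
- move=> v fi; apply/eqP => /(arg_eq0 (f1 g v)).
  rewrite /f; have -> : `[< Dt v >] by apply/asboolP; exists i.
  by move: g0; rewrite -hi; exact: Phi_free.
Qed.

Lemma rigid_of_coding (r : nat -> G) (eps : nat -> R) :
  (forall n, 0 <= eps n) ->
  (forall e : R, 0 < e -> exists N, forall n, (N <= n)%N -> eps n < e) ->
  (forall n, exists Bad : set R,
     [/\ measurable Bad, (unif Bad <= (eps n)%:E)%E &
      forall v i, ~ Bad v -> first_zero i (bits v) ->
        cabs (Phi (bits v) (r n) - Phi (bits v) (s i)) <= eps n]) ->
  exists (d : measure_display) (X : measurableType d) (mu : probability X R)
     (T : G -> X -> X),
     [/\ measure_preserving_system mu T, free_system mu T &
         rigidity_sequence mu T (fun n => r n - t)].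
Proof.
move=> eps_ge0 eps0 rBad; have [Phi1 PhiD _ _ _] := Phi_coding.
apply: (@skew_system R G alpha).
- by move=> g v; exact: arg_unit.
- exact: malpha.
- by move=> v; rewrite /alpha (character0 (fun g => f1 g v) (fun g g' => fD g g' v)) arg1.
- by move=> g g' v; rewrite /alpha fD argM.
- exact: alpha_free.
- move=> e e0 e' e'0; have [k k0 hk] := circle_dist_cexp e0.
  have [N1 hN1] := eps0 _ k0; have [N2 hN2] := eps0 _ e'0.
  exists (maxn N1 N2) => n; rewrite geq_max => /andP[n1 n2].
  have [Bad [mBad Bad_le hBad]] := rBad n.
  apply: (@le_trans _ _ (eps n)%:E); last by rewrite lee_fin ltW// hN2.
  apply: le_trans Bad_le; apply: le_measure; rewrite ?inE//.
    rewrite -[X in measurable X]setTI.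
    apply: (measurable_fun_ler (measurable_cst _) _ measurableT (Y := [set true])) => //.
    apply: measurable_minr; first exact: malpha.
    by apply: measurable_funB => //; exact: malpha.
  move=> v /= ev; apply: contrapT => Bv.
  have := hk _ (arg_unit (f1 (r n - t) v)) ev; rewrite cexp_arg//.
  apply/negP; rewrite -ltNge /f; case: asboolP => [[i fi si]|_]; last first.
    by rewrite subrr cabs0.
  apply: le_lt_trans (hN1 n n1).
  have := hBad v i Bv fi; rewrite si.
  rewrite -{1}(subrK t (r n)) PhiD -[X in _ - X]mul1r -mulrBl cabsM Phi1 mulr1.
  exact.
Qed.

End target.

Lemma freely_rigid_recurrent_of_coding :
  exists r : nat -> G, forall t, freely_rigid_recurrent R G (fun n => r n - t).
Proof.
(* Block k handles the element [u k] and the sets of measure at least 1 / (k + 1). Each element must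
   therefore recur for arbitrarily large k, to reach every set of positive measure. *)
have [u hu] := recurring_enumeration s.
have inv0 k : 0 < k.+1%:R^-1 :> R by rewrite invr_gt0.
have /choice[S hS] k := recurrent_block s Phi_coding (u k) (inv0 k) (inv0 k).
have [|r [kappa [rS Sr kappa_oo]]] := @interleave G 0 S; first by move=> k; have [] := hS k.
exists r => t; split.
  apply: (@rigid_of_coding t r (fun n => (kappa n).+1%:R^-1)).
  - by move=> n; exact: ltW.
  - move=> e e0; have [N hN] := kappa_oo (Num.truncn e^-1); exists N => n /hN Kn.
    rewrite invf_plt ?posrE//; apply: lt_le_trans (truncnS_gt _) _.
    by rewrite ler_nat ltnS.
  - by move=> n; have [_ [+ _]] := hS (kappa n); apply; exact: rS.
move=> d X mu T sys A mA A0.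
have muA : mu A = (fine (mu A))%:E by rewrite fineK// fin_num_measure.
have fA0 : 0 < fine (mu A) by rewrite -lte_fin -muA.
have [i [si _]] := sh_surj t 0.
have [k Kk uk] := hu i (Num.truncn (fine (mu A))^-1).
have [_ [_ /(_ d X mu T sys A mA)]] := hS k.
have hA : ((k.+1%:R^-1)%:E <= mu A)%E.
  rewrite muA lee_fin invf_ple ?posrE//.
  by apply: ltW; apply: lt_le_trans (truncnS_gt _) _; rewrite ler_nat ltnS.
move=> /(_ hA)[g [gS]]; rewrite uk si => gt rec.
have [n rn] := Sr k g gS.
by exists (g - t); split; [exists n => //; rewrite rn|rewrite subr_eq0|].
Qed.

End rigid_recurrent_sequence.

(** * Construction of a coding from a perfect Kronecker set *)

Section kronecker_scheme.
Variable R : realType.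
Local Notation C := (R[i]).

Definition clamp (x : R) : R := Num.max 0 (Num.min 1 x).

Lemma clamp_lip x y : `|clamp x - clamp y| <= `|x - y|.
Proof.
wlog xy : x y / x <= y.
  move=> H; have /orP[xy|yx] := le_total x y; first exact: H.
  by rewrite distrC [leRHS]distrC; exact: H.
rewrite distrC [leRHS]distrC [leRHS]ger0_norm ?subr_ge0//.
rewrite /clamp !maxEle !minEle.
case: (leP 1 x) => x1; case: (leP 1 y) => y1; case: (leP 0 x) => x0;
  case: (leP 0 y) => y0; rewrite ?ler01 ler_norml; apply/andP; split; lra.
Qed.

Lemma clamp0 x : x <= 0 -> clamp x = 0.
Proof. by move=> x0; rewrite /clamp max_l// ge_min x0 orbT. Qed.

Lemma clamp1 x : 1 <= x -> clamp x = 1.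
Proof. by move=> x1; rewrite /clamp min_l// max_r. Qed.

(* The supremum of the lower ends of the intervals meets all of them. *)
Lemma cauchy_limit_real (x d : nat -> R) N :
  (forall m n, (N <= m)%N -> (m <= n)%N -> `|x n - x m| <= d m) ->
  exists l, forall m, (N <= m)%N -> `|l - x m| <= d m.
Proof.
move=> H; pose E := [set y | exists2 m, (N <= m)%N & y = x m - d m].
have ub n : (N <= n)%N -> ubound E (x n + d n).
  move=> Nn _ [m Nm ->].
  have [mn|/ltnW nm] := leqP m n.
    have := H m n Nm mn; have := H n n Nn (leqnn _).
    by rewrite subrr normr0 ler_distl => h /andP[]; lra.
  have := H n m Nn nm; have := H m m Nm (leqnn _).
  by rewrite subrr normr0 ler_distl => h /andP[]; lra.
have hE : has_sup E.
  by split; [exists (x N - d N); exists N|exists (x N + d N); exact: ub].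
exists (sup E) => m Nm; rewrite ler_distl; apply/andP; split.
  by apply: sup_upper_bound => //; exists m.
by apply: ge_sup (ub m Nm); exact: hE.1.
Qed.

Lemma cauchy_limit (z : nat -> C) (d : nat -> R) N :
  (forall m n, (N <= m)%N -> (m <= n)%N -> cabs (z n - z m) <= d m) ->
  exists l, forall m, (N <= m)%N -> cabs (l - z m) <= 2 * d m.
Proof.
move=> H.
have [m n Nm mn|a ha] := @cauchy_limit_real (fun n => complex.Re (z n)) d N.
  exact: le_trans (ReB_le_cabs _ _) (H m n Nm mn).
have [m n Nm mn|b hb] := @cauchy_limit_real (fun n => complex.Im (z n)) d N.
  exact: le_trans (ImB_le_cabs _ _) (H m n Nm mn).
exists (a +i* b)%C => m Nm; apply: le_trans (cabs_le _) _.
rewrite mulr_natl mulr2n lerD//; [have := ha m Nm|have := hb m Nm];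
  by case: (z m).
Qed.

Variables (G : zmodType) (K : set (G -> C)) (s h : nat -> G).

(** These pseudometrics, over the finite lists [F], define the topology of pointwise convergence. *)
Definition seminorm (F : seq G) (x y : G -> C) : R := \sum_(g <- F) cabs (x g - y g).

Lemma seminorm_ge0 F x y : 0 <= seminorm F x y.
Proof. by apply: sumr_ge0 => g _; exact: cabs_ge0. Qed.

Lemma seminormC F x y : seminorm F x y = seminorm F y x.
Proof. by apply: eq_bigr => g _; rewrite cabsC. Qed.

Lemma seminorm_triangle F y x z :
  seminorm F x z <= seminorm F x y + seminorm F y z.
Proof.
by rewrite -big_split; apply: ler_sum => g _; exact: cabs_triangle.
Qed.

Lemma le_seminorm F x y g : g \in F -> cabs (x g - y g) <= seminorm F x y.
Proof.
move=> gF; rewrite /seminorm (big_rem g)//= lerDl sumr_ge0// => g' _.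
exact: cabs_ge0.
Qed.

(** The topology enters through the pseudometrics only: the Kronecker property is stated for real
    phases that are Lipschitz for one of them, which covers sums of bump functions. *)
Hypotheses (K_abs : forall chi, K chi -> forall g, cabs (chi g) = 1)
  (K_add : forall chi, K chi -> forall g g', chi (g + g') = chi g * chi g')
  (K_perfect : forall p F (r : R), K p -> 0 < r ->
     exists q, [/\ K q, q <> p & seminorm F q p < r])
  (K_kronecker : forall (phi : (G -> C) -> R) (F : seq G) (L eps : R), 
     (forall x y, `|phi x - phi y| <= L * seminorm F x y) -> 0 < eps ->
     exists g, forall chi, K chi -> cabs (cexp (phi chi) - chi g) < eps)
  (K_separates : forall g, g != 0 -> exists2 chi, K chi & chi g <> 1)
  (K_neq0 : K !=set0)
  (s_surj : forall g, exists i, s i = g).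

Definition relopen (O : set (G -> C)) := forall p, O p -> K p /\
  exists F r, 0 < r /\ forall q, K q -> seminorm F q p < r -> O q.

(** No point of [K] is isolated, so the removal of one point cannot empty a relatively open set. *)
Lemma relopen_avoid (O : set (G -> C)) x :
  relopen O -> O !=set0 -> relopen [set q | O q /\ q <> x] /\
                           [set q | O q /\ q <> x] !=set0.
Proof.
move=> oO [p Op]; split.
  move=> q [Oq qx]; have [Kq [F [r [r0 hO]]]] := oO q Oq.
  split=> //; have [g qg] : exists g, q g != x g.
    apply: contrapT => H; apply: qx; apply/funext => g; apply/eqP.
    by apply: contrapT => /negP e; apply: H; exists g.
  exists (g :: F), (Num.min r (cabs (q g - x g))).
  rewrite lt_min r0 cabs_gt0 subr_eq0 qg; split=> // y Ky.
  rewrite lt_min /seminorm big_cons => /andP[yr yg]; split.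
    by apply: hO => //; apply: le_lt_trans yr; rewrite lerDr cabs_ge0.
  move=> yx; move: yg; rewrite yx cabsC ltNge lerDl -/(seminorm F x q).
  by rewrite seminorm_ge0.
have [Kp [F [r [r0 hO]]]] := oO p Op.
have [px|px] := pselect (p = x); last by exists p.
have [q [Kq qp qr]] := K_perfect F Kp r0.
by exists q; split; [exact: hO|rewrite -px].
Qed.

Lemma relopen_avoid_seq (O : set (G -> C)) (L : seq (G -> C)) :
  relopen O -> O !=set0 -> exists2 q, O q & forall x, List.In x L -> q <> x.
Proof.
elim: L O => [|x L IHL] O oO O0; first by have [q Oq] := O0; exists q.
have [oO' O'0] := relopen_avoid x oO O0.
have [q [Oq qx] qL] := IHL _ oO' O'0.
by exists q => // y /= [<-//|]; exact: qL.
Qed.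

Lemma distinct_points (I : eqType) (l : seq I) (O : I -> set (G -> C)) : uniq l ->
  (forall i, i \in l -> relopen (O i) /\ O i !=set0) ->
  exists p : I -> G -> C, (forall i, i \in l -> O i (p i)) /\
    (forall i j, i \in l -> j \in l -> i != j -> p i <> p j).
Proof.
elim: l => [_ _|i l IHl /= /andP[il ul] hO]; first by exists (fun _ _ => 0).
have [|p [pO p_inj]] := IHl ul; first by move=> j jl; apply: hO; rewrite inE jl orbT.
have [oOi Oi0] := hO i (mem_head _ _).
have [q Oq qL] := relopen_avoid_seq (map p l) oOi Oi0.
have q_neq j : j \in l -> q <> p j.
  move=> jl; apply: qL; elim: l jl {IHl il ul hO pO p_inj} => //= k l IHl.
  by rewrite inE => /predU1P[->|/IHl]; [left|right].
have neq_i j : j \in l -> (j == i) = false.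
  by move=> jl; apply/negbTE; apply: contraNneq il => <-.
exists (fun j => if j == i then q else p j); split.
  move=> j; rewrite inE; case: eqP => [->//|_ /= jl]; exact: pO.
move=> j k; rewrite !inE => /predU1P[->|jl] /predU1P[->|kl] jk.
- by rewrite eqxx in jk.
- by rewrite eqxx neq_i//; exact: q_neq.
- by rewrite eqxx neq_i//; apply/nesym; exact: q_neq.
- by rewrite !neq_i//; exact: p_inj.
Qed.

Lemma seminorm_separation (I : eqType) (l : seq (I * I)) (p : I -> G -> C) :
  exists F (a : R), 0 < a /\ forall i j, (i, j) \in l -> p i <> p j ->
    3 * a <= seminorm F (p i) (p j).
Proof.
elim: l => [|[i j] l [F [a [a0 IHl]]]]; first by exists [::], 1.
have [pij|pij] := pselect (p i = p j).
  exists F, a; split=> // i' j'; rewrite inE => /predU1P[[-> ->]//|]; exact: IHl.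
have [g pg] : exists g, p i g != p j g.
  apply: contrapT => H; apply: pij; apply/funext => g; apply/eqP.
  by apply: contrapT => /negP e; apply: H; exists g.
have d0 : 0 < cabs (p i g - p j g) by rewrite cabs_gt0 subr_eq0.
exists (g :: F), (Num.min a (cabs (p i g - p j g) / 3)).
split; first by rewrite lt_min a0 divr_gt0.
move=> i' j'; rewrite inE => /predU1P[[-> ->] _|ijl ne]; rewrite /seminorm big_cons.
  rewrite -[leLHS]addr0; apply: lerD; last exact: seminorm_ge0.
  by rewrite mulrC -ler_pdivlMr// ge_min lexx orbT.
rewrite -[leLHS]add0r; apply: lerD; first exact: cabs_ge0.
apply: le_trans (IHl _ _ ijl ne).
by rewrite ler_pM2l// ge_min lexx.
Qed.

Lemma relopen_ball p F (r : R) (O : set (G -> C)) : relopen O ->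
  relopen [set q | O q /\ seminorm F q p < r].
Proof.
move=> oO q [Oq qr]; have [Kq [F' [r' [r'0 hO]]]] := oO q Oq; split=> //.
exists (F ++ F'), (Num.min (r - seminorm F q p) r').
rewrite lt_min subr_gt0 qr; split=> // x Kx.
rewrite [seminorm _ x q]big_cat /= -/(seminorm F x q) -/(seminorm F' x q).
rewrite lt_min => /andP[x1 x2].
have n1 := seminorm_ge0 F x q; have n2 := seminorm_ge0 F' x q.
have := seminorm_triangle F q x p; split; last by rewrite /=; lra.
by apply: hO => //; lra.
Qed.

(* The Kronecker property is applied to a bump function taking the value
   prescribed at each of finitely many distinct points on a whole ball. *)
Lemma kronecker_refine (I : eqType) (l : seq I) (O : I -> set (G -> C))
    (Fs : seq G) (eta : R) : uniq l -> 0 < eta ->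
  (forall i, i \in l -> relopen (O i) /\ O i !=set0) ->
  exists V : I -> set (G -> C),
  [/\ forall i, i \in l -> [/\ relopen (V i), V i !=set0 & V i `<=` O i],
      forall i x y g, i \in l -> V i x -> V i y -> g \in Fs ->
        cabs (x g - y g) <= eta &
      forall (c : I -> C) (e : R), (forall i, cabs (c i) = 1) -> 0 < e ->
        exists g, forall i x, i \in l -> V i x -> cabs (x g - c i) < e].
Proof.
move=> ul eta0 hO; have [p [pO p_inj]] := distinct_points ul hO.
have [F [a [a0 sepF]]] := seminorm_separation [seq (i, j) | i <- l, j <- l] p.
have sep i j : i \in l -> j \in l -> i != j -> 3 * a <= seminorm F (p i) (p j).
  move=> il jl ij; apply: sepF; last exact: p_inj.
  by apply/allpairsP; exists (i, j).
have eta2 : 0 < eta / 2 by rewrite divr_gt0.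
exists (fun i => [set q | [set q | O i q /\ seminorm F q (p i) < a] q /\
                          seminorm Fs q (p i) < eta / 2]); split.
- move=> i il; have [oO O0] := hO i il; split.
  + by apply: relopen_ball; exact: relopen_ball.
  + have pp F' : seminorm F' (p i) (p i) = 0.
      by rewrite /seminorm big1// => g _; rewrite subrr cabs0.
    by exists (p i); split; [split; [exact: pO|]|]; rewrite pp.
  + by move=> q [[]].
- move=> i x y g il [_ xp] [_ yp] gF.
  apply: le_trans (cabs_triangle (p i g) _ _) _.
  have := le_seminorm x (p i) gF; have := le_seminorm y (p i) gF.
  rewrite [cabs (p i g - _)]cabsC; lra.
- move=> c e c1 e0.
  (* Each bump is 1 within [a] of its point and 0 from 2a on. The points are 3a apart, so near [p i]
     only the i-th term is left. *)
  pose phi x := \sum_(i <- l) arg (c i) * clamp (2 - seminorm F x (p i) / a).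
  have [x y||g hg] := @K_kronecker phi F (\sum_(i <- l) `|arg (c i)| / a) e; last first.
  + exists g => i x il [[Ox xa] _]; rewrite cabsC.
    suff <- : cexp (phi x) = c i by apply: hg; have [/(_ _ Ox)[]] := hO i il.
    rewrite /phi (big_rem i)//= clamp1; last first.
      by rewrite lerBrDr -lerBrDl ler_pdivrMr//; lra.
    rewrite mulr1 big1_seq ?addr0 ?cexp_arg// => j /=.
    rewrite rem_filter// mem_filter => /andP[/= ji jl]; rewrite clamp0 ?mulr0//.
    rewrite subr_le0 ler_pdivlMr//.
    have := sep _ _ jl il ji; have := seminorm_triangle F x (p j) (p i).
    rewrite [seminorm F (p j) x]seminormC; lra.
  + exact: e0.
  + rewrite /phi -sumrB; apply: le_trans (ler_norm_sum _ _ _) _.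
    rewrite mulr_suml; apply: ler_sum => i _.
    rewrite -mulrBr normrM -mulrA ler_wpM2l//.
    apply: le_trans (clamp_lip _ _) _.
    rewrite opprB addrC addrA subrK -mulrBl normrM [X in _ * X]gtr0_norm ?invr_gt0//.
    rewrite mulrC ler_pM2l ?invr_gt0// ler_distl.
    have := seminorm_triangle F x y (p i); have := seminorm_triangle F y x (p i).
    rewrite [seminorm F y x]seminormC => *; apply/andP; split; lra.
Qed.

Definition words n : seq (seq bool) := [seq val w | w <- enum {: n.-tuple bool}].

Lemma words_uniq n : uniq (words n).
Proof. by rewrite map_inj_uniq ?enum_uniq//; exact: val_inj. Qed.

Lemma mem_words n w : (w \in words n) = (size w == n).
Proof.
apply/mapP/idP => [[t _ ->]|wn]; first by rewrite size_tuple.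
by exists (Tuple wn); rewrite ?mem_enum.
Qed.

Lemma val_word n (c : nat -> bool) : val (word n c) = mkseq c n.
Proof. by rewrite /= /mkseq -val_enum_ord -map_comp. Qed.

Lemma mkseq_words n (c : nat -> bool) : mkseq c n \in words n.
Proof. by rewrite mem_words size_mkseq. Qed.

Lemma mem_mkseq_false n (c : nat -> bool) : (false \in mkseq c n) = has_zero n c.
Proof.
apply/mapP/has_zeroP => [[i ni ci]|[i ni ci]].
  by exists i; [move: ni; rewrite mem_iota|rewrite -ci].
by exists i; rewrite ?mem_iota//; exact/esym/negbTE.
Qed.

Lemma le0_of_inv (x k : R) N : 0 <= k ->
  (forall m, (N <= m)%N -> x <= k * m%:R^-1) -> x <= 0.
Proof.
move=> k0 H; rewrite leNgt; apply/negP => x0.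
pose m := (maxn N (Num.truncn (k / x))).+1.
have /H : (N <= m)%N by rewrite leqW// leq_maxl.
apply/negP; rewrite -ltNge ltr_pdivrMr ?ltr0n// mulrC -ltr_pdivrMr//.
apply: lt_le_trans (truncnS_gt _) _.
by rewrite ler_nat ltnS leq_maxr.
Qed.

Lemma small_inv (e k : R) N : 0 < e -> exists m, [/\ (N < m)%N & k * m%:R^-1 <= e].
Proof.
move=> e0; exists (maxn N (Num.truncn (k / e))).+1; split.
  by rewrite ltnS leq_maxl.
rewrite ler_pdivrMr ?ltr0n// mulrC -ler_pdivrMr//.
apply: ltW; apply: lt_le_trans (truncnS_gt _) _.
by rewrite ler_nat ltnS leq_maxr.
Qed.

Lemma K_relopen : relopen K.
Proof. by move=> p Kp; split=> //; exists [::], 1. Qed.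

Lemma relopen_far g (d : R) : relopen [set x | K x /\ d < cabs (x g - 1)].
Proof.
move=> p [Kp dp]; split=> //; exists [:: g], (cabs (p g - 1) - d).
rewrite subr_gt0 dp; split=> // q Kq; rewrite /seminorm big_seq1 => h1; split=> //.
have := cabs_triangle (q g) (p g) 1; rewrite [cabs (p g - q g)]cabsC; lra.
Qed.

(* V n w is the piece of K coded by the word w of length n. Pieces are nested
   only below words that contain a zero, where h n has been moved away from 1. *)
Lemma kronecker_scheme_exists :
  exists (V : nat -> seq bool -> set (G -> C)) (d : nat -> R),
  [/\ forall n, h n != 0 -> 0 < d n,
      forall n w, w \in words n -> V n w `<=` K /\ V n w !=set0,
      forall n c, has_zero n c -> V n.+1 (mkseq c n.+1) `<=` V n (mkseq c n),
      forall n c x, first_zero n c -> V n.+1 (mkseq c n.+1) x ->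
        d n < cabs (x (h n) - 1) &
      (forall n w x y i, w \in words n -> V n w x -> V n w y -> (i < n)%N ->
        cabs (x (s i) - y (s i)) <= n%:R^-1) /\
      (forall n (z : seq bool -> C) e, (0 < n)%N -> (forall w, cabs (z w) = 1) -> 0 < e ->
        exists g, forall w x, w \in words n -> V n w x -> cabs (x g - z w) < e)].
Proof.
have /choice[d hd] n : exists d : R, (h n != 0 -> 0 < d) /\
    exists x, K x /\ d < cabs (x (h n) - 1).
  have [h0|h0] := eqVneq (h n) 0.
    (* For h n = 0 nothing has to stay away from 1; the bound -1 makes the condition vacuous. *)
    have [x Kx] := K_neq0; exists (-1); split=> //; exists x; split=> //.
    by apply: lt_le_trans (cabs_ge0 _); rewrite ltrN10.
  have [x Kx xh] := K_separates h0; have x0 : 0 < cabs (x (h n) - 1).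
    by rewrite cabs_gt0 subr_eq0; apply/eqP.
  exists (cabs (x (h n) - 1) / 2); split; first by rewrite divr_gt0.
  by exists x; split=> //; lra.
(* After a zero the new piece stays in its parent. A word of ones restarts from all of [K], so that
   at a first zero the piece can be put wherever [h n] is far from 1; this is where nesting is given
   up. *)
pose O n (V : seq bool -> set (G -> C)) w :=
  if false \in take n w then V (take n w)
  else if nth true w n then K else [set x | K x /\ d n < cabs (x (h n) - 1)].
pose valid n (V : seq bool -> set (G -> C)) :=
  forall w, w \in words n -> relopen (V w) /\ V w !=set0.
have /choice[nxt hnxt] (nV : nat * (seq bool -> set (G -> C))) : exists V',
    let n := nV.1 in let V := nV.2 in valid n V ->
    [/\ valid n.+1 V', forall w, w \in words n.+1 -> V' w `<=` O n V w,
      forall w x y g, w \in words n.+1 -> V' w x -> V' w y ->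
        g \in [seq s i | i <- iota 0 n.+1] -> cabs (x g - y g) <= n.+1%:R^-1 &
      forall (z : seq bool -> C) e, (forall w, cabs (z w) = 1) -> 0 < e ->
        exists g, forall w x, w \in words n.+1 -> V' w x -> cabs (x g - z w) < e].
  case: nV => n V /=; have [vV|] := pselect (valid n V); last by exists V.
  have inv0 : 0 < n.+1%:R^-1 :> R by rewrite invr_gt0.
  have [w wn|V' [V'1 V'2 V'3]] := @kronecker_refine _ (words n.+1) (O n V)
     [seq s i | i <- iota 0 n.+1] _ (words_uniq _) inv0.
    rewrite /O; case: ifP => _.
      apply: vV; rewrite mem_words size_take; move: wn.
      by rewrite mem_words => /eqP ->; rewrite ltnSn.
    case: ifP => _; first by split=> //; exact: K_relopen.
    by split; [exact: relopen_far|have [_] := hd n].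
  exists V' => _; split=> //.
    by move=> w /V'1[].
  by move=> w /V'1[].
pose V := fix V n := if n is m.+1 then nxt (m, V m) else fun=> K.
have vV n : valid n (V n).
  elim: n => [|n IHn]; first by move=> w _; split=> //; exact: K_relopen.
  by have [] := hnxt (n, V n) IHn.
have take_mkseq (c : nat -> bool) n : take n (mkseq c n.+1) = mkseq c n.
  by rewrite /mkseq -map_take take_iota (minn_idPl (leqnSn n)).
exists V, d; split.
- by move=> n; have [] := hd n.
- by move=> n w /vV[oV V0]; split=> // x /oV[].
- move=> n c zc; have [_ VO _ _] := hnxt (n, V n) (vV n).
  apply: subset_trans (VO _ (mkseq_words _ _)) _.
  by rewrite /O take_mkseq mem_mkseq_false zc.
- move=> n c x [cn cj] Vx; have [_ VO _ _] := hnxt (n, V n) (vV n).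
  have := VO _ (mkseq_words _ _) _ Vx; rewrite /O take_mkseq mem_mkseq_false.
  rewrite (negbTE (_ : ~~ has_zero n c)); last first.
    by apply/has_zeroP => -[j jn]; rewrite cj.
  by rewrite nth_mkseq// (negbTE cn) => -[].
- split.
    move=> [|n] w x y i // wn Vx Vy ni; have [_ _ Vs _] := hnxt (n, V n) (vV n).
    by apply: (Vs w) => //; rewrite map_f// mem_iota.
  by move=> [|n] z e // _ z1 e0; have [_ _ _ Vk] := hnxt (n, V n) (vV n); exact: Vk.
Qed.

(** [Phi c] is built value by value. Pieces of length m determine the values at s_0, ..., s_(m-1) up
    to 1/m, so points chosen from the nested pieces have Cauchy values at every g. Each property of
    the points of [K] passes to [Phi c] up to a multiple of 1/m, which [le0_of_inv] removes. *)
Theorem kronecker_coding : exists Phi : (nat -> bool) -> G -> C, coding Phi h.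
Proof.
have [V [d [d_gt0 VK V_nest V_far [V_small V_kron]]]] := kronecker_scheme_exists.
have V_sub c m n : has_zero m c -> (m <= n)%N -> V n (mkseq c n) `<=` V m (mkseq c m).
  move=> zc; elim: n => [|n IHn]; first by rewrite leqn0 => /eqP ->.
  rewrite leq_eqVlt => /predU1P[->//|]; rewrite ltnS => mn.
  apply: subset_trans (IHn mn); apply: V_nest.
  have /has_zeroP[i im ci] := zc; apply/has_zeroP; exists i => //.
  exact: leq_trans im mn.
have /choice[pt hpt] (nc : nat * (nat -> bool)) :
    exists x, V nc.1 (mkseq nc.2 nc.1) x.
  by have [_ [x Vx]] := VK nc.1 _ (mkseq_words nc.1 nc.2); exists x.
have /choice[idx hidx] := s_surj.
have /choice[Phi hPhi] (cg : (nat -> bool) * G) : exists l : C,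
    ((forall i, cg.1 i) -> l = 1) /\
    (forall m, (idx cg.2 < m)%N -> has_zero m cg.1 ->
       cabs (l - pt (m, cg.1) cg.2) <= 2 * m%:R^-1).
  case: cg => c g /=; have [[i0 ci0]|nz] := pselect (exists i, ~~ c i); last first.
    (* The sequence of ones has no nested pieces; it gets the trivial character. *)
    exists 1; split=> // m _ /has_zeroP[i _ ci]; exfalso; apply: nz; by exists i.
  have [i _ fi] : exists2 i, (i < i0.+1)%N & first_zero i c.
    by apply: has_zero_first; apply/has_zeroP; exists i0.
  have [m n Nm mn|l hl] := @cauchy_limit (fun n => pt (n, c) g) (fun n => n%:R^-1)
      (maxn (idx g) i).+1.
    move: Nm; rewrite gtn_max => /andP[gm im].
    have zm : has_zero m c by exact: first_zero_has fi.
    rewrite -(hidx g); apply: (V_small m _ _ _ _ (mkseq_words m c)) => //.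
      exact: V_sub zm mn _ (hpt (n, c)).
    exact: hpt (m, c).
  exists l; split=> [call|m gm zm]; first by rewrite call in ci0.
  apply: hl; rewrite gtn_max gm /=.
  by have [j jm fj] := has_zero_first zm; rewrite (first_zero_unique fi fj).
have close c g m x : (idx g < m)%N -> has_zero m c -> V m (mkseq c m) x ->
    cabs (Phi (c, g) - x g) <= 3 * m%:R^-1.
  move=> gm zm Vx; have [_ /(_ m gm zm) /= h1] := hPhi (c, g).
  have := V_small m _ _ _ _ (mkseq_words m c) (hpt (m, c)) Vx gm.
  rewrite hidx /= => h2.
  have := cabs_triangle (pt (m, c) g) (Phi (c, g)) (x g); lra.
have zero_or (c : nat -> bool) : (forall i, c i) \/
    exists N, forall m, (N <= m)%N -> has_zero m c.
  have [[i ci]|nz] := pselect (exists i, ~~ c i).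
    by right; exists i.+1 => m im; apply/has_zeroP; exists i.
  by left=> i; apply: contrapT => /negP ci; apply: nz; exists i.
exists (fun c g => Phi (c, g)); split.
- move=> c g; have [call|[N hN]] := zero_or c.
    by have [-> // _] := hPhi (c, g); exact: cabs1.
  apply/eqP; rewrite -subr_eq0 -normr_le0.
  apply: (@le0_of_inv _ 3 (maxn N (idx g).+1)) => // m; rewrite geq_max => /andP[Nm gm].
  have Vx := hpt (m, c); have zm := hN _ Nm.
  have := close c g m _ gm zm Vx.
  have Kx : K (pt (m, c)) by exact: (VK m _ (mkseq_words m c)).1 _ Vx.
  have := K_abs Kx g; set x := pt (m, c) g => x1 h1.
  apply: le_trans h1; rewrite ler_distl -x1.
  have := cabs_triangle x (Phi (c, g)) 0; have := cabs_triangle (Phi (c, g)) x 0.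
  by rewrite !subr0 [cabs (x - _)]cabsC => *; apply/andP; split; lra.
- move=> c g g'; have [call|[N hN]] := zero_or c.
    have [-> // _] := hPhi (c, g); have [-> // _] := hPhi (c, g').
    by have [-> // _] := hPhi (c, g + g'); rewrite mulr1.
  (* A crude bound 1 + 3/m with m >= 1. It yields the 12 = 4 * 3 below and the total 18 = 3 + 3 +
     12. *)
  have P1 f : cabs (Phi (c, f)) <= 4.
    have [m [Nm _]] := @small_inv 1 0 (maxn N (idx f)) ltr01.
    move: Nm; rewrite gtn_max => /andP[Nm fm].
    have Vx := hpt (m, c); have zm := hN _ (ltnW Nm).
    have h1 := close c f m _ fm zm Vx.
    have Kx : K (pt (m, c)) by exact: (VK m _ (mkseq_words m c)).1 _ Vx.
    have := cabs_triangle (pt (m, c) f) (Phi (c, f)) 0; rewrite !subr0 (K_abs Kx).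
    have : m%:R^-1 <= 1 :> R.
      by rewrite invf_le1 ?ltr0n ?(leq_trans _ fm)// ler1n (leq_trans _ fm).
    lra.
  apply/eqP; rewrite -subr_eq0 -cabs_eq0 eq_le cabs_ge0 andbT.
  apply: (@le0_of_inv _ 18 
    (maxn N (maxn (idx (g + g')) (maxn (idx g) (idx g'))).+1)) => // m.
  rewrite geq_max gtn_max gtn_max => /andP[Nm /and3P[m1 m2 m3]].
  have Vx := hpt (m, c); have zm := hN _ Nm.
  have h1 := close c _ m _ m1 zm Vx.
  have h2 := close c _ m _ m2 zm Vx; have h3 := close c _ m _ m3 zm Vx.
  have Kx : K (pt (m, c)) by exact: (VK m _ (mkseq_words m c)).1 _ Vx.
  move: h1; rewrite (K_add Kx).
  set x := pt (m, c) g in h2 *; set x' := pt (m, c) g' in h3 * => h1.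
  have h4 : cabs (x * x' - x * Phi (c, g')) <= 3 * m%:R^-1.
    by rewrite -mulrBr cabsM (K_abs Kx) mul1r cabsC.
  have h5 : cabs (x * Phi (c, g') - Phi (c, g) * Phi (c, g')) <= 12 * m%:R^-1.
    rewrite -mulrBl cabsM cabsC.
    have := P1 g'; have := cabs_ge0 (Phi (c, g')).
    have := cabs_ge0 (Phi (c, g) - x); nra.
  have := cabs_triangle (x * x') (Phi (c, g + g')) (Phi (c, g) * Phi (c, g')).
  have := cabs_triangle (x * Phi (c, g')) (x * x') (Phi (c, g) * Phi (c, g')).
  lra.
- move=> g eta eta0; have [n0 [gn0 hn0]] := @small_inv eta 6 (idx g) eta0.
  exists n0 => n c c' n0n zc cc'.
  have gn : (idx g < n)%N by exact: leq_trans gn0 n0n.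
  have E : mkseq c n = mkseq c' n by rewrite -!val_word cc'.
  have zc' : has_zero n c' by rewrite -mem_mkseq_false -E mem_mkseq_false.
  have h1 := close c g n _ gn zc (hpt (n, c)).
  have Vx := hpt (n, c); rewrite /= E in Vx.
  have h2 := close c' g n _ gn zc' Vx.
  have h3 : n%:R^-1 <= n0%:R^-1 :> R.
    rewrite lef_pV2 ?posrE ?ltr0n ?ler_nat//; first exact: leq_ltn_trans gn.
    exact: leq_ltn_trans gn0.
  have := cabs_triangle (pt (n, c) g) (Phi (c, g)) (Phi (c', g)).
  rewrite [cabs (pt _ _ - Phi (c', g))]cabsC; lra.
- move=> n z eta z1 eta0; case: (posnP n) => [n0|n0].
    by exists 0 => c; rewrite n0 in z z1 * => /has_zeroP[].
  have e2 : 0 < eta / 2 by rewrite divr_gt0.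
  have [|g hg] := V_kron n (fun w => z (insubd (word n (fun=> true)) w)) _ n0 _ e2.
    by move=> w; exact: z1.
  exists g => c zc; have [m [nm hm]] := @small_inv _ 3 (maxn n (idx g)) e2.
  move: nm; rewrite gtn_max => /andP[nm gm].
  have zm : has_zero m c.
    have /has_zeroP[i im ci] := zc; apply/has_zeroP; exists i => //.
    exact: ltn_trans im nm.
  have h1 := close c g m _ gm zm (hpt (m, c)).
  have := hg _ _ (mkseq_words n c) (V_sub c n m zc (ltnW nm) _ (hpt (m, c))).
  rewrite -val_word valKd => h2.
  have := cabs_triangle (pt (m, c) g) (Phi (c, g)) (z (word n c)); lra.
- move=> c i fi hi; have di := d_gt0 i hi => P1.
  have zi : has_zero i.+1 c by exact: first_zero_has fi.
  suff : d i <= 0 by rewrite leNgt di.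
  apply: (@le0_of_inv _ 3 (maxn i.+1 (idx (h i)).+1)) => // m.
  rewrite geq_max => /andP[im gm].
  have zm : has_zero m c by exact: first_zero_has fi.
  have := V_far i c _ fi (V_sub c i.+1 m zi im _ (hpt (m, c))).
  have := close c (h i) m _ gm zm (hpt (m, c)); rewrite P1 cabsC; lra.
Qed.

End kronecker_scheme.

(** * Characters of a countable group separate its points *)

Section separation.
Variables (R : realType) (G : zmodType).
Local Notation C := (R[i]).
Implicit Types (P : G -> C -> Prop) (a x : G) (c z : C) (k : int).

(* P is the graph of a character of a subgroup of G. *)
Definition partial_character P :=
  [/\ P 0 1, forall a b c e, P a c -> P b e -> P (a - b) (c / e),
      forall c, P 0 c -> c = 1 & forall a c, P a c -> cabs c = 1].

(** The extension of [P] to the subgroup generated with [x], with the value [z] at [x]. It is single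
    valued only if [z] is compatible with [P] on the multiples of [x] already in the domain. *)
Definition adjoin P x z a c : Prop :=
  exists b e k, [/\ P b e, a = b + x *~ k & c = e * z ^ k].

Lemma cabs1_neq0 z : cabs z = 1 -> z != 0.
Proof. by move=> z1; rewrite -cabs_eq0 z1 oner_eq0. Qed.

Lemma cabsV z : cabs z = 1 -> cabs z^-1 = 1.
Proof.
move=> z1; have := cabs1 R; rewrite -(mulVf (cabs1_neq0 z1)) cabsM z1.
by rewrite mulr1.
Qed.

Lemma cabs_exprz z k : cabs z = 1 -> cabs (z ^ k) = 1.
Proof.
move=> z1; case: k => n; first by rewrite -exprnP cabsX z1 expr1n.
by rewrite NegzE -exprz_inv -exprnP cabsX cabsV// expr1n.
Qed.

Section partial_character_theory.
Variable P : G -> C -> Prop.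
Hypothesis pP : partial_character P.

Lemma partial_characterN a c : P a c -> P (- a) c^-1.
Proof.
have [P0 PB _ _] := pP; move=> Pac.
by rewrite -sub0r -[c^-1]mul1r; exact: PB.
Qed.

Lemma partial_characterD a b c e : P a c -> P b e -> P (a + b) (c * e).
Proof.
have [_ PB _ _] := pP; move=> Pac /partial_characterN Pbe.
by rewrite -[b]opprK -[e]invrK; exact: PB.
Qed.

Lemma partial_characterMz a c k : P a c -> P (a *~ k) (c ^ k).
Proof.
have [P0 _ _ _] := pP; move=> Pac.
have Pn n : P (a *+ n) (c ^+ n).
  elim: n => [//|n IHn]; rewrite mulrS exprS; exact: partial_characterD.
case: k => n; first exact: Pn.
exact: partial_characterN (Pn n.+1).
Qed.

Lemma partial_character_inj a c e : P a c -> P a e -> c = e.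
Proof.
have [_ PB P0 P1] := pP; move=> Pac Pae; have := PB _ _ _ _ Pac Pae.
rewrite subrr => /P0 ce; rewrite -[c](divfK (cabs1_neq0 (P1 _ _ Pae))) ce.
by rewrite mul1r.
Qed.

Lemma adjoin_sub x z a c : P a c -> adjoin P x z a c.
Proof. by move=> Pac; exists a, c, 0; rewrite mulr0z addr0 expr0z mulr1. Qed.

Lemma adjoin_self x z : adjoin P x z x z.
Proof.
have [P0 _ _ _] := pP; exists 0, 1, 1.
by rewrite mulr1z add0r expr1z mul1r.
Qed.

Lemma partial_character_adjoin x z : cabs z = 1 ->
  (forall k c, P (x *~ k) c -> c = z ^ k) -> partial_character (adjoin P x z).
Proof.
have [P0 PB P0_eq P1] := pP; move=> z1 xz; split.
- exact: adjoin_sub.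
- move=> _ _ _ _ [b [e [k [Pbe -> ->]]]] [b' [e' [k' [Pbe' -> ->]]]].
  exists (b - b'), (e / e'), (k - k'); split; first exact: PB.
    by rewrite mulrzBr opprD addrACA.
  by rewrite invfM mulrACA expfzDr ?cabs1_neq0// invr_expz.
- move=> c [b [e [k [Pbe bk ->]]]].
  have Pk : P (x *~ k) e^-1.
    have -> : x *~ k = - b by apply/eqP; rewrite -addr_eq0 addrC -bk.
    exact: partial_characterN.
  by rewrite -(xz _ _ Pk) mulfV// cabs1_neq0// (P1 _ _ Pbe).
- by move=> a c [b [e [k [/P1 e1 _ ->]]]]; rewrite cabsM e1 mul1r cabs_exprz.
Qed.

(** By division with remainder, the multiples of [x] in the domain are those of [x *+ m] with the
    least positive m; so any m-th root of the value there is compatible. *)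
Lemma partial_character_root x m c : (0 < m)%N -> P (x *+ m) c ->
  (forall n e, (0 < n)%N -> P (x *+ n) e -> (m <= n)%N) ->
  forall z, z ^+ m = c -> forall k e, P (x *~ k) e -> e = z ^ k.
Proof.
have [P0 PB P0_eq P1] := pP; move=> m0 Pm m_min z zc k e Pk.
pose q := (k %/ m)%Z; have kE := divz_eq k m.
have Pr : P (x *~ (k %% m)%Z) (e / c ^ q).
  have -> : x *~ (k %% m)%Z = x *~ k - x *+ m *~ q.
    have -> : x *~ k = x *~ (m%:Z * q) + x *~ (k %% m)%Z.
      by rewrite -mulrzDr mulrC -kE.
    by rewrite mulrzA addrAC subrr add0r.
  by apply: PB => //; exact: partial_characterMz.
have c0 : c ^ q != 0.
  by apply: cabs1_neq0; apply: cabs_exprz; exact: P1 Pm.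
have r0 : (k %% m)%Z = 0.
  have := modz_ge0 k (_ : (m : int) != 0); have := ltz_pmod k (_ : 0 < (m : int)).
  case: (k %% m)%Z Pr => [[//|r] Pr /(_ m0) rm _|//].
    by have := m_min r.+1 _ isT Pr; rewrite leqNgt -ltz_nat rm.
  by move=> ? _ _ /(_ _); rewrite -lt0n m0 => /(_ isT).
move: Pr; rewrite r0 mulr0z => /P0_eq ec.
rewrite -[e](divfK c0) ec mul1r -zc kE r0 addr0 -/q mulrC.
by rewrite -[z ^+ m]/(z ^ m%:Z) exprz_exp.
Qed.

(** The circle is divisible: an m-th root of the value at the least positive multiple in the domain
    will do. If there is no such multiple, every value is compatible, and 1 is taken. *)
Lemma partial_character_step x : exists z, partial_character (adjoin P x z).
Proof.
have [P0 PB P0_eq P1] := pP.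
have [[m /andP[m0 /asboolP[c Pm]] m_min]|H] :=
    pselect (exists2 m, (0 < m)%N && `[< exists c, P (x *+ m) c >] &
      forall n e, (0 < n)%N -> P (x *+ n) e -> (m <= n)%N).
  have c1 := P1 _ _ Pm; exists (cexp (arg c / m%:R)).
  apply: partial_character_adjoin; first exact: cabs_cexp.
  apply: (partial_character_root m0 Pm m_min).
  rewrite -cexpMn (_ : _ *+ m = arg c) ?cexp_arg//.
  by rewrite -[LHS]mulr_natr divfK// pnatr_eq0 -lt0n.
have none n c : (0 < n)%N -> P (x *+ n) c -> False.
  move=> n0 Pn; apply: H.
  have ex : exists n, (0 < n)%N && `[< exists c, P (x *+ n) c >].
    by exists n; rewrite n0; apply/asboolP; exists c.
  case: (ex_minnP ex) => m hm m_min; exists m => // n' e n'0 Pe.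
  by apply: m_min; rewrite n'0; apply/asboolP; exists e.
exists 1; apply: partial_character_adjoin; first exact: cabs1.
move=> k c Pk; rewrite exp1rz; apply: P0_eq.
case: k Pk => [[//|n]|n] Pk.
  by case: (none n.+1 c).
case: (none n.+1 c^-1) => //; have := partial_characterN Pk.
by rewrite NegzE mulrNz opprK.
Qed.

End partial_character_theory.

Lemma trivial_partial_character : partial_character (fun a c => a = 0 /\ c = 1).
Proof.
split=> // [_ _ _ _ [-> ->] [-> ->]|c []|_ _ [_ ->]] //; last exact: cabs1.
by rewrite subrr divr1.
Qed.

(** For [x] of finite order m > 1 the value is exp(2 pi i / m); for infinite order any value is
    allowed, here -1. *)
Lemma partial_character_neq1 x : x != 0 -> exists P z,
  [/\ partial_character P, P x z & z <> 1].
Proof.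
move=> x0; pose P0 a c := a = 0 /\ c = 1.
have pP0 : partial_character P0 := trivial_partial_character.
have m1 : -1 <> 1 :> C.
  by move=> /eqP; rewrite -subr_eq0 -opprD oppr_eq0 -[1 + 1]/(2%:R) pnatr_eq0.
have [[m m0 [xm m_min]]|H] := pselect (exists2 m, (0 < m)%N & x *+ m = 0 /\
    forall n, (0 < n)%N -> x *+ n = 0 -> (m <= n)%N).
  pose z : C := cexp m%:R^-1.
  exists (adjoin P0 x z), z; split; last first.
  - move=> z1; have : m%:R^-1 = 0 :> R.
      apply: cexp_inj; last by rewrite cexp0.
        apply/unit_itvP; rewrite invr_ge0 ler0n invf_lt1 ?ltr0n// ltr1n.
        rewrite ltn_neqAle m0 andbT.
        by apply: contraNneq x0 => m1'; rewrite -m1' mulr1n in xm; rewrite xm.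
      by apply/unit_itvP; rewrite lexx ltr01.
    by move/eqP; rewrite invr_eq0 pnatr_eq0 -leqn0 leqNgt m0.
  - exact: adjoin_self.
  - apply: partial_character_adjoin => //; first exact: cabs_cexp.
    apply: (@partial_character_root P0 pP0 x m 1) => //.
      by move=> n e n0 [xn _]; exact: m_min.
    rewrite -cexpMn (_ : m%:R^-1 *+ m = 1) ?cexp1//.
    by rewrite -[LHS]mulr_natr mulVf// pnatr_eq0 -lt0n.
have none n : (0 < n)%N -> x *+ n <> 0.
  move=> n0 xn; apply: H.
  have ex : exists n, (0 < n)%N && (x *+ n == 0) by exists n; rewrite n0 xn eqxx.
  case: (ex_minnP ex) => m /andP[m0 /eqP xm] m_min; exists m => //; split=> // n' n'0 xn'.
  by apply: m_min; rewrite n'0 xn' eqxx.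
exists (adjoin P0 x (-1)), (-1); split=> //; last exact: adjoin_self.
apply: partial_character_adjoin => //; first by rewrite cabsN cabs1.
move=> [[|n]|n] c [xk ->] //; first by case: (none n.+1).
by case: (none n.+1) => //; apply: oppr_inj; rewrite oppr0.
Qed.

(** Starting from a character that is nontrivial at [x], the elements [s n] are adjoined in turn;
    the union of the chain is a character of the whole group. *)
Lemma characters_separate (s : nat -> G) (x : G) : (forall g, exists i, s i = g) ->
  x != 0 -> exists chi : G -> C,
  [/\ forall g, cabs (chi g) = 1, forall g g', chi (g + g') = chi g * chi g' &
      chi x <> 1].
Proof.
move=> s_surj /partial_character_neq1[P0 [z0 [pP0 P0x z0_neq1]]].
have /choice[ext hext] (Px : (G -> C -> Prop) * G) : exists z,
    partial_character Px.1 -> partial_character (adjoin Px.1 Px.2 z).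
  case: Px => P y /=; have [pP|] := pselect (partial_character P); last by exists 0.
  by have [z hz] := partial_character_step pP y; exists z.
pose P := fix P n := if n is m.+1 then adjoin (P m) (s m) (ext (P m, s m)) else P0.
have pP n : partial_character (P n).
  by elim: n => [//|n IHn]; exact: (hext (P n, s n)).
have P_mono m n a c : (m <= n)%N -> P m a c -> P n a c.
  elim: n => [|n IHn]; first by rewrite leqn0 => /eqP ->.
  rewrite leq_eqVlt => /predU1P[->//|]; rewrite ltnS => /IHn h /h.
  exact: adjoin_sub.
have /choice[nz hnz] (g : G) : exists nz : nat * C, P nz.1 g nz.2.
  have [i si] := s_surj g; exists (i.+1, ext (P i, s i)) => /=.
  by rewrite -si; exact: (adjoin_self (pP i)).
pose chi g := (nz g).2.
have chiE n g c : P n g c -> chi g = c.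
  move=> Pgc; apply: (partial_character_inj (pP (maxn n (nz g).1)) (a := g)).
    exact: P_mono (leq_maxr _ _) (hnz g).
  exact: P_mono (leq_maxl _ _) Pgc.
exists chi; split.
- by move=> g; have [_ _ _] := pP (nz g).1; apply; exact: hnz.
- move=> g g'; apply: (chiE (maxn (nz g).1 (nz g').1)).
  apply: partial_characterD (pP _) _ _ _ _ _ _.
    exact: P_mono (leq_maxl _ _) (hnz g).
  exact: P_mono (leq_maxr _ _) (hnz g').
- by rewrite (chiE 0%N x z0 P0x).
Qed.

End separation.

(** * The hypotheses on the dual group in terms of finite lists of elements *)

Section dual_topology.
Variables (R : realType) (G : zmodType).
Local Notation C := (R[i]^o).
Implicit Types (K : set {ptws G -> C}) (p : {ptws G -> C}).

Lemma nbhs_cabs (z : C) (r : R) : 0 < r -> nbhs z [set w : C | cabs (w - z) < r].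
Proof.
move=> r0; apply/nbhs_ballP; exists r%:C%C; first by rewrite /= ltcR.
by move=> w; rewrite /ball /= -[`|_|]/(`|(z : R[i]) - w|) cabsE ltcR cabsC.
Qed.

Lemma nbhs_seminorm p (F : seq G) (r : R) : 0 < r ->
  nbhs p [set q : {ptws G -> C} | seminorm F q p < r].
Proof.
elim: F r => [|g F IHF] r r0.
  by apply: filterE => q; rewrite /= /seminorm big_nil.
have r2 : 0 < r / 2 by rewrite divr_gt0.
have h1 : nbhs p [set q : {ptws G -> C} | cabs (q g - p g) < r / 2].
  exact: (@proj_continuous G (fun=> C) g p _ (nbhs_cabs (p g) r2)).
apply: filterS (filterI h1 (IHF _ r2)) => q [/= qg qF].
rewrite /seminorm big_cons -/(seminorm F q p) [r]splitr.
exact: ltrD.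
Qed.

Lemma continuous_cexp (phi : {ptws G -> C} -> R) (F : seq G) (L : R) :
  (forall x y, `|phi x - phi y| <= L * seminorm F x y) ->
  continuous (fun x => cexp (phi x) : C).
Proof.
move=> phi_lip p U /nbhs_ballP[e /= e0 eU].
(* The radius is a positive element of R[i], hence real. *)
have eE : e = (complex.Re e)%:C%C.
  move: e0; rewrite ltcE /= => /andP[/eqP i0 _].
  by rewrite [LHS]complexE i0 mulr0 addr0.
have /cexp_near1[d d0 hd] : 0 < complex.Re e by rewrite -ltcR -eE.
have L0 : 0 < `|L| + 1 by rewrite ltr_wpDl.
apply: filterS (nbhs_seminorm p F (divr_gt0 d0 L0)) => q /= qp.
apply: eU; rewrite /ball /= cabsE eE ltcR cabs_cexpB; apply: hd.
rewrite distrC; apply: le_lt_trans (phi_lip _ _) _.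
move: qp; rewrite ltr_pdivlMr// => qp; apply: le_lt_trans qp.
rewrite mulrC ler_wpM2l ?seminorm_ge0//.
by apply: le_trans (ler_norm _) _; rewrite lerDl.
Qed.

Lemma dual_cabs p : dual R G p -> forall g, cabs (p g) = 1.
Proof. by move=> [p1 _] g; apply/circleP. Qed.

(** The relation chi(g)^q = 1 passes from [K] to the subgroup it generates and by density to the
    whole dual, whose characters separate points. For q >= 2 this excludes the type K_q; for q = 1
    it shows that [K] itself separates points. *)
Lemma dual_exp (s : nat -> G) K (g : G) (q : nat) :
  (forall x, exists i, s i = x) -> K `<=` dual R G ->
  dual R G `<=` closure (generated K) ->
  (forall chi, K chi -> chi g ^+ q = 1) -> g *+ q = 0.
Proof.
move=> s_surj K_dual K_dense Kq.
pose H := [set x : {ptws G -> C} | cabs (x g) = 1 /\ x g ^+ q = 1].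
have KH : generated K `<=` H.
  apply: smallest_sub => [|chi Kchi]; last first.
    by split; [exact: dual_cabs (K_dual _ Kchi) g|exact: Kq].
  split.
  - by split; [exact: cabs1|rewrite expr1n].
  - by move=> x y [x1 xq] [y1 yq]; split; rewrite ?cabsM ?x1 ?y1 ?mulr1// exprMn xq yq mulr1.
  - by move=> x [x1 xq]; split; [exact: cabsV|rewrite exprVn xq invr1].
have dualq chi : dual R G chi -> chi g ^+ q = 1.
  move=> dchi; have chi1 := dual_cabs dchi g.
  apply/eqP; rewrite -subr_eq0 -cabs_eq0 eq_le cabs_ge0 andbT.
  (* A point of the generated subgroup within 1/m of [chi] at [g] has q-th power 1 there, so
     [chi g ^+ q] is within q/m of 1. *)
  apply: (@le0_of_inv R _ q%:R 1) => // m m0.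
  have m0' : 0 < m%:R^-1 :> R by rewrite invr_gt0 ltr0n.
  have [x [/KH[x1 xq]]] := K_dense _ dchi _ (nbhs_seminorm chi [:: g] m0').
  rewrite /= /seminorm big_seq1 => xchi.
  rewrite -xq cabsC; apply: le_trans (cabs_exprB _ x1 chi1) _.
  by rewrite ler_wpM2l// ltW.
apply/eqP; apply: contraT => gq0.
have [chi [chi1 chiD]] := characters_separate R s_surj gq0; case.
rewrite (characterMn chi1 chiD); apply: dualq; split; last exact: chiD.
by move=> g'; apply/circleP.
Qed.

(** [chi] corresponds to a point x of D_q under a multiplicative bijection; x^q = 1 then gives the
    same for [chi]. *)
Lemma type_K_exp K (q : nat) chi g : type_K q K -> K chi -> chi g ^+ q = 1.
Proof.
move=> [[H [_ H_dual [phi [psi [phiH psiT phiM _ _]]] KH]] _] Kchi.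
have [Tx chiE] := psiT _ (KH _ Kchi); set x := psi chi in Tx chiE.
pose one : {ptws nat -> C} := fun=> 1.
have T1 : torsion_product q one by move=> n; exact: expr1n.
have phi1 g' : phi one g' = 1.
  have := phiM _ _ T1 T1; rewrite (_ : (fun i => _) = one); last first.
    by apply/funext => i; rewrite mulr1.
  move=> /(congr1 (fun f => f g')) /= e.
  have n0 : phi one g' != 0 by apply/cabs1_neq0/dual_cabs/H_dual; case: (phiH _ T1).
  by apply: (mulIf n0); rewrite mul1r -e.
have pow n : torsion_product q (fun i => x i ^+ n) /\
    phi (fun i => x i ^+ n) g = chi g ^+ n.
  elim: n => [|n [Tn IHn]].
    rewrite (_ : (fun i => _) = one) ?phi1//.
  have Tn1 : torsion_product q (fun i => x i ^+ n.+1).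
    by move=> i; rewrite /roots_of_unity /= exprAC (Tx i) expr1n.
  split=> //; rewrite exprS -IHn -[in RHS]chiE.
  have := phiM _ _ Tx Tn => /(congr1 (fun f => f g)) /= <-.
  by congr (phi _ g); apply/funext => i; rewrite exprS.
have [_ <-] := pow q.
rewrite (_ : (fun i => _) = one) ?phi1//.
by apply/funext => i; exact: Tx.
Qed.

End dual_topology.

Theorem proposition7p5 (R : realType) (Gamma : zmodType)
    (Gamma_countable : countable [set: Gamma])
    (Gamma_exponent : infinite_exponent Gamma)
    (dual_generated : topologically_kronecker_generated R Gamma) :
  exists r : nat -> Gamma,
    forall t : Gamma, freely_rigid_recurrent R Gamma (fun n => r n - t).
Proof.
(* Pairs are enumerated at once, so that every (t, g) occurs as (s i, h i) at one common position
   i. *)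
have [sh sh_surj] : exists sh : nat -> Gamma * Gamma, forall x, exists i, sh i = x.
  have /countable_injP[f f_inj] := Gamma_countable.
  have /choice[sh hsh] n : exists x, forall y : Gamma * Gamma,
      pickle (f y.1, f y.2) = n -> y = x.
    have [[y yn]|H] := pselect (exists y : Gamma * Gamma, pickle (f y.1, f y.2) = n).
      exists y => -[a b] abn; move: yn; rewrite -abn.
      move=> /(pcan_inj (@pickleK _))[/f_inj fa /f_inj fb].
      by rewrite -fa ?inE// -fb ?inE// -surjective_pairing.
    by exists (0, 0) => y yn; case: H; exists y.
  by exists sh => x; exists (pickle (f x.1, f x.2)); exact/esym/hsh.
pose s i := (sh i).1; pose h i := (sh i).2.
have s_surj g : exists i, s i = g.
  by have [i si] := sh_surj (g, 0); exists i; rewrite /s si.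
have [_ [K [K_dual [K_closed K_lim] K_type K_dense]]] := dual_generated.
case: K_type => [[_ K_kron]|[q [q2 Kq]]]; last first.
  exfalso; apply: Gamma_exponent; exists q; split; first exact: leq_trans q2.
  move=> g; apply: (dual_exp s_surj K_dual K_dense) => chi; exact: type_K_exp.
have K_sep g : g != 0 -> exists2 chi, K chi & chi g <> 1.
  move=> g0; apply: contrapT => H; move/eqP: g0; apply.
  rewrite -[g]mulr1n; apply: (dual_exp s_surj K_dual K_dense) => chi Kchi.
  by rewrite expr1; apply: contrapT => chig; apply: H; exists chi.
have K0 : K !=set0.
  have [g g0] : exists g : Gamma, g != 0.
    apply: contrapT => H; apply: Gamma_exponent; exists 1%N; split=> // x.
    by rewrite mulr1n; apply/eqP; apply: contrapT => /negP x0; apply: H; exists x.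
  by have [chi Kchi _] := K_sep g g0; exists chi.
have [Phi Phi_coding] : exists Phi, @coding R Gamma Phi h.
  apply: (@kronecker_coding R Gamma K s h) => //.
  - by move=> chi /K_dual; exact: dual_cabs.
  - by move=> chi /K_dual[].
  - move=> p F r Kp r0.
    have : limit_point K p by rewrite K_lim.
    move=> /(_ _ (nbhs_seminorm p F r0))[y [/eqP yp Ky yr]]; by exists y.
  - move=> phi F L eps phi_lip eps0.
    have cphi := @continuous_subspaceT _ _ K _ (continuous_cexp phi_lip).
    have [|g hg] := K_kron _ cphi _ _ eps0.
      by move=> chi _; apply/circleP; exact: cabs_cexp.
    exists g => chi Kchi; rewrite -lte_fin; apply: le_lt_trans hg.
    by apply: ereal_sup_ubound; exists chi.
apply: (freely_rigid_recurrent_of_coding (s := s) Phi_coding).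
by move=> g g'; have [i si] := sh_surj (g, g'); exists i; rewrite /s /h si.
Qed.
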